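(* Let $\Omega$ be a compact subset of $\mathbb{R}^n$, let $f,g:\Omega\to\mathbb{R}^n$ be Lipschitz vector fields, and let $q$ belong to the interior of $\Omega$. Then the set $[f,g]_{set}(q)$ is a QDQ of the function $$F:\varepsilon\mapsto\Psi_{\sqrt{\varepsilon}}(q)$$ at the point $(0,q)$ in the direction of $\mathbb{R}^+=[0,+\infty)$.
   Context: Flows: for a Lipschitz vector field $f$, $\Phi^f_t(q)$ denotes the value at time $t$ of the solution of $y'(\tau)=f(y(\tau))$, $y(0)=q$ (defined for $|t|$ small when $q$ is interior to the domain). Set $$\Psi_t(q):=\big[\Phi_t^{-g}\circ\Phi_t^{-f}\circ\Phi_t^{g}\circ\Phi_t^{f}\big](q),$$ which is defined for $t\ge0$ small; accordingly $F(\varepsilon)=\Psi_{\sqrt\varepsilon}(q)$ is defined for small $\varepsilon\ge0$ (the QDQ notion below is local, so the values of $F$ elsewhere are irrelevant). Set-valued Lie bracket: at points where $f$ and $g$ are both differentiable, $[f,g]:=Dg\cdot f-Df\cdot g$. Let $\mathrm{Diff}(f)$, $\mathrm{Diff}(g)$ be the sets of differentiability points of $f$ and $g$. Then $$[f,g]_{set}(q):=\overline{\mathrm{co}}\Big\{\lim_{k\to\infty}[f,g](q_k)\Big\},$$ where the limits range over all sequences $q_k\to q$ with $q_k\in\mathrm{Diff}(f)\cap\mathrm{Diff}(g)$ for which the limit exists, and $\overline{\mathrm{co}}$ is the closure of the convex hull. Vectors in $\mathbb{R}^n$ are identified with elements of $\mathrm{Lin}(\mathbb{R},\mathbb{R}^n)$.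 Definition (QDQ). $\rightsquigarrow$ denotes a set-valued map (a single-valued map is regarded as set-valued with singleton values), $\mathrm{Lin}(V,W)$ the space of linear maps, $B_\delta$ the ball of radius $\delta$ centered at $0$ (open or closed balls give equivalent definitions), $d$ the distance induced by a norm. A modulus is a non-decreasing function $\rho:[0,+\infty)\to[0,+\infty)$ with $\lim_{\delta\to0^+}\rho(\delta)=0$. Let $F:\mathbb{R}^k\rightsquigarrow\mathbb{R}^m$, $(\bar x,\bar y)\in\mathbb{R}^k\times\mathbb{R}^m$, $\Lambda\subset\mathrm{Lin}(\mathbb{R}^k,\mathbb{R}^m)$ compact, and $\Gamma\subseteq\mathbb{R}^k$ any subset. $\Lambda$ is a Quasi Differential Quotient (QDQ) of $F$ at $(\bar x,\bar y)$ in the direction of $\Gamma$ if there exist $\delta^*\in(0,+\infty]$ and a modulus $\rho$ such that for every $\delta\in(0,\delta^* )$ there is a continuous map $(L_\delta,h_\delta):(\bar x+B_\delta)\cap\Gamma\to\mathrm{Lin}(\mathbb{R}^k,\mathbb{R}^m)\times\mathbb{R}^m$ such that, for all $x\in(\bar x+B_\delta)\cap\Gamma$, $$d(L_\delta(x),\Lambda)\le\rho(\delta),\qquad |h_\delta(x)|\le\delta\rho(\delta),\qquad \bar y+L_\delta(x)\cdot(x-\bar x)+h_\delta(x)\in F(x).$$ *)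

(* Defs.v *)
From HB Require Import structures.
From mathcomp Require Import all_boot all_order all_algebra.
From mathcomp Require Import all_classical all_reals all_analysis.

Set Implicit Arguments.
Unset Strict Implicit.
Unset Printing Implicit Defensive.

Import Order.TTheory GRing.Theory Num.Theory.
Import numFieldNormedType.Exports.

Local Open Scope classical_set_scope.
Local Open Scope ring_scope.

(* R^n is 'rV[R]_n with the sup norm, and Lin(R^k, R^m) is 'M[R]_(k, m) acting
   on row vectors by x |-> x *m L.  In particular R is 'rV[R]_1 as the domain of
   a set-valued map, and the identification of R^n with Lin(R, R^n) is the
   definitional equality of 'rV[R]_n and 'M[R]_(1, n).

   A vector field on Omega is given by a total function of which only the
   values on Omega are used. *)

(* p is the value at time t of a solution of y' = f(y), y(0) = q, living in
   Omega on an open interval that contains 0 and t. *)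
Definition flow_value (R : realType) (n : nat) (Omega : set 'rV[R]_n)
    (f : 'rV[R]_n -> 'rV[R]_n) (t : R) (q p : 'rV[R]_n) : Prop :=
  exists (y : R -> 'rV[R]_n) (a b : R),
    [/\ 0 \in `]a, b[, t \in `]a, b[, y 0 = q, y t = p &
        forall s : R, s \in `]a, b[ ->
          Omega (y s) /\ is_derive s 1 y (f (y s))].

(* The value is unique when f is Lipschitz on Omega; the default 0 is returned
   where the flow is not defined. *)
Definition flow (R : realType) (n : nat) (Omega : set 'rV[R]_n)
    (f : 'rV[R]_n -> 'rV[R]_n) (t : R) (q : 'rV[R]_n) : 'rV[R]_n :=
  xget 0 [set p | flow_value Omega f t q p].

Definition Psi (R : realType) (n : nat) (Omega : set 'rV[R]_n)
    (f g : 'rV[R]_n -> 'rV[R]_n) (t : R) : 'rV[R]_n -> 'rV[R]_n :=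
  flow Omega (fun x => - g x) t \o flow Omega (fun x => - f x) t
    \o flow Omega g t \o flow Omega f t.

(* Differentiability is restricted to the interior of Omega, where it does not
   depend on the values of f outside Omega. *)
Definition Diff (R : realType) (n : nat) (Omega : set 'rV[R]_n)
    (f : 'rV[R]_n -> 'rV[R]_n) : set 'rV[R]_n :=
  [set x | interior Omega x /\ differentiable f x].

Definition lie_bracket (R : realType) (n : nat)
    (f g : 'rV[R]_n -> 'rV[R]_n) (x : 'rV[R]_n) : 'rV[R]_n :=
  'd g x (f x) - 'd f x (g x).

Definition convex_hull (R : realType) (n : nat) (A : set 'rV[R]_n) :
    set 'rV[R]_n :=
  smallest (@convex_set R 'rV[R]_n) A.

Definition lie_bracket_set (R : realType) (n : nat) (Omega : set 'rV[R]_n)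
    (f g : 'rV[R]_n -> 'rV[R]_n) (q : 'rV[R]_n) : set 'rV[R]_n :=
  closure (convex_hull
    [set v | exists q_ : nat -> 'rV[R]_n,
       [/\ forall k, (Diff Omega f `&` Diff Omega g) (q_ k),
           q_ k @[k --> \oo] --> q &
           lie_bracket f g (q_ k) @[k --> \oo] --> v]]).

(* Only the values of rho on [0, +oo[ are relevant. *)
Definition modulus (R : realType) (rho : R -> R) : Prop :=
  [/\ forall x : R, 0 <= x -> 0 <= rho x,
      forall x y : R, 0 <= x -> x <= y -> rho x <= rho y &
      rho x @[x --> 0^'+] --> 0].

Definition QDQ (R : realType) (k m : nat) (F : 'rV[R]_k -> set 'rV[R]_m)
    (xbar : 'rV[R]_k) (ybar : 'rV[R]_m) (Lambda : set 'M[R]_(k, m))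
    (Gamma : set 'rV[R]_k) : Prop :=
  compact Lambda /\
  exists (deltamax : \bar R) (rho : R -> R),
    [/\ (0 < deltamax)%E, modulus rho &
      forall delta : R, 0 < delta -> (delta%:E < deltamax)%E ->
      exists (L : 'rV[R]_k -> 'M[R]_(k, m)) (h : 'rV[R]_k -> 'rV[R]_m),
        {within ball xbar delta `&` Gamma, continuous (fun x => (L x, h x))} /\
        forall x : 'rV[R]_k, (ball xbar delta `&` Gamma) x ->
          [/\ (edist_inf Lambda (L x) <= (rho delta)%:E)%E,
              `|h x| <= delta * rho delta &
              F x (ybar + (x - xbar) *m L x + h x)]].

(* Main.v *)
Require Import Defs.
From HB Require Import structures.
From mathcomp Require Import all_boot all_order all_algebra.
From mathcomp Require Import all_classical all_reals all_analysis.
From mathcomp Require Import finmap measurable_realfun.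
From mathcomp Require Import lra ring.
Import Order.TTheory GRing.Theory Num.Theory.
Import numFieldNormedType.Exports.
Local Open Scope classical_set_scope.
Local Open Scope ring_scope.
Set Implicit Arguments.
Unset Strict Implicit.
Unset Printing Implicit Defensive.

(** The quotient [t^-2 (Psi_t(q) - q)] approaches the set-valued bracket
    [Lambda] as [t -> 0+] ([bracket_estimate]).  Given this, the maps required
    by the definition of a QDQ are explicit: [L_delta(eps)] is the quotient at
    the time [sqrt (max(eps, delta^2))], and [h_delta] restores the identity
    for [eps < delta^2], at the price of an error of order [delta^2]
    ([QDQ_of_quotient]).

    Since [Lambda] is compact and convex, the distance from the quotient to
    [Lambda] is seen by one linear functional [l], obtained by projecting the
    quotient on [Lambda] ([convex_projection]).  It is thus enough to bound
    [l(Psi_t(q) - q)] by [t^2 (max_Lambda l + small)].  Replacing each of the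
    four flow arcs by a straight segment and integrating the fields along these
    segments shows that, up to [O(t^3)] and to a discretization error,
    [Psi_t(q) - q] is the integral over [0 <= s <= t] of
    [(g(q + t f(q) + s g(q)) - g(q + s g(q)))
     - (f(q + s f(q) + t g(q)) - f(q + s f(q)))] ([Psi_expansion]).

    For smooth fields this is the integral of [Dg.f(q) - Df.g(q)] over the
    parallelogram spanned by [t f(q)] and [t g(q)].  For Lipschitz fields the
    derivatives exist almost everywhere only, and the parallelogram may be a
    null set without any point of differentiability.  The remedy is to let the
    base point vary: the discretized integral depends on it in a Lipschitz way,
    uniformly in the mesh, so that its value at [q] is close to its mean over
    base points in a small ball; and translation invariance together with
    dominated convergence bounds this mean by the almost everywhere derivatives
    ([averaging]).  By Rademacher's theorem ([rademacher]) almost every point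
    [x] close to [q] is a common differentiability point, and there
    [l([f,g](x))] is at most [max_Lambda l + small], because all limit values of
    [[f,g]] at [q] belong to [Lambda] ([limit_set_near]).

    Rademacher's theorem is obtained for a locally finite translation-invariant
    measure ([exists_translation_invariant]): derivability at almost every
    point of each line gives directional derivatives almost everywhere
    ([lip_ae_derivable_dir]), these are additive in the direction almost
    everywhere ([ae_deriveD]), and countably many directions determine the
    differential ([gateaux_differentiable]).  The flows come from Picard
    iteration ([picard], [local_flow]). *)

(** * Lipschitz functions of one real variable *)

Definition lip_with (R : realType) (V W : normedModType R) (K : R)
  (u : V -> W) := forall x y, `|u x - u y| <= K * `|x - y|.

Lemma lip_with_continuous (R : realType) (V W : normedModType R) (K : R)
  (u : V -> W) : lip_with K u -> continuous u.
Proof.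
move=> uK x; apply/cvgrPdist_le => e e0.
have K0 : 0 < `|K| + 1 by rewrite ltr_pwDr.
have := @cvgr_dist_le _ _ _ (nbhs x) _ id x cvg_id (e / (`|K| + 1)).
rewrite divr_gt0// => /(_ _ isT); apply: filterS => y xy.
rewrite (le_trans (uK _ _))// (@le_trans _ _ ((`|K| + 1) * `|x - y|))//.
  by rewrite ler_wpM2r// ler_wpDr// ler_norm.
by rewrite mulrC -ler_pdivlMr.
Qed.

Section derivable_1d.
Variable R : realType.
Local Notation leb := (@lebesgue_measure R).

(** The functions [(x + u x) / 2] and [(x - u x) / 2] are both nondecreasing and
    add up to [x], so their Stieltjes measures add up to the Lebesgue measure, which
    therefore dominates each of them. *)
Lemma nonexpansive_stieltjes (u : R -> R) : lip_with 1 u ->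
  exists v : cumulative R R, (forall x, v x = (x + u x) / 2) /\
    lebesgue_stieltjes_measure v `<< leb.
Proof.
move=> u1.
have half (w : R -> R) : lip_with 1 w ->
    exists v : cumulative R R, forall x, v x = (x + w x) / 2.
  move=> w1.
  pose v x := (x + w x) / 2.
  have vnd : nondecreasing v.
    move=> x y xy; rewrite /v; have := w1 x y.
    rewrite (distrC x y) (ger0_norm (_ : 0 <= y - x)) ?subr_ge0//.
    by rewrite ler_norml; lra.
  have vrc : right_continuous v.
    apply: right_continuousW => x; rewrite /v; apply: cvgMl.
    by apply: cvgD; [exact: cvg_id|exact: (lip_with_continuous w1)].
  by exists (HB.pack_for (cumulative R R) v (isCumulative.Build R _ R v vnd vrc)).
have [v vE] := half u u1.
have [w wE] : exists w : cumulative R R, forall x, w x = (x - u x) / 2.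
  apply: (half (fun x => - u x)) => x y.
  by rewrite -opprD normrN; exact: u1.
exists v; split => //.
pose nu := lebesgue_stieltjes_measure v : {measure set (measurableTypeR R) -> \bar R}.
pose nu' := lebesgue_stieltjes_measure w : {measure set (measurableTypeR R) -> \bar R}.
have vw A : measurable A -> leb A = measure_add nu nu' A.
  apply: lebesgue_measure_unique => X [[a b] _ <-].
  rewrite [RHS](measure_addE nu nu') /nu /nu' /=.
  rewrite /lebesgue_measure /lebesgue_stieltjes_measure.
  rewrite /measure_extension !measurable_mu_extE//=; try exact: is_ocitv.
  rewrite !wlength_itv /= lte_fin; case: ltP => ab; last by rewrite adde0.
  by rewrite -!EFinD vE wE vE wE; congr (_%:E) => /=; lra.
apply/null_content_dominatesP => A mA A0.
apply/eqP; rewrite -measure_le0 -A0 [leRHS](vw A mA) (measure_addE nu nu').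
exact: leeDl.
Qed.

(** After scaling to the constant 1, [(x + u x) / 2] is on each bounded interval
    the distribution function of a finite measure dominated by the Lebesgue measure,
    hence a primitive of its Radon-Nikodym density, and a primitive is derivable
    almost everywhere. *)
Lemma lip_ae_derivable (u : R -> R) (K : R) : lip_with K u ->
  leb.-negligible [set x | ~ derivable u x 1].
Proof.
wlog: K u / K = 1.
  move=> H uK; pose K' := `|K| + 1.
  have K'0 : 0 < K' by rewrite /K' ltr_pwDr.
  have h1 : lip_with 1 (fun x => K'^-1 * u x).
    move=> x y; rewrite -mulrBr normrM gtr0_norm ?invr_gt0//.
    rewrite mul1r mulrC ler_pdivrMr// mulrC (le_trans (uK x y))//.
    by rewrite ler_wpM2r// /K' ler_wpDr// ler_norm.
  have := H 1 _ erefl h1; apply: negligibleS => x /= + d; apply.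
  have -> : u = (fun x => K' * (K'^-1 * u x)).
    by apply/funext => y; rewrite mulVKf// gt_eqF.
  by apply: (@derivableZ _ _ _ _ K'); exact: d.
move=> -> u1.
have [v [vE nuleb]] := nonexpansive_stieltjes u1.
have uE : u = (fun x => 2 * v x - x) by apply/funext => x; rewrite vE; lra.
suff H : forall m : nat,
    leb.-negligible [set x | (x \in `]- m%:R, m%:R[) /\ ~ derivable u x 1].
  apply: (@negligibleS _ _ _ leb) (negligible_bigcup H) => x /= nd.
  exists (Num.truncn `|x|).+1 => //=; split => //; rewrite in_itv/= -ltr_norml.
  exact: Num.Theory.truncnS_gt.
move=> m.
pose mu := lebesgue_stieltjes_measure v : {measure set (measurableTypeR R) -> \bar R}.
pose D : set (measurableTypeR R) := `]- m%:R, m%:R]%classic.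
have mD : measurable D by exact: measurable_itv.
have nuI (a b : R) : a <= b ->
    mu `]a, b]%classic = (v b - v a)%:E.
  move=> ab; rewrite /mu /= /lebesgue_stieltjes_measure /measure_extension.
  rewrite measurable_mu_extE/=; last exact: is_ocitv.
  by rewrite wlength_itv_bnd.
have Dfin : (mu D < +oo)%E.
  by rewrite nuI ?ltry// lerNl; rewrite (le_trans _ (ler0n _ _)).
pose nu : {finite_measure set (measurableTypeR R) -> \bar R} := mfrestr mD Dfin.
have nu_leb : nu `<< leb.
  apply/null_content_dominatesP => A mA A0.
  move/null_content_dominatesP: nuleb; apply; first exact: measurableI.
  apply/eqP; rewrite -measure_le0 -A0; apply: le_measure => //; apply: mem_set => //.
  exact: measurableI.
have [phi [phi0 phif phii nuphi]] := radon_nikodym_sigma_finite nu_leb.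
pose f := fine \o phi.
have phiE : EFin \o f = phi by apply/funext => x; rewrite /f/= fineK.
have fi : leb.-integrable setT (EFin \o f) by rewrite phiE.
have fiS A : measurable A -> leb.-integrable A (EFin \o f).
  by move=> mA; exact: integrableS fi.
have := FTC1 (a := BRight (- m%:R)) (f := f) (fun y => fiS _ (measurable_itv _))
  (open_integrable_locally openT fi).
rewrite /almost_everywhere/=; apply: negligibleS => x [/=].
rewrite in_itv/= => /andP[mx xm] ndu; apply/not_implyP; split; first by [].
case=> dF _; apply: ndu; rewrite uE.
suff dv : derivable v x 1.
  by apply: (@derivableB _ _ _ (fun x => 2 *: v x) id);
    [exact: (@derivableZ _ _ _ v 2)|exact: derivable_id].
suff : derivable (fun x => v x - v (- m%:R)) x 1.
  move=> d; have := derivableD d (derivable_cst (v (- m%:R)) x 1).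
  by apply: near_eq_derivable; near=> y => /=; exact: subrK.
apply: near_eq_derivable dF.
near=> y => /=.
have my : - m%:R < y by near: y; exact: lt_nbhsr.
have ym : y < m%:R by near: y; exact: lt_nbhsl.
rewrite /Rintegral.
transitivity (fine (nu `]- m%:R, y]%classic)).
  rewrite nuphi; last exact: measurable_itv.
  by congr fine; apply: eq_integral => z _; rewrite -phiE.
have -> : nu `]- m%:R, y]%classic = mu (`]- m%:R, y]%classic `&` D) by [].
rewrite setIidl ?nuI ?(ltW my)//.
by apply: subset_itvl; rewrite bnd_simp ltW.
Unshelve. all: by end_near. Qed.

End derivable_1d.

(** * Norm and Borel sets of R^n *)

Lemma rV_norm_ltP (R : realType) n (x : 'rV[R]_n) (e : R) : 0 < e ->
  (`|x| < e) <-> (forall i, `|x 0 i| < e).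
Proof.
move=> e0; rewrite -[ `|x|]/(mx_norm x) mx_normrE; split.
  by move=> /bigmax_ltP[_ h] i; exact: (h (0, i)).
by move=> h; apply/bigmax_ltP; split => // -[i j] _; rewrite ord1.
Qed.

Lemma rV_norm_leP (R : realType) n (x : 'rV[R]_n) (e : R) : 0 <= e ->
  (`|x| <= e) <-> (forall i, `|x 0 i| <= e).
Proof.
move=> e0; rewrite -[ `|x|]/(mx_norm x) mx_normrE; split.
  by move=> /bigmax_leP[_ h] i; exact: (h (0, i)).
by move=> h; apply/bigmax_leP; split => // -[i j] _; rewrite ord1.
Qed.

Lemma rV_coord_le (R : realType) n (x : 'rV[R]_n) i : `|x 0 i| <= `|x|.
Proof. by move: i; apply/rV_norm_leP. Qed.

Definition rat_rV (R : realType) n (v : 'rV[rat]_n) : 'rV[R]_n := map_mx ratr v.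

Lemma rat_rV_dense (R : realType) n (x : 'rV[R]_n) (e : R) : 0 < e ->
  exists v, `|x - rat_rV R v| < e.
Proof.
move=> e0.
have /choice[w wP] : forall i, exists p : rat, `|x 0 i - ratr p| < e.
  move=> i; have : x 0 i - e < x 0 i + e by lra.
  by move=> /rat_in_itvoo[p]; rewrite in_itv/= => h; exists p; rewrite ltr_distlC.
by exists (\row_i w i); apply/rV_norm_ltP => // i; rewrite !mxE.
Qed.

(** Generated by the open sets, so that continuous maps are measurable by
    definition; [open_prod_borel] relates it to product sigma-algebras. *)
Definition borel_rV (R : realType) (n : nat) : measurableType _ :=
  g_sigma_algebraType (@open 'rV[R]_n).

Lemma open_borel_rV (R : realType) n (A : set 'rV[R]_n) :
  open A -> measurable (A : set (borel_rV R n)).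
Proof. by move=> oA; exact: sub_sigma_algebra. Qed.

Lemma continuous_borel_rV (R : realType) n m (u : 'rV[R]_n -> 'rV[R]_m) :
  continuous u ->
  measurable_fun (setT : set (borel_rV R n)) (u : _ -> borel_rV R m).
Proof.
move=> /continuousP cu; 
apply: (@measurability _ _ (borel_rV R n) (borel_rV R m) setT u (@open 'rV[R]_m)) => //.
by move=> _ [B oB <-]; rewrite setTI; apply: open_borel_rV; exact: cu.
Qed.

Lemma continuous_borel_R (R : realType) n (u : 'rV[R]_n -> R) :
  continuous u -> measurable_fun (setT : set (borel_rV R n)) u.
Proof.
move=> /continuousP cu.
apply: (measurability _ (measurable_realfun.RGenOpens.measurableE R)) => //.
move=> _ [_ [a [b ->]] <-]; rewrite setTI; apply: open_borel_rV; apply: cu.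
exact: interval_open.
Qed.

(** By second countability: an open set is the union of the countably many
    products of balls with rational centers that it contains. *)
Lemma open_prod_borel (R : realType) n (W : set (R * 'rV[R]_n)) : open W ->
  measurable (W : set (measurableTypeR R * borel_rV R n)).
Proof.
move=> oW.
pose I := (rat * 'rV[rat]_n * nat)%type.
pose B (i : I) : set (R * 'rV[R]_n) :=
  ball (ratr i.1.1 : R) i.2.+1%:R^-1 `*` ball (rat_rV R i.1.2) i.2.+1%:R^-1.
pose F i := if pselect (B i `<=` W) then B i else set0.
have -> : W = \bigcup_i F i.
  apply/seteqP; split => [[s x] Wsx|p [i _]]; last first.
    by rewrite /F; case: pselect => // BW /BW.
  have [e e0 sub] : exists2 e : R, 0 < e & ball (s, x) e `<=` W.
    by apply/nbhs_ballP; apply: open_nbhs_nbhs.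
  have e20 : 0 < e / 2 by rewrite divr_gt0.
  have [k ke] : exists k, k.+1%:R^-1 < e / 2.
    by have [k _ /(_ k (leqnn k))] := near_infty_natSinv_lt (PosNum e20); exists k.
  have k0 : 0 < k.+1%:R^-1 :> R by rewrite invr_gt0.
  have [v xv] := rat_rV_dense x k0.
  have [p sp] : exists p : rat, `|s - ratr p| < k.+1%:R^-1.
    have : s - k.+1%:R^-1 < s + k.+1%:R^-1 by rewrite ltrD2l (lt_trans _ k0)// oppr_lt0.
    by move=> /rat_in_itvoo[p]; rewrite in_itv/= => h; exists p; rewrite ltr_distlC.
  exists (p, v, k) => //; rewrite /F; case: (pselect _) => [BW|nBW]; last first.
    exfalso; apply: nBW => -[s' x'] [/=]; rewrite -!ball_normE/= => ss' xx'; apply: sub.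
    split; rewrite -ball_normE/=.
      rewrite (le_lt_trans (ler_distD (ratr p) _ _))// [ltRHS](splitr e).
      by rewrite ltrD// (lt_trans _ ke).
    rewrite (le_lt_trans (ler_distD (rat_rV R v) _ _))// [ltRHS](splitr e).
    by rewrite ltrD// (lt_trans _ ke).
  by split; rewrite -ball_normE/= distrC.
apply: countable_bigcupT_measurable; first exact: countableP.
move=> i; rewrite /F; case: (pselect _) => [BW|nBW]; last exact: measurable0.
apply: measurableX; first by apply: open_measurable; exact: ball_open.
by apply: open_borel_rV; exact: ball_open.
Qed.

Lemma continuous_prod_borel (R : realType) n m (u : R * 'rV[R]_n -> 'rV[R]_m) :
  continuous u -> measurable_fun
  (setT : set (measurableTypeR R * borel_rV R n)) (u : _ -> borel_rV R m).
Proof.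
move=> /continuousP cu.
apply: (@measurability _ _ (measurableTypeR R * borel_rV R n)%type (borel_rV R m)
  setT u (@open 'rV[R]_m)) => //.
by move=> _ [B oB <-]; rewrite setTI; apply: open_prod_borel; exact: cu.
Qed.

(** * A translation-invariant measure on R^n *)

Lemma lebesgue_translation (R : realType) (a : R) (A : set R) : measurable A ->
  lebesgue_measure ((fun x : R => x + a) @^-1` A) = lebesgue_measure A.
Proof.
have mt : measurable_fun (setT : set (measurableTypeR R))
    ((fun x : R => x + a) : _ -> measurableTypeR R).
  by apply: measurable_funD => //; exact: measurable_cst.
pose t : {mfun measurableTypeR R >-> measurableTypeR R} :=
  HB.pack_for {mfun measurableTypeR R >-> measurableTypeR R}
  (fun x : R => x + a) (isMeasurableFun.Build _ _ _ _ _ mt).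
move=> mA; apply/esym.
apply: (@lebesgue_measure_unique R (pushforward lebesgue_measure t)) => //.
move=> X [[x y] _ <-]; 
have tE : t @^-1` `]x, y]%classic = `]x - a, y - a]%classic.
  by apply/seteqP; split => z /=; rewrite !in_itv/= ltrBlDr lerBrDr.
transitivity (lebesgue_measure (`]x - a, y - a]%classic : set (measurableTypeR R))); last by rewrite -tE.
rewrite !lebesgue_measure_itv/= !lte_fin ltrD2r.
by case: ifP => // _; rewrite -!EFinD; congr (_%:E); lra.
Qed.

(** R^(n+1) as R x R^n, the step of the induction on the dimension. *)
Definition cons_rV (R : realType) n (p : R * 'rV[R]_n) : 'rV[R]_n.+1 :=
  row_mx (const_mx p.1 : 'rV_1) p.2.

Lemma cons_rV_head (R : realType) n (p : R * 'rV[R]_n) (j : 'I_1) :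
  cons_rV p 0 (@lshift 1 n j) = p.1.
Proof. exact: etrans (row_mxEl (const_mx p.1) p.2 0 j) (mxE _ _ 0 j). Qed.

Lemma cons_rV_tail (R : realType) n (p : R * 'rV[R]_n) (j : 'I_n) :
  cons_rV p 0 (@rshift 1 n j) = p.2 0 j.
Proof. exact: row_mxEr (const_mx p.1) p.2 0 j. Qed.

Lemma cons_rV_norm_lt (R : realType) n (p : R * 'rV[R]_n) (r : R) : 0 < r ->
  (`|cons_rV p| < r) <-> (`|p.1| < r /\ `|p.2| < r).
Proof.
move=> r0; rewrite !rV_norm_ltP//; split.
  move=> h; split=> [|i]; first by have := h (@lshift 1 n 0); rewrite cons_rV_head.
  by have := h (@rshift 1 n i); rewrite cons_rV_tail.
move=> [h1 h2] i; case: (split_ordP (i : 'I_(1 + n))) => j ->.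
  by rewrite cons_rV_head.
by rewrite cons_rV_tail.
Qed.

Lemma cons_rVD (R : realType) n (p p' : R * 'rV[R]_n) :
  cons_rV (p + p') = cons_rV p + cons_rV p'.
Proof.
apply/rowP => i; rewrite [RHS]mxE; case: (split_ordP (i : 'I_(1 + n))) => j ->.
  by rewrite !cons_rV_head.
by rewrite !cons_rV_tail mxE.
Qed.

Lemma cons_rVN (R : realType) n (p : R * 'rV[R]_n) :
  cons_rV (- p) = - cons_rV p.
Proof.
apply/rowP => i; rewrite [RHS]mxE; case: (split_ordP (i : 'I_(1 + n))) => j ->.
  by rewrite !cons_rV_head.
by rewrite !cons_rV_tail mxE.
Qed.

Lemma cons_rV_continuous (R : realType) n : continuous (@cons_rV R n).
Proof.
move=> p; apply/cvgrPdist_lt => e e0.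
have : \forall p' \near p, `|p - p'| < e.
  exact: (@cvgr_dist_lt _ _ _ (nbhs p) (nbhs_filter p) id p cvg_id e e0).
apply: filterS => p'; rewrite -cons_rVN -cons_rVD prod_normE gt_max => /andP[h1 h2].
by apply/cons_rV_norm_lt.
Qed.

Lemma cons_rV_surj (R : realType) n (v : 'rV[R]_n.+1) :
  exists p, v = cons_rV p.
Proof.
exists (v 0 (@lshift 1 n 0), \row_j v 0 (@rshift 1 n j)).
apply/rowP => i; case: (split_ordP (i : 'I_(1 + n))) => j ->.
  by rewrite cons_rV_head ord1.
by rewrite cons_rV_tail mxE.
Qed.

Section sigma_finite_wrapper.
Context d (T : measurableType d) (R : realType).
Variables (mu : {measure set T -> \bar R}) (mu_sf : sigma_finite setT mu).

(** An alias that carries the bundled structure for a measure of which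
    sigma-finiteness is proved afterwards. *)
Definition sigma_finite_wrapper of sigma_finite setT mu : set T -> \bar R := mu.

HB.instance Definition _ := Measure.on (sigma_finite_wrapper mu_sf).
HB.instance Definition _ := Measure_isSigmaFinite.Build _ _ _
  (sigma_finite_wrapper mu_sf) mu_sf.

Lemma sigma_finite_measureP : exists nu : {sigma_finite_measure set T -> \bar R},
  (nu : set T -> \bar R) = mu.
Proof. by exists (sigma_finite_wrapper mu_sf). Qed.
End sigma_finite_wrapper.

(** The Lebesgue measure of R^n.  It is the image under [cons_rV] of the product
    of the Lebesgue measure of R and of the measure in dimension [n], and the Dirac
    measure in dimension 0; Fubini's theorem reduces a translation to one in each
    factor. *)
Lemma exists_translation_invariant (R : realType) n :
  exists mu : {sigma_finite_measure set (borel_rV R n) -> \bar R},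
  [/\ forall r, (mu (ball (0%R : 'rV[R]_n) r) < +oo)%E,
      forall r, 0 < r -> (0 < mu (ball (0%R : 'rV[R]_n) r))%E &
      forall (v : 'rV[R]_n) (A : set 'rV[R]_n),
        measurable (A : set (borel_rV R n)) ->
        mu ((fun x : 'rV[R]_n => x + v) @^-1` A) = mu A].
Proof.
elim: n => [|n [mu [mu_fin mu_pos mu_tr]]].
  exists (@dirac _ (borel_rV R 0) (0 : 'rV[R]_0) R : {sigma_finite_measure set (borel_rV R 0) -> \bar R}).
  split => [r|r r0|v A mA].
  - by rewrite /= diracE; case: (_ \in _); rewrite ltry.
  - by rewrite /= diracE mem_set ?lte01//; exact: ballxx.
  - congr (_ _); apply/seteqP.
    by split => x; rewrite /preimage/= (thinmx0 v) addr0.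
pose e := @cons_rV R n.
have me := continuous_prod_borel (@cons_rV_continuous R n).
pose E : {mfun (measurableTypeR R * borel_rV R n)%type >-> borel_rV R n.+1} :=
  HB.pack_for {mfun (measurableTypeR R * borel_rV R n)%type >-> borel_rV R n.+1}
    e (isMeasurableFun.Build _ _ _ _ _ me).
pose prodm : {measure set (measurableTypeR R * borel_rV R n) -> \bar R} :=
  (lebesgue_measure \x mu)%E.
pose nu_ : {measure set (borel_rV R n.+1) -> \bar R} := pushforward prodm E.
pose nu : {measure set (borel_rV R n.+1) -> \bar R} := nu_ me.
have nuball r : 0 < r ->
    nu (ball (0%R : 'rV[R]_n.+1) r) = ((r *+ 2)%:E * mu (ball (0%R : 'rV[R]_n) r))%E.
  move=> r0; rewrite /nu/= /pushforward/=.
  have -> : E @^-1` ball (0%R : 'rV[R]_n.+1) r = ball (0%R : R) r `*` ball (0%R : 'rV[R]_n) r.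
    apply/seteqP; split => p /=; rewrite -!ball_normE/= !sub0r !normrN.
      by move/cons_rV_norm_lt => /(_ r0).
    by move=> h; apply/cons_rV_norm_lt.
  rewrite product_measure1E//.
  - by congr (_ * _)%E; exact: (lebesgue_measure_ball 0 (ltW r0)).
  - exact: measurable_ball.
  - by apply: open_borel_rV; exact: ball_open.
have nu_fin r : (nu (ball (0%R : 'rV[R]_n.+1) r) < +oo)%E.
  have [r0|r0] := leP r 0.
    suff -> : ball (0%R : 'rV[R]_n.+1) r = set0 by rewrite measure0.
    by rewrite -subset0 => x; rewrite -ball_normE/= => /lt_le_trans/(_ r0);
      rewrite normr_lt0.
  by rewrite nuball// lte_mul_pinfty// lee_fin mulrn_wge0// ltW.
have nu_sf : sigma_finite setT nu.
  exists (fun k => ball (0%R : 'rV[R]_n.+1) k.+1%:R).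
    apply/seteqP; split => // v _; exists (Num.truncn `|v|) => //.
    by rewrite -ball_normE/= sub0r normrN; exact: Num.Theory.truncnS_gt.
  by move=> k; split => //; apply: open_borel_rV; exact: ball_open.
have [Nu NuE] := sigma_finite_measureP nu_sf.
exists Nu; rewrite NuE; split => [//|r r0|v A mA].
  by rewrite nuball// mule_gt0 ?mu_pos// lte_fin mulrn_wgt0.
have [[a b] ->] := cons_rV_surj v.
pose B := E @^-1` A.
have mB : measurable B by have := me measurableT _ mA; rewrite setTI.
pose G s := mu (xsection B s).
have mG : measurable_fun setT G by exact: measurable_fun_xsection.
have -> : nu A = (\int[lebesgue_measure]_s G s)%E by [].
have -> : nu ((fun x => x + cons_rV (a, b)) @^-1` A) =
    (\int[lebesgue_measure]_s G (s + a)%R)%E.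
  apply: eq_integral => s _; rewrite /G.
  rewrite -(mu_tr b) /=; last exact: measurable_xsection.
  congr (mu _); apply/seteqP; split => x; rewrite /xsection/= !in_setE /B /preimage/=.
    by rewrite /E/= /e -cons_rVD.
  by rewrite /E/= /e -cons_rVD.
have mt : measurable_fun (setT : set (measurableTypeR R))
    ((fun s : R => s + a) : _ -> measurableTypeR R).
  by apply: measurable_funD => //; exact: measurable_cst.
rewrite -[LHS](ge0_integral_pushforward mt lebesgue_measure measurableT mG) => [|s _]; last exact: measure_ge0.
apply: eq_measure_integral => S mS _.
exact: lebesgue_translation.
Qed.

(** * Directional derivatives of Lipschitz functions *)

Definition diffq (R : realType) (V : normedModType R) (u : V -> R) (v : V)
  (h : R) (x : V) : R := h^-1 * (u (h *: v + x) - u x).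

Lemma diffq_continuous (R : realType) (V : normedModType R) (u : V -> R) v h :
  continuous u -> continuous (diffq u v h).
Proof.
move=> cu x; apply: cvgMr; apply: cvgB; last exact: cu.
apply: (@continuous_comp _ _ _ (fun x => h *: v + x) u); last exact: cu.
by apply: cvgD; [exact: cvg_cst|exact: cvg_id].
Qed.

Lemma diffq_bound (R : realType) (V : normedModType R) (u : V -> R) K v h x :
  lip_with K u -> h != 0 -> `|diffq u v h x| <= K * `|v|.
Proof.
move=> uK h0; rewrite /diffq normrM normfV ler_pdivrMl ?normr_gt0//.
by rewrite (le_trans (uK _ _))// addrK normrZ mulrCA.
Qed.

Lemma derivable_diffq (R : realType) (V : normedModType R) (u : V -> R) v x :
  derivable u x v <-> cvg (diffq u v h x @[h --> 0^']).
Proof. by []. Qed.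

(** By continuity in the increment, the Cauchy criterion may be restricted to
    rational increments; derivability becomes a countable combination of closed
    conditions on [x]. *)
Lemma derivable_diffq_cauchy (R : realType) n (u : 'rV[R]_n -> R) v x :
  continuous u ->
  derivable u x v <-> forall k : nat, exists m : nat, forall p p' : rat,
    p != 0 -> p' != 0 -> `|ratr p : R| < m.+1%:R^-1 -> `|ratr p' : R| < m.+1%:R^-1 ->
    `|diffq u v (ratr p) x - diffq u v (ratr p') x| <= k.+1%:R^-1.
Proof.
move=> cu; rewrite derivable_diffq; split.
  move=> /cvg_cauchy/cauchy_ballP du k.
  have k0 : 0 < k.+1%:R^-1 :> R by rewrite invr_gt0.
  have := du _ k0.
  move=> [[A B] /= [Ah Bh] AB].
  have [d d0 dAB] : exists2 d, 0 < d & forall h : R, h != 0 -> `|h| < d -> A (diffq u v h x) /\ B (diffq u v h x).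
    have : \forall h \near 0^', A (diffq u v h x) /\ B (diffq u v h x).
      by apply: filterI.
    move=> [d /= d0 H]; exists d => // h h0 hd; apply: H => //=.
    by rewrite sub0r normrN.
  have [m md] : exists m : nat, m.+1%:R^-1 < d.
    by have [m _ /(_ m (leqnn m))] := near_infty_natSinv_lt (PosNum d0); exists m.
  exists m => p p' p0 p'0 pm p'm; apply: ltW.
  have := AB (diffq u v (ratr p) x, diffq u v (ratr p') x); rewrite -ball_normE; apply.
  split => /=.
    by case: (dAB (ratr p)); rewrite ?fmorph_eq0// (lt_trans pm md).
  by case: (dAB (ratr p')); rewrite ?fmorph_eq0// (lt_trans p'm md).
move=> H; apply/cauchy_cvgP/cauchy_ballP => e e0.
have [k ke] : exists k : nat, k.+1%:R^-1 < e / 2.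
  have e20 : 0 < e / 2 by rewrite divr_gt0.
  by have [m _ /(_ m (leqnn m))] := near_infty_natSinv_lt (PosNum e20); exists m.
have [m Hm] := H k.
have dens (h eta : R) : h != 0 -> `|h| < m.+1%:R^-1 -> 0 < eta ->
    exists p : rat, [/\ p != 0, `|ratr p : R| < m.+1%:R^-1 &
      `|diffq u v h x - diffq u v (ratr p) x| < eta].
  move=> h0 hm eta0.
  have [r /= r0 hr] : \forall h' \near h, [/\ h' != 0, `|h'| < m.+1%:R^-1 &
      `|diffq u v h x - diffq u v h' x| < eta].
    near=> h'; split; near: h'.
    - exact: (@cvgr_neq0 _ _ _ (nbhs h) _ id h cvg_id h0).
    - exact: (@cvgr_norm_lt _ _ _ (nbhs h) _ id h cvg_id _ hm).
    - apply: (@cvgr_dist_lt _ _ _ (nbhs h) _ (fun h' => diffq u v h' x)) => //.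
      apply: cvgM; first exact: cvgV.
      apply: cvgB; last exact: cvg_cst.
      apply: (@cvg_comp _ _ _ (fun h => h *: v + x) u); last exact: cu.
      by apply: cvgD; [apply: cvgZr_tmp; exact: cvg_id|exact: cvg_cst].
  have : h - r < h + r by rewrite ltrD2l (lt_trans _ r0)// oppr_lt0.
  move=> /rat_in_itvoo[p]; rewrite in_itv/= => hp.
  have [p0 pm up] := hr (ratr p) (etrans (ltr_distlC _ _ _) hp).
  by exists p; split => //; move: p0; rewrite fmorph_eq0.
have m0 : 0 < m.+1%:R^-1 :> R by rewrite invr_gt0.
have e40 : 0 < e / 4 by rewrite divr_gt0.
pose C := [set diffq u v h x | h in [set h : R | h != 0 /\ `|h| < m.+1%:R^-1]].
have hC : nbhs (diffq u v h x @[h --> 0^']) C.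
  exists m.+1%:R^-1 => //= h /=; rewrite sub0r normrN => hm h0.
  by exists h.
exists (C, C) => // -[_ _] [[/= h [h0 hm] <-] [h' [h'0 h'm] <-]].
have [p [p0 pm hp]] := dens h _ h0 hm e40.
have [p' [p'0 p'm hp']] := dens h' _ h'0 h'm e40.
have := Hm p p' p0 p'0 pm p'm; move: ke hp hp'.
rewrite -ball_normE/= !ltr_norml ler_norml.
set X := diffq _ _ _ _; set Y := diffq _ _ _ _; set Z := diffq _ _ _ _.
set W := diffq _ _ _ _; set Q := (k.+1%:R^-1 : R).
by clearbody X Y Z W Q; lra.
Unshelve. all: by end_near. Qed.

Lemma measurable_nonderivable (R : realType) n (u : 'rV[R]_n -> R) v :
  continuous u ->
  measurable ([set x | ~ derivable u x v] : set (borel_rV R n)).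
Proof.
move=> cu.
pose D (k : nat) (pp : rat * rat) : set 'rV[R]_n :=
  [set x | `|diffq u v (ratr pp.1) x - diffq u v (ratr pp.2) x| <= k.+1%:R^-1].
pose B (m : nat) : set (rat * rat) := [set pp | [/\ pp.1 != 0, pp.2 != 0,
  `|ratr pp.1 : R| < m.+1%:R^-1 & `|ratr pp.2 : R| < m.+1%:R^-1]].
have mD k pp : measurable (D k pp : set (borel_rV R n)).
  rewrite -[D k pp]setCK; apply: measurableC; apply: open_borel_rV.
  pose d x := `|diffq u v (ratr pp.1) x - diffq u v (ratr pp.2) x|.
  have -> : ~` D k pp = d @^-1` [set y : R | k.+1%:R^-1 < y].
    by apply/seteqP; split => x; rewrite /D/preimage/= ltNge => /negP.
  have /continuousP : continuous d.
    move=> x; have c1 := @diffq_continuous R _ u v (ratr pp.1) cu x.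
    have c2 := @diffq_continuous R _ u v (ratr pp.2) cu x.
    exact: cvg_norm (cvgB c1 c2).
  by apply; exact: open_gt.
have -> : [set x | ~ derivable u x v] =
    ~` (\bigcap_k \bigcup_m \bigcap_(pp in B m) D k pp).
  apply/seteqP; split => x; apply: contra_not => /=.
    move=> H; apply/(derivable_diffq_cauchy _ _ cu) => k.
    have [m _ Hm] := H k I; exists m => p p' p0 p'0 pm p'm.
    exact: (Hm (p, p')).
  move=> /(derivable_diffq_cauchy _ _ cu) H k _; have [m Hm] := H k.
  by exists m => // -[p p'] [/= p0 p'0 pm p'm]; exact: Hm.
apply: measurableC; apply: bigcapT_measurable => k.
apply: bigcupT_measurable => m; rewrite bigcap_mkcond.
rewrite -[X in measurable X]setCK; apply: measurableC; rewrite setC_bigcap.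
apply: countable_bigcupT_measurable; first exact: countableP.
move=> pp; apply: measurableC; case: ifP => _ //; exact: mD.
Qed.

Section null_sets.
Context (R : realType) (n : nat).
Variable mu : {sigma_finite_measure set (borel_rV R n) -> \bar R}.
Hypothesis mu_tr : forall (v : 'rV[R]_n) (A : set 'rV[R]_n),
  measurable (A : set (borel_rV R n)) ->
  mu ((fun x : 'rV[R]_n => x + v) @^-1` A) = mu A.

(** Measure [[set (s, x) | N (x + s *: v)]] in both orders: its sections at fixed
    [x] are null by hypothesis, and those at fixed [s] are translates of [N], so that
    [0 = mu N * +oo]. *)
Lemma null_on_lines (v : 'rV[R]_n) (N : set 'rV[R]_n) :
  measurable (N : set (borel_rV R n)) ->
  (forall x, lebesgue_measure.-negligible [set s : R | N (x + s *: v)]) ->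
  mu N = 0%E.
Proof.
move=> mN Nneg.
pose T (p : R * 'rV[R]_n) := p.2 + p.1 *: v.
have cT : continuous T.
  move=> p; apply: cvgD; first exact: cvg_snd.
  by apply: cvgZ; [exact: cvg_fst|exact: cvg_cst].
have mT := continuous_prod_borel cT.
pose S := T @^-1` N : set (measurableTypeR R * borel_rV R n).
have mS : measurable S by have := mT measurableT _ mN; rewrite setTI.
have muS : ((lebesgue_measure \x mu) S = 0)%E.
  have -> : ((lebesgue_measure \x mu) S = (lebesgue_measure \x^ mu) S)%E.
    by apply: product_measure_unique => //= A B mA mB; rewrite product_measure2E.
  rewrite /product_measure2; apply: integral0_eq => x _ /=.
  have [M [mM M0 sM]] := Nneg x.
  apply/eqP; rewrite -measure_le0 -M0; apply: le_measure; try exact: mem_set.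
    by apply: mem_set; exact: measurable_ysection.
  by move=> s; rewrite /ysection/= in_setE => /sM.
have : ((lebesgue_measure \x mu) S = mu N * +oo)%E.
  rewrite -[RHS]/(mu N * +oo)%E.
  transitivity (\int[@lebesgue_measure R]_s (cst (mu N) s))%E.
    apply: eq_integral => s _ /=; rewrite -(mu_tr (s *: v) mN).
    by congr (mu _); apply/seteqP; split => x; rewrite /xsection/= in_setE.
  rewrite integral_cst//; congr (_ * _)%E.
  by rewrite -set_itvNyy; exact: (lebesgue_measure_itv `]-oo, +oo[).
rewrite muS => /esym/eqP; rewrite mule_eq0 => /orP[/eqP//|//].
Qed.

End null_sets.

Section rademacher.
Context (R : realType) (n : nat).
Variable mu : {sigma_finite_measure set (borel_rV R n) -> \bar R}.
Hypothesis mu_fin : forall r, (mu (ball (0%R : 'rV[R]_n) r) < +oo)%E.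
Hypothesis mu_tr : forall (v : 'rV[R]_n) (A : set 'rV[R]_n),
  measurable (A : set (borel_rV R n)) ->
  mu ((fun x : 'rV[R]_n => x + v) @^-1` A) = mu A.
Implicit Types (u : 'rV[R]_n -> R) (v w : 'rV[R]_n).

(** The restriction of [u] to each line of direction [v] is Lipschitz, so
    [null_on_lines] applies to the set of points without derivative along [v]. *)
Lemma lip_ae_derivable_dir u (K : R) v : lip_with K u ->
  {ae mu, forall x : 'rV[R]_n, derivable u x v}.
Proof.
move=> uK; have cu := lip_with_continuous uK.
have mN := measurable_nonderivable v cu.
exists [set x | ~ derivable u x v]; split => //.
apply: (null_on_lines mu_tr (v := v)) mN _ => x.
pose U (s : R) := u (x + s *: v).
have UK : lip_with (K * `|v|) U.
  move=> s t; rewrite (le_trans (uK _ _))// opprD addrACA subrr add0r -scalerBl.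
  by rewrite normrZ mulrAC mulrA.
have := lip_ae_derivable UK; apply: negligibleS => s /=; apply: contra_not.
rewrite !derivable_diffq.
have -> // : (fun h => diffq U 1 h s) = (fun h => diffq u v h (x + s *: v)).
apply/funext => h; rewrite /diffq /U; congr (_ * (u _ - _)).
by rewrite scalerDl addrCA [h *: 1]mulr1.
Qed.

Definition translate v : borel_rV R n -> borel_rV R n :=
  fun x : 'rV[R]_n => (x + v : 'rV[R]_n).

Lemma measurable_translate v : measurable_fun setT (translate v).
Proof.
apply: continuous_borel_rV; apply: (@lip_with_continuous _ _ _ 1) => x y.
by rewrite mul1r opprD addrACA subrr addr0.
Qed.

Lemma integral_translation v (f : borel_rV R n -> \bar R) :
  mu.-integrable setT f -> (\int[mu]_x f (translate v x) = \int[mu]_x f x)%E.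
Proof.
move=> fi; have mf := measurable_int mu fi; have mt := measurable_translate v.
pose nu_ : {measure set (borel_rV R n) -> \bar R} := pushforward mu (translate v).
have nuE g : (\int[nu_ mt]_x g x = \int[mu]_x g x)%E.
  by apply: eq_measure_integral => A mA _; exact: mu_tr.
rewrite -[RHS]nuE [RHS](integral_pushforward mt)//.
apply/integrableP; split; first exact: measurableT_comp mf mt.
have -> : (\int[mu]_x `|(f \o translate v) x| = \int[mu]_x `|f x|)%E.
  rewrite -[RHS]nuE [RHS](ge0_integral_pushforward mt)//.
  exact: measurableT_comp.
by case/integrableP : fi.
Qed.

(** The right-hand side is the integrable majorant of all the dominated
    convergence arguments. *)
Definition supp_bound (C r : R) (f : 'rV[R]_n -> R) :=
  forall x, `|f x| <= C * \1_(ball (0 : 'rV[R]_n) r) x.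

Lemma integrable_ball (C r : R) :
  mu.-integrable setT (fun x : borel_rV R n =>
    (C * \1_(ball (0 : 'rV[R]_n) r) (x : 'rV[R]_n))%:E).
Proof.
have mb : measurable (ball (0 : 'rV[R]_n) r : set (borel_rV R n)).
  by apply: open_borel_rV; exact: ball_open.
suff h : mu.-integrable setT (EFin \o \1_(ball (0 : 'rV[R]_n) r : set (borel_rV R n))).
  exact: (integrableZl measurableT C h).
apply/integrableP; split.
  by apply/measurable_EFinP; exact: measurable_indic.
rewrite (eq_integral (fun x => (\1_(ball (0 : 'rV[R]_n) r : set (borel_rV R n)) x)%:E)).
  by rewrite integral_indic// setIT; exact: mu_fin.
by move=> x _ /=; rewrite ger0_norm.
Qed.

Lemma supp_bound_integrable (C r : R) (f : 'rV[R]_n -> R) :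
  measurable_fun (setT : set (borel_rV R n)) f -> supp_bound C r f ->
  mu.-integrable setT (EFin \o f : borel_rV R n -> \bar R).
Proof.
move=> mf fb; apply: le_integrable (integrable_ball C r) => //.
  exact/measurable_EFinP.
move=> x _ /=; rewrite lee_fin; exact: le_trans (fb x) (ler_norm _).
Qed.

Lemma supp_bound_dct (C r : R) (F : nat -> 'rV[R]_n -> R) (f : 'rV[R]_n -> R) :
  (forall k, measurable_fun (setT : set (borel_rV R n)) (F k)) ->
  measurable_fun (setT : set (borel_rV R n)) f ->
  {ae mu, forall x : 'rV[R]_n, F k x @[k --> \oo] --> f x} ->
  (forall k, supp_bound C r (F k)) ->
  (\int[mu]_x (F k x)%:E @[k --> \oo] --> \int[mu]_x (f x)%:E)%E.
Proof.
move=> mF mf Ff Fb.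
have [] := @dominated_convergence _ (borel_rV R n) _ mu setT measurableT
  (fun k x => (F k x)%:E) (EFin \o f) _ _ _ _ (integrable_ball C r).
- by move=> k; exact/measurable_EFinP.
- exact/measurable_EFinP.
- have FF := ae_filter_ringOfSetsType mu.
  by apply: filterS Ff => x + _ /=; by apply: cvg_EFin; exact: nearW.
- by apply: aeW => x k _; rewrite lee_fin; exact: Fb.
by [].
Qed.

End rademacher.

(** * Additivity of the directional derivatives *)

Lemma dnbhs_harmonic (R : realType) : @harmonic R k @[k --> \oo] --> 0^'.
Proof.
move=> A [e /= e0 eA].
have := @near_infty_natSinv_lt R (PosNum e0); apply: filterS => k ke.
apply: eA => /=; last by rewrite invr_eq0 pnatr_eq0.
by rewrite sub0r normrN ger0_norm// invr_ge0.
Qed.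

Lemma diffq_cvg (R : realType) (V : normedModType R) (u : V -> R) v x :
  derivable u x v -> diffq u v (harmonic k) x @[k --> \oo] --> 'D_v u x.
Proof.
move=> du; apply: (@cvg_comp _ _ _ _ (fun h => diffq u v h x)).
  exact: dnbhs_harmonic.
exact: du.
Qed.

Lemma continuous_comp_addr (R : realType) (V : normedModType R) (f : V -> R) v :
  continuous f -> continuous (fun x => f (x + v)).
Proof.
move=> cf x; apply: (@cvg_comp _ _ _ (fun x => x + v) f); last exact: cf.
by apply: cvgD; [exact: cvg_id|exact: cvg_cst].
Qed.

Lemma bounded_mul_cvg0 (R : realType) (a b : nat -> R) (A : R) :
  (forall k, `|a k| <= A) -> b k @[k --> \oo] --> 0 ->
  a k * b k @[k --> \oo] --> 0.
Proof.
move=> aA /cvgr0_norm_lt b0; apply/cvgr0Pnorm_lt => e e0.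
have A0 : 0 < `|A| + 1 by rewrite ltr_pwDr.
have := b0 (e / (`|A| + 1)); rewrite divr_gt0// => /(_ isT).
apply: filterS => k bk; rewrite normrM.
rewrite (@le_lt_trans _ _ ((`|A| + 1) * `|b k|))//.
  by rewrite ler_wpM2r// (le_trans (aA k))// ler_wpDr// ler_norm.
by rewrite mulrC -ltr_pdivlMr.
Qed.

Lemma dist_max0 (R : realType) (a b : R) :
  `|Num.max 0 a - Num.max 0 b| <= `|a - b|.
Proof.
case: (leP 0 a) => a0; case: (leP 0 b) => b0; rewrite ?subrr ?normr0//.
  by rewrite subr0 ger0_norm// ler_normr; apply/orP; left; lra.
by rewrite sub0r normrN ger0_norm// distrC ler_normr; apply/orP; left; lra.
Qed.

Section additivity.
Context (R : realType) (n : nat).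
Variable mu : {sigma_finite_measure set (borel_rV R n) -> \bar R}.
Hypothesis mu_fin : forall r, (mu (ball (0%R : 'rV[R]_n) r) < +oo)%E.
Hypothesis mu_tr : forall (v : 'rV[R]_n) (A : set 'rV[R]_n),
  measurable (A : set (borel_rV R n)) ->
  mu ((fun x : 'rV[R]_n => x + v) @^-1` A) = mu A.
Implicit Types (u : 'rV[R]_n -> R) (v w : 'rV[R]_n).

Lemma supp_boundP (C r : R) (f : 'rV[R]_n -> R) :
  supp_bound C r f <->
  forall x, (`|x| < r -> `|f x| <= C) /\ (r <= `|x| -> f x = 0).
Proof.
have B x : ball (0 : 'rV[R]_n) r x = (`|x| < r) :> Prop.
  by rewrite -ball_normE/= sub0r normrN.
have out (x : 'rV[R]_n) : r <= `|x| -> (x \in (ball (0 : 'rV[R]_n) r : set _)) = false.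
  by move=> xr; apply/negbTE/negP => /set_mem; rewrite B ltNge xr.
split=> fb x; have := fb x; rewrite indicE; have [xr|xr] := ltP `|x| r.
- by rewrite mem_set ?B// mulr1.
- by rewrite out// mulr0 normr_le0 => /eqP.
- by rewrite mem_set ?B// mulr1 => -[/(_ isT)].
- by rewrite out// mulr0 => -[_ /(_ isT) ->]; rewrite normr0.
Qed.

Lemma supp_boundM (A C r : R) (a f : 'rV[R]_n -> R) :
  (forall x, `|a x| <= A) -> supp_bound C r f ->
  supp_bound (A * C) r (fun x => a x * f x).
Proof.
move=> aA /supp_boundP fb; apply/supp_boundP => x; split => xr.
  by rewrite normrM ler_pM//; exact: (fb x).1.
by rewrite (fb x).2// mulr0.
Qed.

(** The defect of additivity of difference quotients comes from a shift of the
    base point by [h *: v], which an integral can transfer to a test function. *)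
Lemma diffq_add u v w h x :
  diffq u (v + w) h x - diffq u v h x = diffq u w h (x + h *: v).
Proof.
rewrite /diffq -mulrBr; congr (_ * _).
have E (a b c : R) : a - c - (b - c) = a - b by rewrite opprB addrA subrK.
rewrite E; congr (u _ - u _); last by rewrite addrC.
by rewrite scalerDr [h *: v + _]addrC -addrA [h *: v + x]addrC.
Qed.

Let psi u v w k x : R := diffq u (v + w) (harmonic k) x -
  diffq u v (harmonic k) x - diffq u w (harmonic k) x.

(** By [diffq_add] and translation invariance the integral is that of
    [diffq u w h x * (phi (x - h *: v) - phi x)]; the first factor is bounded and the
    second one tends to 0 pointwise. *)
Lemma integral_second_difference u (K : R) v w (phi : 'rV[R]_n -> R) (C r : R) :
  lip_with K u -> continuous phi -> 0 <= C -> supp_bound C r phi ->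
  (\int[mu]_x (psi u v w k x * phi x)%:E @[k --> \oo] --> 0)%E.
Proof.
move=> uK cphi C0 phib; have cu := lip_with_continuous uK.
pose F k := diffq u w (harmonic k).
have FK k x : `|F k x| <= K * `|w| by apply: diffq_bound => //; rewrite gt_eqF// harmonic_gt0.
have Kw0 : 0 <= K * `|w| := le_trans (normr_ge0 _) (FK 0%N 0).
have cF k : continuous (F k) by exact: diffq_continuous.
pose phis k x : R := phi (x - harmonic k *: v).
have cphis k : continuous (phis k).
  exact: continuous_comp_addr.
have hv k : `|harmonic k *: v| <= `|v|.
  rewrite normrZ ger0_norm ?invr_ge0// ler_piMl// /harmonic.
  by rewrite invf_le1 ?ltr0n// ler1n.
have phisb k : supp_bound C (r + `|v|) (phis k).
  move/supp_boundP : phib => phib; apply/supp_boundP => x; split => xr.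
    have [xr'|xr'] := ltP `|x - harmonic k *: v| r; first exact: (phib _).1.
    by rewrite /phis (phib _).2// normr0.
  apply: (phib _).2; have := hv k; have := lerB_dist x (harmonic k *: v); lra.
have phib' : supp_bound C (r + `|v|) phi.
  move/supp_boundP : phib => phib; apply/supp_boundP => x; split => xr.
    have [xr'|xr'] := ltP `|x| r; first exact: (phib _).1.
    by rewrite (phib _).2// normr0.
  by apply: (phib _).2; rewrite (le_trans _ xr)// lerDl.
have int_c (f : 'rV[R]_n -> R) C' r' : continuous f -> supp_bound C' r' f ->
    mu.-integrable setT (EFin \o f : borel_rV R n -> \bar R).
  by move=> cf; apply: supp_bound_integrable => //; exact: continuous_borel_R.
have E k : (\int[mu]_x (psi u v w k x * phi x)%:E =
    \int[mu]_x (F k x * (phis k x - phi x))%:E)%E.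
  pose g x : R := F k x * phis k x.
  have cg : continuous g.
    by move=> x; exact: cvgM (cF k x) (cphis k x).
  have ig : mu.-integrable setT (EFin \o g : borel_rV R n -> \bar R).
    exact: int_c (supp_boundM (FK k) (phisb k)).
  have iF : mu.-integrable setT (EFin \o (fun x => F k x * phi x) : borel_rV R n -> \bar R).
    apply: int_c (supp_boundM (FK k) phib).
    by move=> x; exact: cvgM (cF k x) (cphi x).
  transitivity (\int[mu]_x (g (x + harmonic k *: v)%R - F k x * phi x)%:E)%E.
    apply: eq_integral => x _; congr (_%:E).
    by rewrite /psi /g /phis addrK diffq_add mulrBl.
  have ig' : mu.-integrable setT
      (EFin \o (fun x : 'rV[R]_n => g (x + harmonic k *: v)) : borel_rV R n -> \bar R).
    apply: (int_c _ (K * `|w| * C) (r + `|v| + `|v|)).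
      exact: continuous_comp_addr.
    have /supp_boundP gb := supp_boundM (FK k) (phisb k).
    apply/supp_boundP => x; split => xr.
      have [xr'|xr'] := ltP `|x + harmonic k *: v| (r + `|v|); first exact: (gb _).1.
      by rewrite /g (gb _).2// normr0 mulr_ge0.
    apply: (gb _).2; have := hv k; have := lerB_normD x (harmonic k *: v); lra.
  rewrite integralB_EFin//.
  rewrite -[X in (X - _)%E = _]/(\int[mu]_x (EFin \o g) (translate (harmonic k *: v) x))%E.
  rewrite (integral_translation mu_tr)// -integralB_EFin//.
  by apply: eq_integral => x _; rewrite /g /= mulrBr EFinB.
under eq_fun do rewrite E.
rewrite -(integral0 mu setT).
apply: (supp_bound_dct mu_fin (C := K * `|w| * (C + C)) (r := r + `|v|)
  (F := fun k x => F k x * (phis k x - phi x)) (f := cst 0)) => //.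
- move=> k; apply: continuous_borel_R => x.
  exact: cvgM (cF k x) (cvgB (cphis k x) (cphi x)).
- apply: aeW => x; apply: (bounded_mul_cvg0 (FK ^~ x)).
  apply/cvgrPdist_lt => e e0.
  have := @cvgr_dist_lt _ _ _ (nbhs x) (nbhs_filter x) phi _ (cphi x) e e0.
  move=> /nbhs_ballP[d /= d0 dphi].
  have Kv : 0 < d / (`|v| + 1) by rewrite divr_gt0// ltr_pwDr.
  have := @near_infty_natSinv_lt R (PosNum Kv); apply: filterS => k /= kd.
  rewrite sub0r normrN distrC; apply: dphi; rewrite -ball_normE/= opprB addrC subrK.
  rewrite normrZ ger0_norm ?invr_ge0// (@le_lt_trans _ _ (harmonic k * (`|v| + 1)))//.
    by rewrite ler_wpM2l ?invr_ge0// lerDl.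
  by rewrite -ltr_pdivlMr// ltr_pwDr.
- move=> k; apply: supp_boundM => //; apply/supp_boundP => x; split => xr.
    move/supp_boundP : phib' => phib'; move/supp_boundP : (phisb k) => phisb'.
    by rewrite (le_trans (ler_normB _ _))// lerD//; [exact: (phisb' _).1|exact: (phib' _).1].
  move/supp_boundP : phib' => phib'; move/supp_boundP : (phisb k) => phisb'.
  by rewrite (phib' _).2 ?(phisb' _).2 ?subrr.
Qed.

(** The defect [P] of additivity is the limit of the second differences [psi], so
    it is orthogonal to all continuous functions with bounded support
    ([integral_second_difference]).  It is then orthogonal to itself, since the
    [psi k] are such functions after a cutoff. *)
Lemma ae_deriveD u (K : R) v w : lip_with K u ->
  {ae mu, forall x : 'rV[R]_n, 'D_(v + w) u x = 'D_v u x + 'D_w u x}.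
Proof.
move=> uK; have cu := lip_with_continuous uK.
have FF := ae_filter_ringOfSetsType mu.
pose G : set 'rV[R]_n :=
  [set x | [/\ derivable u x (v + w), derivable u x v & derivable u x w]].
have mG : measurable (G : set (borel_rV R n)).
  have mD z : measurable ([set x | derivable u x z] : set (borel_rV R n)).
    rewrite -[X in measurable X]setCK; apply: measurableC.
    exact: measurable_nonderivable.
  have -> : G = [set x | derivable u x (v + w)] `&` [set x | derivable u x v]
      `&` [set x | derivable u x w].
    apply/seteqP; split=> x => [[h1 h2 h3]|[[h1 h2] h3]].
      exact: (conj (conj h1 h2) h3).
    exact: And3 h1 h2 h3.
  by apply: measurableI; [apply: measurableI|]; exact: mD.
have aeG : {ae mu, forall x, G x}.
  have d1 := lip_ae_derivable_dir mu_tr (v + w) uK.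
  have d2 := lip_ae_derivable_dir mu_tr v uK.
  have d3 := lip_ae_derivable_dir mu_tr w uK.
  by apply: filterS3 d1 d2 d3 => x.
pose P x : R := ('D_(v + w) u x - 'D_v u x - 'D_w u x) * \1_G x.
have psiG x : G x -> psi u v w k x @[k --> \oo] --> P x.
  move=> Gx; rewrite /P indicE mem_set// mulr1; have [g1 g2 g3] := Gx.
  by apply: cvgB; [apply: cvgB|]; exact: diffq_cvg.
have cpsi k : continuous (psi u v w k).
  move=> x; have c z := @diffq_continuous R _ u z (harmonic k) cu x.
  exact: (cvgB (cvgB (c (v + w)) (c v)) (c w)).
have mP : measurable_fun (setT : set (borel_rV R n)) P.
  apply: (@measurable_fun_cvg _ (borel_rV R n) R setT
    (fun k (x : 'rV[R]_n) => psi u v w k x * \1_G x) P).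
    move=> k; apply: measurable_funM; first exact: continuous_borel_R.
    exact: measurable_indic.
  move=> x _; have [Gx|Gx] := pselect (G x).
    rewrite (_ : (fun k => _) = psi u v w ^~ x); first exact: psiG.
    by apply/funext => k; rewrite indicE mem_set// mulr1.
  rewrite (_ : (fun k => _) = cst 0); last first.
    by apply/funext => k; rewrite indicE memNset// mulr0.
  by rewrite /P indicE memNset// mulr0; exact: cvg_cst.
pose C0 := K * `|v + w| + K * `|v| + K * `|w|.
have psib k x : `|psi u v w k x| <= C0.
  have h0 : @harmonic R k != 0 by rewrite gt_eqF// harmonic_gt0.
  rewrite /psi (le_trans (ler_normB _ _))// lerD//; last exact: diffq_bound.
  by rewrite (le_trans (ler_normB _ _))// lerD//; exact: diffq_bound.
have C00 : 0 <= C0 := le_trans (normr_ge0 _) (psib 0%N 0).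
have Pb x : `|P x| <= C0.
  have [Gx|Gx] := pselect (G x); last by rewrite /P indicE memNset// mulr0 normr0.
  apply: (ler_cvg_to (cvg_norm (psiG x Gx)) (cvg_cst C0)).
  by near=> k; exact: psib.
have intP (phi : 'rV[R]_n -> R) C r : continuous phi -> 0 <= C ->
    supp_bound C r phi -> (\int[mu]_x (P x * phi x)%:E = 0)%E.
  move=> cphi C'0 phib.
  have l1 := integral_second_difference v w uK cphi C'0 phib.
  apply: (cvg_unique (@ereal_hausdorff R)) l1.
  apply: (supp_bound_dct mu_fin (C := C0 * C) (r := r)
    (F := fun k x => psi u v w k x * phi x) (f := fun x => P x * phi x)).
  - move=> k; apply: continuous_borel_R => x; exact: cvgM (cpsi k x) (cphi x).
  - by apply: measurable_funM => //; exact: continuous_borel_R.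
  - by apply: filterS aeG => x Gx; apply: cvgMl; exact: psiG.
  - by move=> k; exact: supp_boundM.
(* Cutoff functions, positive on the ball of radius [m] and zero outside. *)
pose chi (m : nat) (x : 'rV[R]_n) : R := Num.max 0 (m%:R - `|x|).
have cchi m : continuous (chi m).
  apply: (@lip_with_continuous _ _ _ 1) => x y.
  rewrite (le_trans (dist_max0 _ _))// opprB addrC addrA subrK mul1r distrC.
  exact: ler_dist_dist.
have chib m : supp_bound m%:R m%:R (chi m).
  apply/supp_boundP => x; rewrite /chi; split => xm.
    have h : 0 <= m%:R - `|x| by rewrite subr_ge0 ltW.
    by rewrite max_r// ger0_norm// lerBlDr lerDl.
  by rewrite max_l// subr_le0.
(* Test [P] against [psi k * chi m], then let [k] tend to infinity. *)
have P2 m : (\int[mu]_x (P x * (P x * chi m x))%:E = 0)%E.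
  have l0 : (\int[mu]_x (P x * (psi u v w k x * chi m x))%:E @[k --> \oo] --> 0)%E.
    rewrite (_ : (fun k => _) = cst 0%E); first exact: cvg_cst.
    apply/funext => k; apply: (intP _ (C0 * m%:R) m%:R).
    - by move=> x; exact: cvgM (cpsi k x) (cchi m x).
    - by rewrite mulr_ge0.
    - exact: supp_boundM.
  apply: (cvg_unique (@ereal_hausdorff R)) l0.
  apply: (supp_bound_dct mu_fin (C := C0 * (C0 * m%:R)) (r := m%:R)
    (F := fun k x => P x * (psi u v w k x * chi m x))
    (f := fun x => P x * (P x * chi m x))).
  - move=> k; apply: measurable_funM => //; apply: continuous_borel_R => x.
    exact: cvgM (cpsi k x) (cchi m x).
  - apply: measurable_funM => //; apply: measurable_funM => //.
    exact: continuous_borel_R.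
  - apply: filterS aeG => x Gx; apply: cvgMr; apply: cvgMl; exact: psiG.
  - by move=> k; apply: supp_boundM => //; exact: supp_boundM.
have P0 m : {ae mu, forall x, P x * (P x * chi m x) = 0}.
  have mPP : measurable_fun (setT : set (borel_rV R n))
      (EFin \o (fun x => P x * (P x * chi m x))).
    apply/measurable_EFinP; apply: measurable_funM => //.
    by apply: measurable_funM => //; exact: continuous_borel_R.
  have PP0 x : 0 <= P x * (P x * chi m x).
    by rewrite mulrA mulr_ge0// ?sqr_ge0// /chi le_max lexx.
  have /(ae_eq_integral_abs mu measurableT mPP) :
      (\int[mu]_x `|(P x * (P x * chi m x))%:E| = 0)%E.
    by rewrite -(P2 m); apply: eq_integral => x _; rewrite gee0_abs// lee_fin PP0.
  by apply: filterS => x /(_ I)/= [].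
have := ae_foralln P0; move: aeG; apply: filterS2 => x Gx Px.
have := Px (Num.truncn `|x|).+1; rewrite mulrA => /eqP; rewrite mulf_eq0.
have xm : 0 < (Num.truncn `|x|).+1%:R - `|x|.
  by rewrite subr_gt0; exact: Num.Theory.truncnS_gt.
rewrite /chi max_r ?(ltW xm)// (gt_eqF xm) orbF.
rewrite mulf_eq0 orbb /P indicE mem_set// mulr1 -addrA -opprD subr_eq0.
by move/eqP.
Unshelve. all: by end_near. Qed.

End additivity.

(** * Rademacher's theorem *)

Lemma differentiable_expansion (R : realType) (V W : normedModType R)
    (f : V -> W) (L : {linear V -> W}) x : continuous L ->
  (forall e : R, 0 < e -> \forall y \near 0, `|f (y + x) - f x - L y| <= e * `|y|) ->
  differentiable f x.
Proof.
move=> cL H.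
have E : f \o shift x = cst (f x) + L +o_ 0 id.
  apply/eqaddoP => e e0; have := H e e0; apply: filterS => y.
  by rewrite /= !fctE opprD addrA.
apply/diff_locallyP; rewrite (diff_unique cL E); split => //.
Qed.

Lemma diffq_scaled_cvg (R : realType) (V : normedModType R) (u : V -> R) v x c :
  c != 0 -> derivable u x v ->
  diffq u v (c * harmonic k) x @[k --> \oo] --> 'D_v u x.
Proof.
move=> c0 dv; apply: (@cvg_comp _ _ _ (fun k => c * harmonic k)
  (fun h => diffq u v h x)); last exact: dv.
move=> A [e /= e0 eA].
have ec : 0 < e / `|c| by rewrite divr_gt0// normr_gt0.
have := @near_infty_natSinv_lt R (PosNum ec); apply: filterS => k /= ke.
apply: eA => /=; last by rewrite mulf_neq0// invr_eq0 pnatr_eq0.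
rewrite sub0r normrN normrM mulrC -ltr_pdivlMr ?normr_gt0//.
by rewrite ger0_norm// invr_ge0.
Qed.

(** Both derivatives are taken along one line; so this holds wherever they exist,
    in contrast with additivity. *)
Lemma derive_scale_dir (R : realType) (V : normedModType R) (u : V -> R) v c x :
  derivable u x v -> derivable u x (c *: v) -> 'D_(c *: v) u x = c * 'D_v u x.
Proof.
move=> dv dcv; have l1 := diffq_cvg dcv.
apply: (cvg_unique (@Rhausdorff R) l1).
have [c0|c0] := eqVneq c 0.
  rewrite c0 mul0r scale0r (_ : (fun k => _) = cst 0); first exact: cvg_cst.
  by apply/funext => k; rewrite /diffq scaler0 add0r subrr mulr0.
rewrite (_ : (fun k => _) = (fun k => c * diffq u v (c * harmonic k) x)).
  by apply: cvgMr; exact: diffq_scaled_cvg.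
apply/funext => k; rewrite /diffq scalerA [_ * c]mulrC invfM.
by rewrite -[c^-1 * _ * _]mulrA mulrA mulfV// mul1r.
Qed.

Definition lin_coords (R : realType) n (c : 'I_n -> R) (y : 'rV[R]_n) : R :=
  \sum_i y 0 i * c i.

Lemma lin_coords_is_linear (R : realType) n (c : 'I_n -> R) :
  linear (lin_coords c : 'rV[R]_n -> R^o).
Proof.
move=> a y z; rewrite /lin_coords scaler_sumr -big_split/=.
by apply: eq_bigr => i _; rewrite !mxE mulrDl -mulrA.
Qed.

HB.instance Definition _ (R : realType) n (c : 'I_n -> R) :=
  GRing.isLinear.Build R 'rV[R]_n R _ (lin_coords c) (lin_coords_is_linear c).

Lemma lin_coords_bound (R : realType) n (c : 'I_n -> R) y :
  `|lin_coords c y| <= (\sum_i `|c i|) * `|y|.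
Proof.
rewrite /lin_coords (le_trans (ler_norm_sum _ _ _))// mulr_suml ler_sum// => i _.
by rewrite normrM mulrC ler_wpM2l// rV_coord_le.
Qed.

Lemma lip_with_lin_coords (R : realType) n (c : 'I_n -> R) :
  lip_with (\sum_i `|c i|) (lin_coords c).
Proof. by move=> x y; rewrite -linearB; exact: lin_coords_bound. Qed.

Lemma rat_rVD (R : realType) n (a b : 'rV[rat]_n) :
  rat_rV R (a + b) = rat_rV R a + rat_rV R b.
Proof. exact: map_mxD. Qed.

(** Additivity and homogeneity make the derivatives in rational directions
    the values of a linear form [L].  The convergence of the difference quotients to
    [L] is uniform on the unit ball, because by the Lipschitz bound a finite net of
    rational directions controls all directions. *)
Lemma gateaux_differentiable (R : realType) n (u : 'rV[R]_n -> R) (K : R) x :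
  lip_with K u -> (forall a, derivable u x (rat_rV R a)) ->
  (forall a b, 'D_(rat_rV R a + rat_rV R b) u x =
     'D_(rat_rV R a) u x + 'D_(rat_rV R b) u x) ->
  differentiable u x.
Proof.
move=> uK du uD.
pose T (a : 'rV[rat]_n) := 'D_(rat_rV R a) u x.
pose e i : 'rV[rat]_n := delta_mx 0 i.
pose L := lin_coords (fun i => T (e i)).
have TL a : T a = L (rat_rV R a).
  have T0 : T 0 = 0.
    have := uD 0 0; rewrite -rat_rVD addr0 -/(T 0) => /eqP.
    by rewrite -subr_eq subrr eq_sym => /eqP.
  have -> : T a = T (\sum_i a 0 i *: e i) by rewrite -row_sum_delta.
  have TD b c : T (b + c) = T b + T c by rewrite /T rat_rVD uD.
  rewrite (big_morph T TD T0) /L /lin_coords; apply: eq_bigr => i _.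
  have E : rat_rV R (a 0 i *: e i) = ratr (a 0 i) *: rat_rV R (e i).
    exact: map_mxZ.
  have dE : derivable u x (ratr (a 0 i) *: rat_rV R (e i)) by rewrite -E.
  rewrite /T E (derive_scale_dir (du _) dE); congr (_ * _).
  by rewrite [RHS]mxE.
pose La := \sum_i `|T (e i)|.
have cL : continuous L by apply: lip_with_continuous; exact: lip_with_lin_coords.
apply: (@differentiable_expansion _ _ _ _ L) => // eps eps0.
pose d := eps / (`|K| + La + 1).
have La0 : 0 <= La by apply: sumr_ge0.
have D0 : 0 < `|K| + La + 1 by rewrite ltr_pwDr// addr_ge0.
have d0 : 0 < d by rewrite divr_gt0.
have ball_compact : compact [set y : 'rV[R]_n | `|y| <= 1].
  apply: bounded_closed_compact.
    by exists 1; split => // M M1 y /= y1; rewrite (le_trans y1)// ltW.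
  have /continuous_closedP := @norm_continuous R 'rV[R]_n.
  by move=> /(_ [set x | x <= 1]); apply; exact: closed_le.
have [||D' _ cov] := (eq_ind _ (fun P => P _) ball_compact _ (compact_cover _)) _ setT
    (fun a : 'rV[rat]_n => ball (rat_rV R a) d).
- by move=> a _; exact: ball_open.
- by move=> y _; have [a ya] := rat_rV_dense y d0; exists a => //; rewrite -ball_normE/= distrC.
have [del /= del0 Hdel] : \forall h \near (0 : R)^', (\bigcap_(a in [set` D'])
    [set h | `|diffq u (rat_rV R a) h x - T a| <= d]) h.
  apply: filter_bigI => a _.
  have dua : diffq u (rat_rV R a) h x @[h --> 0^'] --> T a by exact: du.
  move/cvgrPdist_le : dua => /(_ _ d0); apply: filterS => h /=.
  by rewrite distrC.
have : \forall y \near (0 : 'rV[R]_n), `|y| < del.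
  apply/nbhs_ballP; exists del => // y.
  by rewrite -ball_normE/= sub0r normrN.
apply: filterS => y ydel.
have [->|y0] := eqVneq y 0.
  by rewrite add0r subrr linear0 subrr !normr0 mulr0.
have h0 : 0 < `|y| by rewrite normr_gt0.
set h := `|y| in h0 ydel *.
pose th := h^-1 *: y.
have thy : y = h *: th by rewrite scalerA mulfV ?scale1r// gt_eqF.
have th1 : `|th| <= 1 by rewrite normrZ normfV gtr0_norm// mulVf// gt_eqF.
have [a aD'] := cov th th1; rewrite -ball_normE/= => ath.
have ha : `|diffq u (rat_rV R a) h x - T a| <= d.
  by apply: Hdel => //=; rewrite ?gt_eqF// sub0r normrN gtr0_norm.
have e1 : `|u (y + x) - u (h *: rat_rV R a + x)| <= `|K| * (h * d).
  rewrite (le_trans (uK _ _))// opprD addrACA subrr addr0 thy -scalerBr normrZ gtr0_norm//.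
  rewrite (@le_trans _ _ (`|K| * (h * `|th - rat_rV R a|)))//.
    by rewrite ler_wpM2r ?ler_norm// mulr_ge0// ltW.
  by rewrite !ler_wpM2l ?(ltW h0)// distrC ltW.
have e2 : `|u (h *: rat_rV R a + x) - u x - h * L (rat_rV R a)| <= h * d.
  have -> : u (h *: rat_rV R a + x) - u x = h * diffq u (rat_rV R a) h x.
    by rewrite /diffq mulVKf// gt_eqF.
  by rewrite -TL -mulrBr normrM gtr0_norm// ler_wpM2l// ltW.
have e3 : `|h * L (rat_rV R a) - L y| <= La * (h * d).
  have -> : L y = h * L th by rewrite [in LHS]thy /L linearZ.
  rewrite -mulrBr /L -linearB normrM gtr0_norm//.
  rewrite mulrCA ler_wpM2l ?(ltW h0)// (le_trans (lin_coords_bound _ _))//.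
  by rewrite ler_wpM2l// ltW.
have -> : eps * h = `|K| * (h * d) + h * d + La * (h * d).
  have -> : eps = d * (`|K| + La + 1) by rewrite /d divfK// gt_eqF.
  by ring.
have -> : u (y + x) - u x - L y = (u (y + x) - u (h *: rat_rV R a + x)) +
    (u (h *: rat_rV R a + x) - u x - h * L (rat_rV R a)) +
    (h * L (rat_rV R a) - L y) by ring.
rewrite (le_trans (ler_normD _ _))// lerD// (le_trans (ler_normD _ _))// lerD//.
Qed.

Lemma differentiable_rV (R : realType) (V : normedModType R) m
    (f : V -> 'rV[R]_m) x :
  (forall i, differentiable (fun y => f y 0 i) x) -> differentiable f x.
Proof.
move=> df.
have -> : f = \sum_(i < m) (fun y => f y 0 i *: (delta_mx 0 i : 'rV[R]_m)).
  by apply/funext => y; rewrite fct_sumE [LHS]row_sum_delta.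
by apply: differentiable_sum => i; exact: differentiableZl.
Qed.

Lemma ae_forall_count d (T : measurableType d) (R : realType)
    (mu : {measure set T -> \bar R}) (C : countType) (P : C -> T -> Prop) :
  (forall c, {ae mu, forall x, P c x}) -> {ae mu, forall x, forall c, P c x}.
Proof.
move=> aeP; have FF := ae_filter_ringOfSetsType mu.
have : {ae mu, forall x, forall k : nat,
    if @choice.unpickle C k is Some c then P c x else True}.
  apply: ae_foralln => k; case: (choice.unpickle k) => [c|]; first exact: aeP.
  exact: aeW.
by apply: filterS => x Px c; have := Px (choice.pickle c); rewrite choice.pickleK.
Qed.

Section rademacher_vector.
Context (R : realType) (n : nat).
Variable mu : {sigma_finite_measure set (borel_rV R n) -> \bar R}.
Hypothesis mu_fin : forall r, (mu (ball (0%R : 'rV[R]_n) r) < +oo)%E.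
Hypothesis mu_tr : forall (v : 'rV[R]_n) (A : set 'rV[R]_n),
  measurable (A : set (borel_rV R n)) ->
  mu ((fun x : 'rV[R]_n => x + v) @^-1` A) = mu A.

Lemma rademacher_scalar (u : 'rV[R]_n -> R) (K : R) : lip_with K u ->
  {ae mu, forall x : 'rV[R]_n, differentiable u x}.
Proof.
move=> uK; have FF := ae_filter_ringOfSetsType mu.
have d1 : {ae mu, forall x : 'rV[R]_n, forall a, derivable u x (rat_rV R a)}.
  by apply: ae_forall_count => a; exact: lip_ae_derivable_dir uK.
have d2 : {ae mu, forall x : 'rV[R]_n, forall p : 'rV[rat]_n * 'rV[rat]_n,
    'D_(rat_rV R p.1 + rat_rV R p.2) u x =
    'D_(rat_rV R p.1) u x + 'D_(rat_rV R p.2) u x}.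
  by apply: ae_forall_count => p; exact: ae_deriveD uK.
move: d1 d2; apply: filterS2 => x dx Dx.
by apply: gateaux_differentiable uK dx _ => a b; exact: (Dx (a, b)).
Qed.

Lemma rademacher m (f : 'rV[R]_n -> 'rV[R]_m) (K : R) : lip_with K f ->
  {ae mu, forall x : 'rV[R]_n, differentiable f x}.
Proof.
move=> fK; have FF := ae_filter_ringOfSetsType mu.
have : {ae mu, forall x : 'rV[R]_n, forall i, differentiable (fun y => f y 0 i) x}.
  apply: ae_forall_count => i; apply: (@rademacher_scalar _ K) => x y.
  have := rV_coord_le (f x - f y) i; rewrite !mxE => /le_trans; apply.
  exact: fK.
by apply: filterS => x; exact: differentiable_rV.
Qed.

End rademacher_vector.

(** * Averaging the circulation of a pair of functions *)

Section averaging.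
Context (R : realType) (n : nat).
Implicit Types (u w : 'rV[R]_n -> R) (a b q x : 'rV[R]_n).

(** For smooth [u] and [w] and [N] large, this approximates the integral over
    [0 <= s, s' <= t] of ['D_a u - 'D_b w] at [x + s *: a + s' *: b], by sums over the
    two pairs of opposite sides of the parallelogram. *)
Definition circulation u w a b (t : R) (N : nat) x : R :=
  t / N%:R * \sum_(j < N)
   ((u (x + t *: a + (j%:R * (t / N%:R)) *: b) - u (x + (j%:R * (t / N%:R)) *: b))
    - (w (x + (j%:R * (t / N%:R)) *: a + t *: b) - w (x + (j%:R * (t / N%:R)) *: a))).

Lemma diffq_telescope u v (h : R) (N : nat) x : h != 0 ->
  \sum_(i < N) h * diffq u v h (x + (i%:R * h) *: v) =
  u (x + (N%:R * h) *: v) - u x.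
Proof.
move=> h0; rewrite -(big_mkord xpredT (fun i => h * diffq u v h (x + (i%:R * h) *: v))).
rewrite (eq_bigr (fun i => u (x + (i.+1%:R * h) *: v) - u (x + (i%:R * h) *: v))).
  rewrite (telescope_sumr (fun i => u (x + (i%:R * h) *: v)))//.
  by rewrite mul0r scale0r addr0.
move=> i _; rewrite /diffq mulVKf//; congr (u _ - _).
by rewrite addrCA -scalerDl -natr1 mulrDl mul1r [h + _]addrC.
Qed.

(** Subdividing the increment over [t *: a], resp. [t *: b], into [N] telescoping
    increments produces difference quotients at the points of a square grid. *)
Lemma circulationE u w a b t N x : 0 < t -> (0 < N)%N ->
  let h := t / N%:R in
  circulation u w a b t N x = \sum_(p : 'I_N * 'I_N)
    h ^+ 2 * (diffq u a h (x + (p.1%:R * h) *: a + (p.2%:R * h) *: b) -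
              diffq w b h (x + (p.1%:R * h) *: a + (p.2%:R * h) *: b)).
Proof.
move=> t0 N0 h; have N0' : N%:R != 0 :> R by rewrite pnatr_eq0 -lt0n.
have h0 : h != 0 by rewrite mulf_neq0 ?invr_eq0// gt_eqF.
have Nh : N%:R * h = t by rewrite /h mulrC divfK.
rewrite /circulation -/h -(pair_bigA _ (fun i j : 'I_N => h ^+ 2 *
   (diffq u a h (x + (i%:R * h) *: a + (j%:R * h) *: b) -
    diffq w b h (x + (i%:R * h) *: a + (j%:R * h) *: b))))/=.
under [RHS]eq_bigr => i _ do under eq_bigr => j _ do rewrite mulrBr.
under [RHS]eq_bigr => i _ do rewrite sumrB.
rewrite [RHS]sumrB [X in _ = X - _]exchange_big/= mulr_sumr -sumrB.
apply: eq_bigr => j _; rewrite mulrBr; congr (_ - _).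
  rewrite -mulr_sumr expr2 -[RHS]mulrA; congr (_ * _).
  rewrite mulr_sumr -[t in LHS]Nh.
  under [RHS]eq_bigr => i _ do rewrite addrAC.
  by rewrite diffq_telescope// addrAC.
rewrite -mulr_sumr expr2 -[RHS]mulrA; congr (_ * _).
by rewrite mulr_sumr diffq_telescope// Nh.
Qed.

(** The constant does not depend on [N], so the base point can be averaged before
    [N] tends to infinity. *)
Lemma circulation_lip u w (K : R) a b t N x y : lip_with K u -> lip_with K w ->
  0 < t -> (0 < N)%N ->
  `|circulation u w a b t N x - circulation u w a b t N y| <= 4 * K * t * `|x - y|.
Proof.
move=> uK wK t0 N0; have N0' : N%:R != 0 :> R by rewrite pnatr_eq0 -lt0n.
have hN : 0 <= t / N%:R by rewrite divr_ge0// ltW.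
rewrite /circulation -mulrBr -sumrB normrM ger0_norm//.
rewrite (@le_trans _ _ (t / N%:R * \sum_(j < N) (4 * K * `|x - y|)))//.
  rewrite ler_wpM2l//; apply: le_trans (ler_norm_sum _ _ _) _.
  apply: ler_sum => j _.
  have uD v : `|u (x + v) - u (y + v)| <= K * `|x - y|.
    by rewrite (le_trans (uK _ _))// opprD addrACA subrr addr0.
  have wD v : `|w (x + v) - w (y + v)| <= K * `|x - y|.
    by rewrite (le_trans (wK _ _))// opprD addrACA subrr addr0.
  rewrite -!addrA.
  have := uD (t *: a + (j%:R * (t / N%:R)) *: b).
  have := uD ((j%:R * (t / N%:R)) *: b).
  have := wD ((j%:R * (t / N%:R)) *: a + t *: b).
  have := wD ((j%:R * (t / N%:R)) *: a).
  rewrite !ler_norml -!mulrA; set d := K * `|x - y|.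
  by move: (u _) (u _) (u _) (u _) (w _) (w _) (w _) (w _) => *; lra.
rewrite sumr_const card_ord -[leRHS]mulr1 -[_ *+ N]mulr_natr.
by rewrite le_eqVlt; apply/orP; left; apply/eqP; field.
Qed.

Variable mu : {sigma_finite_measure set (borel_rV R n) -> \bar R}.
Hypothesis mu_fin : forall r, (mu (ball (0%R : 'rV[R]_n) r) < +oo)%E.
Hypothesis mu_pos : forall r, 0 < r -> (0 < mu (ball (0%R : 'rV[R]_n) r))%E.
Hypothesis mu_tr : forall (v : 'rV[R]_n) (A : set 'rV[R]_n),
  measurable (A : set (borel_rV R n)) ->
  mu ((fun x : 'rV[R]_n => x + v) @^-1` A) = mu A.

(** The amount by which difference quotients violate, near [q], the bound [M] that
    the derivatives satisfy. *)
Definition excess u w a b (M rho h : R) q x : R :=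
  Num.max 0 (diffq u a h x - diffq w b h x - M) * \1_(ball q rho) x.

Lemma excess_ge0 u w a b (M rho h : R) q x : 0 <= excess u w a b M rho h q x.
Proof. by rewrite mulr_ge0// le_max lexx. Qed.

Lemma excess_ge u w a b (M rho h : R) q x : `|q - x| < rho ->
  diffq u a h x - diffq w b h x <= M + excess u w a b M rho h q x.
Proof.
move=> qx; rewrite /excess indicE mem_set ?mulr1; last by rewrite -ball_normE.
by rewrite -lerBlDl le_max lexx orbT.
Qed.

Lemma max0_continuous : continuous (fun y : R => Num.max 0 y).
Proof.
by apply: (@lip_with_continuous _ _ _ 1) => y z; rewrite mul1r dist_max0.
Qed.

Lemma measurable_excess u w a b (M rho h : R) q : continuous u -> continuous w ->
  measurable_fun (setT : set (borel_rV R n)) (excess u w a b M rho h q).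
Proof.
move=> cu cw.
have mB : measurable (ball q rho : set (borel_rV R n)).
  by apply: open_borel_rV; exact: ball_open.
apply: measurable_funM; last exact: measurable_indic.
pose G x := diffq u a h x - diffq w b h x - M.
apply: (@continuous_borel_R _ _ ((fun y : R => Num.max 0 y) \o G)) => x.
apply: continuous_comp; last exact: max0_continuous.
have c1 := @diffq_continuous R _ u a h cu x.
have c2 := @diffq_continuous R _ w b h cw x.
exact: (cvgB (cvgB c1 c2) (cvg_cst M)).
Qed.

Lemma supp_bound_excess u w (K : R) a b (M rho h : R) q :
  lip_with K u -> lip_with K w -> h != 0 ->
  supp_bound (K * `|a| + K * `|b| + `|M|) (`|q| + rho) (excess u w a b M rho h q).
Proof.
move=> uK wK h0; pose G x := diffq u a h x - diffq w b h x - M.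
have GC x : `|G x| <= K * `|a| + K * `|b| + `|M|.
  rewrite /G (le_trans (ler_normB _ _))// lerD// (le_trans (ler_normB _ _))//.
  by rewrite lerD//; exact: diffq_bound.
apply/supp_boundP => x; split => xr; rewrite /excess.
  rewrite normrM (@le_trans _ _ (`|Num.max 0 (G x)| * 1))//.
    by rewrite ler_wpM2l// indicE; case: (_ \in _); rewrite ?normr1 ?normr0.
  rewrite mulr1 (le_trans _ (GC x))//.
  by have := dist_max0 (G x) 0; rewrite maxxx !subr0.
have nb : ~ ball q rho x.
  rewrite -ball_normE/= => qx; have := ler_normB q (q - x).
  by rewrite subKr => *; lra.
by rewrite indicE memNset// mulr0.
Qed.

(** The increments [t * harmonic N] tend to 0 and the difference quotients converge
    almost everywhere to the derivatives, which do not exceed [M] near [q]. *)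
Lemma excess_cvg0 u w (K : R) a b (M rho t : R) q : lip_with K u -> lip_with K w ->
  0 < t ->
  {ae mu, forall x : 'rV[R]_n, `|x - q| < rho -> 'D_a u x - 'D_b w x <= M} ->
  (\int[mu]_x (excess u w a b M rho (t * harmonic N) q x)%:E @[N --> \oo] --> 0)%E.
Proof.
move=> uK wK t0 ae_le; have FF := ae_filter_ringOfSetsType mu.
have [cu cw] := (lip_with_continuous uK, lip_with_continuous wK).
pose h N : R := t * harmonic N.
have h0 N : h N != 0 by rewrite mulf_neq0 ?gt_eqF// harmonic_gt0.
rewrite -(integral0 mu setT).
apply: (supp_bound_dct mu_fin (C := K * `|a| + K * `|b| + `|M|) (r := `|q| + rho)
  (F := fun N x => excess u w a b M rho (h N) q x) (f := cst 0)) => //.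
- by move=> N; exact: measurable_excess.
- have du := lip_ae_derivable_dir mu_tr a uK.
  have dw := lip_ae_derivable_dir mu_tr b wK.
  apply: filterS3 ae_le du dw => x le_x dux dwx.
  have [xq|xq] := pselect (ball q rho x); last first.
    rewrite (_ : (fun N => _) = cst 0); first exact: cvg_cst.
    by apply/funext => N; rewrite /excess indicE memNset// mulr0.
  pose G N := diffq u a (h N) x - diffq w b (h N) x - M.
  rewrite (_ : (fun N => _) = (fun N => Num.max 0 (G N))); last first.
    by apply/funext => N; rewrite /excess indicE mem_set// mulr1.
  have -> : cst 0 x = Num.max 0 ('D_a u x - 'D_b w x - M).
    rewrite max_l// subr_le0 le_x//.
    by move: xq; rewrite -ball_normE/= distrC.
  apply: (@cvg_comp _ _ _ G (fun y : R => Num.max 0 y)); last exact: max0_continuous.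
  have t0' : t != 0 by rewrite gt_eqF.
  exact: cvgB (cvgB (diffq_scaled_cvg t0' dux) (diffq_scaled_cvg t0' dwx)) (cvg_cst _).
- by move=> N; exact: supp_bound_excess.
Qed.

(** On a ball of radius [r] around [q] the circulation differs from its value at
    [q] by at most [4 K t r].  At each base point it is at most [t^2 M] plus a sum of
    translates of [excess], and by translation invariance each of these translates has
    the same integral, which tends to 0 with the mesh. *)
Lemma averaging u w (K : R) a b (M rho t e : R) q : lip_with K u -> lip_with K w ->
  0 < t -> t * (`|a| + `|b|) < rho -> 0 < e ->
  {ae mu, forall x : 'rV[R]_n, `|x - q| < rho -> 'D_a u x - 'D_b w x <= M} ->
  \forall N \near \oo, circulation u w a b t N.+1 q <= t ^+ 2 * M + e.
Proof.
move=> uK wK t0 trho e0 ae_le.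
have [cu cw] := (lip_with_continuous uK, lip_with_continuous wK).
have D0 : 0 < 8 * `|K| * t + 1 by rewrite ltr_pwDr// mulr_ge0 ?(ltW t0)// mulr_ge0.
(* Small enough for the grids based in the ball of radius [r] to stay at distance
   less than [rho] from [q], and for [circulation] to vary by at most [e / 2] there. *)
pose r := Num.min (rho - t * (`|a| + `|b|)) (e / (8 * `|K| * t + 1)).
have r0 : 0 < r by rewrite lt_min subr_gt0 trho divr_gt0.
have rrho : r + t * (`|a| + `|b|) <= rho by rewrite -lerBrDr ge_min lexx.
have Kr : 4 * `|K| * t * r <= e / 2.
  have : r <= e / (8 * `|K| * t + 1) by rewrite ge_min lexx orbT.
  by rewrite ler_pdivlMr// mulrDr mulr1; nra.
pose beta := fine (mu (ball (0 : 'rV[R]_n) r)).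
have betaE : mu (ball q r) = beta%:E.
  have mB0 : measurable (ball (0 : 'rV[R]_n) r : set (borel_rV R n)).
    by apply: open_borel_rV; exact: ball_open.
  rewrite /beta fineK; last by rewrite ge0_fin_numE ?mu_fin// measure_ge0.
  rewrite -(mu_tr (- q) mB0); congr (mu _); apply/seteqP.
  by split => x; rewrite /preimage/= -!ball_normE/= sub0r normrN distrC.
have beta0 : 0 < beta.
  by rewrite /beta fine_gt0// mu_pos//= mu_fin.
have mB : measurable (ball q r : set (borel_rV R n)).
  by apply: open_borel_rV; exact: ball_open.
have eb : 0 < beta * e / (2 * t ^+ 2).
  by rewrite divr_gt0// ?mulr_gt0// exprn_gt0.
have eta0 := excess_cvg0 uK wK t0 ae_le.
pose E N := excess u w a b M rho (t * harmonic N) q.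
have E0 N x : 0 <= E N x by exact: excess_ge0.
have mE N : measurable_fun (setT : set (borel_rV R n)) (E N).
  exact: measurable_excess.
have iE N : mu.-integrable setT (EFin \o E N : borel_rV R n -> \bar R).
  apply: (supp_bound_integrable mu_fin (mE N)); apply: supp_bound_excess uK wK _.
  by rewrite mulf_neq0 ?gt_eqF// harmonic_gt0.
pose I N := fine (\int[mu]_x (E N x)%:E)%E.
have IE N : (\int[mu]_x (E N x)%:E)%E = (I N)%:E.
  by rewrite /I fineK// (integrable_fin_num _ (iE N)).
have : \forall N \near \oo, I N <= beta * e / (2 * t ^+ 2).
  have /fine_cvg/cvgr0_norm_le := eta0.
  by move=> /(_ _ eb); apply: filterS => N; apply: le_trans; exact: ler_norm.
apply: filterS => N etaN.
set P := N.+1.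
pose h := t / P%:R.
pose y (p : 'I_P * 'I_P) : 'rV[R]_n := (p.1%:R * h) *: a + (p.2%:R * h) *: b.
pose T x := \sum_(p : 'I_P * 'I_P) h ^+ 2 * E N (x + y p).
pose c := circulation u w a b t P q - t ^+ 2 * M - 4 * `|K| * t * r.
(* [T] is at least [c] on the ball, whose measure is [beta], and its integral
   is [t ^+ 2 * I N]. *)
suff cb : c * beta <= t ^+ 2 * I N.
  have : c <= e / 2.
    rewrite -(ler_pM2r beta0) (le_trans cb)//.
    rewrite (le_trans (ler_wpM2l (sqr_ge0 t) etaN))//.
    by rewrite le_eqVlt; apply/orP; left; apply/eqP; field; rewrite gt_eqF.
  by rewrite /c; lra.
have h0 : 0 < h by rewrite divr_gt0// ltr0n.
have hP : P%:R * h = t by rewrite /h mulrC divfK// pnatr_eq0.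
have card_h : (h ^+ 2) *+ #|{: 'I_P * 'I_P}| = t ^+ 2.
  by rewrite card_prod card_ord -mulr_natr natrM -hP; ring.
have yt p : `|y p| <= t * (`|a| + `|b|).
  have ht (i : 'I_P) : `|i%:R * h| <= t.
    rewrite ger0_norm; last by rewrite mulr_ge0// ltW.
    have : i%:R * h <= P%:R * h.
      by apply: ler_wpM2r; [exact: ltW|rewrite ler_nat; exact: ltnW].
    by rewrite hP.
  apply: le_trans (ler_normD _ _) _.
  rewrite mulrDr (normrZ _ a) (normrZ _ b).
  by apply: lerD; apply: ler_wpM2r => //; exact: ht.
have cT x : ball q r x -> c <= T x.
  rewrite -ball_normE/= => qx.
  have lipK (v : 'rV[R]_n -> R) : lip_with K v -> lip_with `|K| v.
    by move=> vK z z'; rewrite (le_trans (vK _ _))// ler_wpM2r// ler_norm.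
  have := circulation_lip (N := P) a b q x (lipK _ uK) (lipK _ wK) t0 isT.
  rewrite ler_norml => /andP[_ cxq].
  have : circulation u w a b t P x <= t ^+ 2 * M + T x.
    rewrite circulationE// -/h /T -card_h mulrnAl -sumr_const -big_split/=.
    apply: ler_sum => p _; rewrite -mulrDr ler_wpM2l ?sqr_ge0// -addrA.
    have qy : `|q - (x + y p)| < rho.
      have := yt p; have := ler_normB (q - x) (y p).
      have -> : q - (x + y p) = q - x - y p by rewrite [in LHS]opprD addrA.
      by move=> *; lra.
    exact: excess_ge qy.
  have : 4 * `|K| * t * `|q - x| <= 4 * `|K| * t * r.
    by apply: ler_wpM2l; [rewrite !mulr_ge0// ltW|exact: ltW].
  by rewrite /c; lra.
have [c0|c0] := leP c 0.
  apply: (@le_trans _ _ 0); first by rewrite mulr_le0_ge0// ltW.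
  apply: mulr_ge0; first exact: sqr_ge0.
  by rewrite /I fine_ge0// integral_ge0// => x _; rewrite lee_fin.
have T0 x : 0 <= T x by apply: sumr_ge0 => p _; rewrite mulr_ge0 ?sqr_ge0.
have mEy p : measurable_fun setT (fun x : borel_rV R n => E N (translate (y p) x)).
  exact: measurableT_comp (mE N) (measurable_translate (y p)).
have IT : (\int[mu]_x (T x)%:E = (t ^+ 2 * I N)%:E)%E.
  rewrite /T.
  transitivity (\int[mu]_x (\sum_(p : 'I_P * 'I_P) (h ^+ 2 * E N (translate (y p) x))%:E))%E.
    by apply: eq_integral => x _; rewrite sumEFin.
  rewrite ge0_integral_sum//; last 2 first.
  - by move=> p; apply/measurable_EFinP; exact: measurable_funM.
  - by move=> p x _; rewrite lee_fin mulr_ge0 ?sqr_ge0.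
  transitivity (\sum_(p : 'I_P * 'I_P) (h ^+ 2 * I N)%:E)%E.
    apply: eq_bigr => p _.
    have mEp : measurable_fun setT (fun x : borel_rV R n => (E N (translate (y p) x))%:E).
      exact/measurable_EFinP.
    have nn x : [set: borel_rV R n] x -> (0 <= (E N (translate (y p) x))%:E)%E.
      by rewrite lee_fin.
    rewrite (ge0_integralZl_EFin mu measurableT nn mEp (sqr_ge0 h)).
    by rewrite (integral_translation mu_tr (y p) (iE N)) IE.
  by rewrite sumEFin sumr_const -mulrnAl card_h.
pose ind (x : borel_rV R n) : \bar R := (\1_(ball q r) x)%:E.
have mind : measurable_fun setT ind.
  by apply/measurable_EFinP; exact: measurable_indic.
have ind0 x : [set: borel_rV R n] x -> (0 <= ind x)%E by rewrite lee_fin.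
rewrite -lee_fin EFinM -betaE -IT -[ball q r]setIT -integral_indic//.
rewrite -(ge0_integralZl_EFin mu measurableT ind0 mind (ltW c0)).
apply: ge0_le_integral => //.
- by move=> x _; apply: mule_ge0; rewrite lee_fin// ltW.
- exact: measurable_funeM.
- apply/measurable_EFinP; apply: measurable_sum => p.
  by apply: measurable_funM => //; exact: mEy.
- move=> x _; rewrite lee_fin indicE; case: (boolP (_ \in _)) => [/set_mem/cT|_].
    by rewrite mulr1.
  by rewrite mulr0.
Qed.

End averaging.

(** * Curves in R^n *)

Section curves.
Context (R : realType) (n : nat).
Implicit Types (y z : R -> 'rV[R]_n) (v : 'rV[R]_n).

Lemma is_derive_rVP y (s : R) v :
  is_derive s 1 y v <-> forall i, is_derive s 1 (fun r => y r 0 i) (v 0 i).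
Proof.
split=> [dy i|dy].
  have dyv : derivable y s 1 by [].
  apply: DeriveDef; first by move/derivable_mxP : dyv.
  by have := @derive_val _ _ _ _ _ _ _ dy; rewrite derive_mx// => <-; rewrite mxE.
have dyv : derivable y s 1.
  by apply/derivable_mxP => i j; rewrite ord1; have := dy j => d.
apply: DeriveDef => //; rewrite derive_mx//; apply/rowP => i; rewrite mxE.
exact: (@derive_val _ _ _ _ _ _ _ (dy i)).
Qed.

(** The norm is the sup norm, so the scalar mean value theorem may be applied
    to each coordinate. *)
Lemma rV_mvi y (dy : R -> 'rV[R]_n) (a b B : R) v : a <= b ->
  (forall s, s \in `[a, b] -> is_derive s 1 y (dy s)) ->
  (forall s, s \in `[a, b] -> `|dy s - v| <= B) ->
  `|y b - y a - (b - a) *: v| <= B * (b - a).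
Proof.
move=> ab yd dyB.
have B0 : 0 <= B.
  by rewrite (le_trans _ (dyB a _))// in_itv/= lexx.
apply/rV_norm_leP => [|i]; first by rewrite mulr_ge0// subr_ge0.
have yd' s : s \in `[a, b] -> is_derive s 1 (fun r => y r 0 i) (dy s 0 i).
  by move=> sab; move: i; apply/is_derive_rVP; exact: yd.
have dO s : s \in `]a, b[ -> is_derive s 1 (fun r => y r 0 i) (dy s 0 i).
  move=> sab; apply: yd'; move: sab; rewrite !in_itv/= => /andP[as_ sb].
  by rewrite !ltW.
have cy : {within `[a, b], continuous (fun r => y r 0 i)}.
  apply: derivable_within_continuous => s sab.
  exact: (@ex_derive _ _ _ _ _ _ _ (yd' s sab)).
have [c cab E] := MVT_segment ab dO cy.
rewrite !mxE; have := E => /= ->; rewrite mulrC -mulrBr normrM mulrC.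
rewrite (ger0_norm (_ : 0 <= b - a)) ?subr_ge0// ler_wpM2r ?subr_ge0//.
by have := rV_coord_le (dy c - v) i; rewrite !mxE => /le_trans; apply; exact: dyB.
Qed.

(** Inequalities of this form pass to limits of curves, unlike derivatives. *)
Lemma is_derive_quadratic y (s A eta : R) v : 0 < eta ->
  (forall h, `|h| < eta -> `|y (s + h) - y s - h *: v| <= A * h ^+ 2) ->
  is_derive s 1 y v.
Proof.
move=> eta0 yA.
have H : h^-1 *: ((y \o shift s) (h *: 1) - y s) @[h --> 0^'] --> v.
  apply/cvgrPdist_le => e e0.
  near=> h.
  have h0 : h != 0 by near: h; exact: nbhs_dnbhs_neq.
  have -> : v = h^-1 *: (h *: v) by rewrite scalerA mulVf// scale1r.
  rewrite /= -scalerBr normrZ normfV ler_pdivrMl ?normr_gt0//.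
  rewrite distrC [h *: 1]mulr1 [h + s]addrC (le_trans (yA h _))//.
    by near: h; exact: dnbhs0_lt.
  have he : `|h| <= e / (`|A| + 1).
    by near: h; apply: dnbhs0_le; rewrite divr_gt0// ltr_pwDr.
  rewrite -real_normK ?num_real// expr2 mulrA mulrC ler_wpM2l//.
  rewrite (@le_trans _ _ ((`|A| + 1) * `|h|))//.
    by rewrite ler_wpM2r// ler_wpDr// ler_norm.
  by rewrite mulrC -ler_pdivlMr// ltr_pwDr.
by apply: DeriveDef; [apply/cvg_ex; exists v|exact/cvg_lim].
Unshelve. all: by end_near. Qed.

Lemma antiderivative (phi : R -> R) (c : R) : continuous phi ->
  exists Phi : R -> R, Phi 0 = c /\ forall s : R, s \in `]-1, 1[ -> is_derive s 1 Phi (phi s).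
Proof.
move=> cphi.
pose G x := (\int[@lebesgue_measure R]_(t in `[-1, x]) phi t)%R.
exists (G + cst (c - G 0)); split; first by rewrite fctE /= addrC subrK.
move=> s; rewrite in_itv/= => /andP[s1 s2].
have [|dG GE] := @continuous_FTC1_closed R phi (-1) s 1 s2 _ s1 (cphi s).
  apply: continuous_compact_integrable; first exact: segment_compact.
  exact: continuous_subspaceT.
have dG' : is_derive s 1 G (phi s).
  by apply: DeriveDef; [exact: dG|rewrite -derive1E; exact: GE].
by rewrite -[phi s]addr0; exact: is_deriveD.
Qed.

Lemma antiderivative_rV (phi : R -> 'rV[R]_n) (c : 'rV[R]_n) : continuous phi ->
  exists Phi : R -> 'rV[R]_n, Phi 0 = c /\
    forall s : R, s \in `]-1, 1[ -> is_derive s 1 Phi (phi s).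
Proof.
move=> cphi.
have /choice[Phi PhiP] : forall i, exists P : R -> R, P 0 = c 0 i /\
    forall s : R, s \in `]-1, 1[ -> is_derive s 1 P (phi s 0 i).
  move=> i; apply: (antiderivative (phi := fun s => phi s 0 i)) => s.
  by apply: (@cvg_comp _ _ _ phi (fun v : 'rV[R]_n => v 0 i)); [exact: cphi|exact: coord_continuous].
exists (fun s => \row_i Phi i s); split.
  by apply/rowP => i; rewrite mxE (PhiP i).1.
move=> s s1; apply/is_derive_rVP => i; have := (PhiP i).2 s s1.
by congr (is_derive _ _ _ _); apply/funext => r; rewrite mxE.
Qed.

End curves.

(** * Picard iteration *)

Lemma rV_mvi_sym (R : realType) n (y dy : R -> 'rV[R]_n) (S B : R) (v : 'rV[R]_n) (a b : R) :
  (forall s : R, `|s| <= S -> is_derive s 1 y (dy s)) ->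
  `|a| <= S -> `|b| <= S ->
  (forall s : R, `|s| <= S -> `|s - a| <= `|b - a| -> `|dy s - v| <= B) ->
  `|y b - y a - (b - a) *: v| <= B * `|b - a|.
Proof.
move=> yd; rewrite !ler_norml => /andP[a1 a2] /andP[b1 b2] dB.
have [ab|ba] := leP a b.
  rewrite (ger0_norm (_ : 0 <= b - a)) ?subr_ge0//.
  apply: (rV_mvi (dy := dy)) => // s; rewrite in_itv/= => /andP[as_ sb].
    by apply: yd; rewrite ler_norml (le_trans a1)//= (le_trans sb).
  apply: dB; first by rewrite ler_norml (le_trans a1)//= (le_trans sb).
  by rewrite !ger0_norm ?subr_ge0// lerB.
rewrite (ltr0_norm (_ : b - a < 0)) ?subr_lt0// opprB.
have -> : y b - y a - (b - a) *: v = - (y a - y b - (a - b) *: v).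
  by rewrite -(opprB a b) scaleNr opprK [RHS]opprB addrC -(opprB (y a)).
rewrite normrN; apply: (rV_mvi (dy := dy)); first exact: ltW.
  move=> s; rewrite in_itv/= => /andP[bs sa].
  by apply: yd; rewrite ler_norml (le_trans b1)//= (le_trans sa).
move=> s; rewrite in_itv/= => /andP[bs sa].
apply: dB; first by rewrite ler_norml (le_trans b1)//= (le_trans sa).
by rewrite !ler0_norm ?subr_le0 ?(ltW ba)// lerN2 lerB.
Qed.

(** Precomposition with this truncation extends to all of R a curve that is only
    controlled on [-S, S]. *)
Definition clampR (R : realType) (S s : R) := Num.max (- S) (Num.min S s).

Lemma clampR_norm (R : realType) (S s : R) : 0 <= S -> `|clampR S s| <= S.
Proof.
move=> S0; rewrite ler_norml /clampR le_max lexx/= ge_max ge_min lexx andbT.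
by rewrite -subr_ge0 opprK addr_ge0.
Qed.

Lemma clampR_id (R : realType) (S s : R) : `|s| <= S -> clampR S s = s.
Proof. by rewrite ler_norml => /andP[h1 h2]; rewrite /clampR min_r// max_r. Qed.

Lemma clampR_lip (R : realType) (S s s' : R) :
  0 <= S -> `|clampR S s - clampR S s'| <= `|s - s'|.
Proof.
move=> S0; rewrite /clampR.
case: (leP S s) => h1; case: (leP S s') => h2;
  rewrite ?(max_r (_ : - S <= S)) ?subrr ?normr0//; try lra.
- case: (leP (- S) s') => h3; rewrite !ger0_norm; lra.
- case: (leP (- S) s) => h3; rewrite distrC [leRHS]distrC !ger0_norm; lra.
- case: (leP (- S) s) => h3; case: (leP (- S) s') => h4; rewrite ?subrr ?normr0//.
  + rewrite !ger0_norm; lra.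
  + rewrite distrC [leRHS]distrC !ger0_norm; lra.
Qed.

Section picard.
Context (R : realType) (n : nat).
Variables (F : 'rV[R]_n -> 'rV[R]_n) (K C S : R).
Hypothesis FK : lip_with K F.
Hypothesis FC : forall x, `|F x| <= C.
Hypothesis K0 : 0 <= K.
Hypothesis S0 : 0 < S.
Hypothesis S1 : S < 1.
Hypothesis KS : K * S <= 1 / 2.

Let C0 : 0 <= C. Proof. exact: le_trans (normr_ge0 _) (FC 0). Qed.

Lemma picard_step (q : 'rV[R]_n) (y : R -> 'rV[R]_n) : lip_with C (y \o clampR S) ->
  exists y' : R -> 'rV[R]_n, [/\ y' 0 = q, lip_with C (y' \o clampR S) &
    forall s : R, `|s| <= S -> is_derive s 1 y' (F (y s))].
Proof.
move=> yC.
have cphi : continuous (fun s => F (y (clampR S s))).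
  apply: (@lip_with_continuous _ _ _ (K * C)) => s s'.
  by rewrite (le_trans (FK _ _))// -mulrA ler_wpM2l//; exact: yC.
have [y' [y'0 dy']] := antiderivative_rV q cphi.
have dy'S (s : R) : `|s| <= S -> is_derive s 1 y' (F (y s)).
  move=> sS; rewrite -{2}(clampR_id sS); apply: dy'.
  by rewrite in_itv/= -ltr_norml (le_lt_trans sS).
exists y'; split => // s s' /=.
have S0' := ltW S0.
rewrite -[y' _ - _]subr0 -[in X in _ - X](scaler0 _ (clampR S s - clampR S s')).
apply: (@le_trans _ _ (C * `|clampR S s - clampR S s'|)); last first.
  by rewrite ler_wpM2l// clampR_lip.
apply: (rV_mvi_sym dy'S); rewrite ?clampR_norm// => r _ _.
by rewrite subr0.
Qed.

(** The iterates [y k] are Cauchy, since [K * S <= 1 / 2] halves the distance at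
    each step.  Their limit [z] satisfies
    [`|z (s + h) - z s - h *: F (z s)| <= K * C * h ^+ 2], which contains the
    equation ([is_derive_quadratic]). *)
Lemma picard (q : 'rV[R]_n) : exists y : R -> 'rV[R]_n,
  y 0 = q /\ forall s : R, `|s| < S -> is_derive s 1 y (F (y s)).
Proof.
have /choice[Phi PhiP] : forall y : R -> 'rV[R]_n, exists y' : R -> 'rV[R]_n,
    lip_with C (y \o clampR S) -> [/\ y' 0 = q, lip_with C (y' \o clampR S) &
    forall s : R, `|s| <= S -> is_derive s 1 y' (F (y s))].
  move=> y; have [yC|yC] := pselect (lip_with C (y \o clampR S)).
    by have [y' h] := picard_step q yC; exists y'.
  by exists y.
pose y k := iter k Phi (cst q).
have yC k : lip_with C (y k \o clampR S).
  elim: k => [s s'|k IH]; first by rewrite /= subrr normr0 mulr_ge0.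
  by have [] := PhiP _ IH.
have y0 k : y k 0 = q.
  by case: k => [//|k]; have [] := PhiP _ (yC k).
have dy k (s : R) : `|s| <= S -> is_derive s 1 (y k.+1) (F (y k s)).
  by move=> sS; have [_ _] := PhiP _ (yC k); apply.
have ylip k (s s' : R) : `|s| <= S -> `|s'| <= S -> `|y k s - y k s'| <= C * `|s - s'|.
  move=> sS s'S; have := yC k s s'; rewrite /= !clampR_id//.
have z0S : `|0 : R| <= S by rewrite normr0 ltW.
have e0 k : 0 <= (1 / 2 : R) ^+ k by rewrite exprn_ge0// divr_ge0.
have Ce0 k : 0 <= C * (1 / 2 : R) ^+ k by rewrite mulr_ge0.
have ystep k (s : R) : `|s| <= S -> `|y k.+1 s - y k s| <= C * (1 / 2) ^+ k.
  elim: k s => [|k IH] s sS.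
    have := ylip 1%N s 0 sS z0S; rewrite y0 subr0 => /le_trans; apply.
    by rewrite expr0 ler_wpM2l// (le_trans sS)// ltW.
  have dD (r : R) : `|r| <= S -> is_derive r 1 (y k.+2 - y k.+1) (F (y k.+1 r) - F (y k r)).
    by move=> rS; have := dy k.+1 r rS; have := dy k r rS => d1 d2; exact: is_deriveB.
  have := @rV_mvi_sym _ _ _ _ S (K * (C * (1 / 2) ^+ k)) 0 0 s dD z0S sS.
  rewrite !fctE !y0 subrr !subr0 scaler0 subr0 => h.
  apply: le_trans (h _) _.
    by move=> r rS _; rewrite subr0 (le_trans (FK _ _))// ler_wpM2l// IH.
  have Ks : K * `|s| <= 1 / 2 by rewrite (le_trans _ KS)// ler_wpM2l.
  rewrite exprS [leRHS]mulrCA mulrAC ler_wpM2r//; exact: Ce0.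
have ytail k m (s : R) : `|s| <= S -> `|y (k + m)%N s - y k s| <= C * (1 / 2) ^+ k * 2.
  move=> sS; suff : `|y (k + m)%N s - y k s| <= C * (1 / 2) ^+ k * 2 * (1 - (1 / 2) ^+ m).
    move=> /le_trans; apply; rewrite -[leRHS]mulr1.
    by apply: ler_wpM2l; [rewrite mulr_ge0|rewrite lerBlDr lerDl].
  elim: m => [|m IH]; first by rewrite addn0 subrr normr0 expr0 subrr mulr0.
  rewrite addnS -(subrKA (y (k + m)%N s)) (le_trans (ler_normD _ _))//.
  have := ystep (k + m)%N s sS; rewrite exprD exprS.
  by move: IH; set p := _ ^+ k; set p' := _ ^+ m => *; lra.
have tail0 (eps : R) : 0 < eps -> exists k, C * (1 / 2) ^+ k * 2 < eps.
  move=> eps0; have h1 : `|1 / 2 : R| < 1 by rewrite ger0_norm; lra.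
  have c2 : 0 < eps / (C * 2 + 1) by rewrite divr_gt0// ltr_pwDr// mulr_ge0.
  have /cvgr0_norm_lt/(_ _ c2)[k _ /(_ k (leqnn k))/=] := cvg_expr h1.
  rewrite ger0_norm// => hk; exists k.
  rewrite mulrAC (@le_lt_trans _ _ ((C * 2 + 1) * (1 / 2) ^+ k))//.
    by rewrite ler_wpM2r// lerDl.
  by rewrite mulrC -ltr_pdivlMr// ltr_pwDr// mulr_ge0.
have /choice[z zP] : forall s : R, exists l : 'rV[R]_n, `|s| <= S ->
    y k s @[k --> \oo] --> l.
  move=> s; have [sS|sS] := leP `|s| S; last by exists 0.
  suff : cvg (y k s @[k --> \oo]) by move=> h; exists (lim (y k s @[k --> \oo])).
  apply/cauchy_cvgP/cauchy_exP => eps eps0; have [k hk] := tail0 eps eps0.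
  exists (y k s); exists k => // m /= km; rewrite -ball_normE/= distrC.
  by rewrite -(subnKC km) (le_lt_trans _ hk)// ytail.
have ztail k (s : R) : `|s| <= S -> `|z s - y k s| <= C * (1 / 2) ^+ k * 2.
  move=> sS; apply: (ler_cvg_to (cvg_norm (cvgB (zP s sS) (cvg_cst (y k s))))
    (cvg_cst (C * (1 / 2) ^+ k * 2))).
  by exists k => // m /= km; rewrite -(subnKC km) ytail.
have zlip (s s' : R) : `|s| <= S -> `|s'| <= S -> `|z s - z s'| <= C * `|s - s'|.
  move=> sS s'S; apply: (ler_cvg_to (cvg_norm (cvgB (zP s sS) (zP s' s'S)))
    (cvg_cst (C * `|s - s'|))).
  by apply: nearW => k; exact: ylip.
exists z; split.
  apply: (@cvg_unique _ _ _ _ _ _ (zP 0 z0S)).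
    exact: norm_hausdorff.
  by rewrite (_ : (fun k => _) = cst q); [exact: cvg_cst|apply/funext => k; exact: y0].
move=> s sS; apply: (@is_derive_quadratic _ _ _ _ (K * C) (S - `|s|)); first by rewrite subr_gt0.
move=> h hS.
have sS' := ltW sS.
have shS : `|s + h| <= S by rewrite (le_trans (ler_normD _ _))//; lra.
have bound k : `|y k.+1 (s + h) - y k.+1 s - h *: F (z s)| <=
    K * (C * (1 / 2) ^+ k * 2 + C * `|h|) * `|h|.
  have := @rV_mvi_sym _ _ _ _ S (K * (C * (1 / 2) ^+ k * 2 + C * `|h|)) (F (z s))
    s (s + h) (dy k) sS' shS.
  rewrite [s + h - s]addrAC subrr add0r; apply => r rS rsh.
  rewrite (le_trans (FK _ _))// ler_wpM2l// -(subrKA (z r)) (le_trans (ler_normD _ _))//.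
  rewrite lerD//; first by rewrite distrC ztail.
  by rewrite (le_trans (zlip _ _ rS sS'))// ler_wpM2l.
apply/ler_addgt0Pr => eps eps0.
have Kh : 0 < 1 + K * `|h| by rewrite ltr_wpDr// mulr_ge0.
have [k hk] := tail0 (eps / (1 + K * `|h|)) (divr_gt0 eps0 Kh).
move: hk; rewrite ltr_pdivlMr// => hk.
have := bound k; have := ztail k.+1 s sS'; have := ztail k.+1 (s + h) shS.
rewrite exprS -[h ^+ 2]real_normK ?num_real//.
have -> : z (s + h) - z s - h *: F (z s) = (z (s + h) - y k.+1 (s + h)) -
    (z s - y k.+1 s) + (y k.+1 (s + h) - y k.+1 s - h *: F (z s)).
  by apply/rowP => i; rewrite !mxE; ring.
set p := (1 / 2) ^+ k in hk *.
set A := z (s + h) - _; set B := z s - _; set D := _ - h *: _ => hA hB hD.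
have := ler_normD (A - B) D; have := ler_normB A B; move: hA hB hD hk.
move: (`|A|) (`|B|) (`|D|) (`|A - B|) (`|A - B + D|) (`|h|) => *; nra.
Qed.

End picard.

(** * Local flows *)

Definition lip_on (R : realType) (V W : normedModType R) (A : set V) (K : R)
  (u : V -> W) := forall x y, A x -> A y -> `|u x - u y| <= K * `|x - y|.

(** At a maximum point [c] of [`|y - z|] the mean value inequality yields
    [`|y c - z c| <= `|y 0 - z 0| + K * t * `|y c - z c|], with [K * t <= 1 / 2]. *)
Lemma flow_stability (R : realType) (n : nat) (Omega : set 'rV[R]_n)
    (f : 'rV[R]_n -> 'rV[R]_n) (K t : R) (y z : R -> 'rV[R]_n) :
  lip_on Omega K f -> 0 <= K -> 0 <= t -> K * t <= 1 / 2 ->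
  (forall s : R, s \in `[0, t] -> Omega (y s) /\ is_derive s 1 y (f (y s))) ->
  (forall s : R, s \in `[0, t] -> Omega (z s) /\ is_derive s 1 z (f (z s))) ->
  forall s, s \in `[0, t] -> `|y s - z s| <= 2 * `|y 0 - z 0|.
Proof.
move=> fK K0 t0 Kt yP zP.
pose D s := `|y s - z s|.
have cD : {within `[0, t], continuous D}.
  apply: continuous_in_subspaceT => s /set_mem sI.
  have dc (w : R -> 'rV[R]_n) v : is_derive s 1 w v -> {for s, continuous w}.
    move=> dw; apply: differentiable_continuous; apply/derivable1_diffP.
    exact: (@ex_derive _ _ _ _ _ _ _ dw).
  exact: cvg_norm (cvgB (dc _ _ (yP s sI).2) (dc _ _ (zP s sI).2)).
have [c cI cmax] := EVT_max t0 cD.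
have [c0 ct] : 0 <= c /\ c <= t by move: cI; rewrite in_itv/= => /andP.
have sub s : s \in `[0, c] -> s \in `[0, t].
  by rewrite !in_itv/= => /andP[-> sc]; rewrite (le_trans sc).
have dyz (s : R) : s \in `[0, c] -> is_derive s 1 (y - z) (f (y s) - f (z s)).
  move=> /sub sI; have [_ dy] := yP s sI; have [_ dz] := zP s sI.
  exact: is_deriveB.
have bound (s : R) : s \in `[0, c] -> `|f (y s) - f (z s) - 0| <= K * D c.
  move=> /sub sI; rewrite subr0 (le_trans (fK _ _ (yP s sI).1 (zP s sI).1))//.
  by rewrite ler_wpM2l// cmax.
have := rV_mvi c0 dyz bound; rewrite !fctE subr0 scaler0 subr0 => h.
have Dc : D c <= 2 * `|y 0 - z 0|.
  have h1 : D c <= `|y c - z c - (y 0 - z 0)| + `|y 0 - z 0|.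
    by rewrite /D -[in leLHS](subrK (y 0 - z 0) (y c - z c)) ler_normD.
  have h2 : K * D c * c <= 1 / 2 * D c.
    rewrite mulrAC ler_wpM2r ?normr_ge0// (le_trans _ Kt)// ler_wpM2l//.
  by lra.
by move=> s sI; exact: le_trans (cmax s sI) Dc.
Qed.

(** A retraction on the closed ball, nonexpansive for the sup norm; composed with
    it, a field that is Lipschitz on the ball becomes globally Lipschitz. *)
Definition clamp_rV (R : realType) n (q : 'rV[R]_n) (r : R) (x : 'rV[R]_n) :=
  q + \row_i clampR r ((x - q) 0 i).

Lemma clamp_rV_in (R : realType) n (q : 'rV[R]_n) (r : R) x : 0 <= r ->
  `|clamp_rV q r x - q| <= r.
Proof.
move=> r0; rewrite /clamp_rV addrC addKr; apply/rV_norm_leP => // i.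
by rewrite mxE clampR_norm.
Qed.

Lemma clamp_rV_id (R : realType) n (q : 'rV[R]_n) (r : R) x : 0 <= r ->
  `|x - q| <= r -> clamp_rV q r x = x.
Proof.
move=> r0 /(rV_norm_leP _ r0) xr; rewrite /clamp_rV.
have -> : \row_i clampR r ((x - q) 0 i) = x - q.
  by apply/rowP => i; rewrite mxE clampR_id.
by rewrite addrC subrK.
Qed.

Lemma clamp_rV_lip (R : realType) n (q : 'rV[R]_n) (r : R) : 0 <= r ->
  lip_with 1 (clamp_rV q r).
Proof.
move=> r0 x y; rewrite mul1r /clamp_rV opprD addrACA subrr add0r.
apply/rV_norm_leP => // i; rewrite !mxE (le_trans (clampR_lip _ _ r0))//.
have := rV_coord_le (x - y) i; rewrite !mxE => /(le_trans _); apply.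
by rewrite opprD addrACA subrr addr0.
Qed.

(** [picard] solves the equation of the truncated field [f \o clamp_rV q r], whose
    solutions do not leave the ball where it coincides with [f]; uniqueness
    ([flow_stability]) identifies the solution with the chosen value [flow]. *)
Lemma local_flow (R : realType) (n : nat) (Omega : set 'rV[R]_n)
    (f : 'rV[R]_n -> 'rV[R]_n) (K C r T : R) (q : 'rV[R]_n) :
  lip_on Omega K f -> 0 <= K -> 0 < r ->
  (forall x, `|x - q| <= r -> Omega x /\ `|f x| <= C) ->
  0 < T -> T < 1 -> K * T <= 1 / 2 -> C * T <= r / 2 ->
  exists phi : 'rV[R]_n -> R -> 'rV[R]_n, forall x, `|x - q| <= r / 2 ->
    [/\ phi x 0 = x,
        forall s, `|s| < T -> `|phi x s - q| <= r /\
          is_derive s 1 (phi x) (f (phi x s)) &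
        forall s, 0 <= s -> s < T -> flow Omega f s x = phi x s].
Proof.
move=> fK K0 r0 fC T0 T1 KT CT.
pose F := f \o clamp_rV q r.
have r0' := ltW r0.
have FK : lip_with K F.
  move=> x y; rewrite (le_trans (fK _ _ _ _))//.
  - by have [] := fC _ (clamp_rV_in q x r0').
  - by have [] := fC _ (clamp_rV_in q y r0').
  by rewrite ler_wpM2l//; have := clamp_rV_lip q r0' x y; rewrite mul1r.
have FC x : `|F x| <= C by have [] := fC _ (clamp_rV_in q x r0').
have C0 : 0 <= C := le_trans (normr_ge0 _) (FC 0).
have /choice[phi phiP] := picard FK FC K0 T0 T1 KT.
exists phi => x xq; have [phi0 dphi] := phiP x.
have phiC (s : R) : `|s| < T -> `|phi x s - x| <= C * `|s|.
  move=> sT.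
  have d (r' : R) : `|r'| <= `|s| -> is_derive r' 1 (phi x) (F (phi x r')).
    by move=> r's; apply: dphi; exact: le_lt_trans sT.
  have := @rV_mvi_sym _ _ _ _ `|s| C 0 0 s d.
  rewrite normr0 subr0 scaler0 subr0 phi0; apply => //.
  by move=> r' _ _; rewrite subr0.
have phiq (s : R) : `|s| < T -> `|phi x s - q| <= r.
  move=> sT; rewrite -(subrKA x) (le_trans (ler_normD _ _))//.
  rewrite (splitr r) lerD// (le_trans (phiC s sT))// (le_trans _ CT)//.
  by rewrite ler_wpM2l// ltW.
have dphi' (s : R) : `|s| < T -> is_derive s 1 (phi x) (f (phi x s)).
  by move=> sT; have := dphi s sT; rewrite /F/= clamp_rV_id// phiq.
split => //; first by move=> s sT; split; [exact: phiq|exact: dphi'].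
move=> s s0 sT; rewrite /flow; apply: xget_unique.
  exists (phi x), (- T), T; split => //.
  - by rewrite in_itv/= oppr_lt0 T0.
  - by rewrite in_itv/= sT andbT (lt_le_trans _ s0)// oppr_lt0.
  move=> s'; rewrite in_itv/= -ltr_norml => s'T.
  by split; [have [] := fC _ (phiq _ s'T)|exact: dphi'].
move=> p [y [a [b [ab0 abs y0 <- yP]]]].
have Ks : K * s <= 1 / 2 by rewrite (le_trans _ KT)// ler_wpM2l// ltW.
have I1 (s' : R) : s' \in `[0, s] -> Omega (phi x s') /\ is_derive s' 1 (phi x) (f (phi x s')).
  rewrite in_itv/= => /andP[s'0 s's].
  have s'T : `|s'| < T by rewrite ger0_norm// (le_lt_trans s's).
  by split; [have [] := fC _ (phiq _ s'T)|exact: dphi'].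
have I2 (s' : R) : s' \in `[0, s] -> Omega (y s') /\ is_derive s' 1 y (f (y s')).
  rewrite in_itv/= => /andP[s'0 s's]; apply: yP.
  move: ab0 abs; rewrite !in_itv/= => /andP[a0 _] /andP[_ sb].
  by rewrite (lt_le_trans a0)//= (le_lt_trans s's).
have := flow_stability fK K0 s0 Ks I1 I2 (s := s).
rewrite in_itv/= s0 lexx => /(_ isT).
by rewrite phi0 y0 subrr normr0 mulr0 normr_le0 subr_eq0 => /eqP ->.
Qed.

(** * Expansion of the commutator of flows *)

(** The increment of [z] on each interval of length [h = t / N] is [h] times [H]
    at the tag, up to [K] times the distance between [z] and the tagged point, which
    is at most [eta + C * h]. *)
Lemma curve_riemann (R : realType) (n : nat) (Omega : set 'rV[R]_n)
    (H : 'rV[R]_n -> 'rV[R]_n) (K C t eta : R) (N : nat) (z : R -> 'rV[R]_n)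
    (p w : 'rV[R]_n) (tag : nat -> R) :
  lip_on Omega K H -> 0 <= K -> 0 < t -> (0 < N)%N ->
  (forall s, 0 <= s <= t -> Omega (z s) /\ is_derive s 1 z (H (z s))) ->
  (forall s, 0 <= s <= t -> Omega (p + s *: w) /\ `|z s - (p + s *: w)| <= eta) ->
  `|w| <= C ->
  (forall i, i%:R * (t / N%:R) <= tag i <= i.+1%:R * (t / N%:R)) ->
  `|z t - z 0 - \sum_(i < N) (t / N%:R) *: H (p + tag i *: w)| <=
    t * (K * (eta + C * (t / N%:R))).
Proof.
move=> HK K0 t0 N0 zH zp wC tagP; set h := t / N%:R.
have N0' : N%:R != 0 :> R by rewrite pnatr_eq0 -lt0n.
have h0 : 0 < h by rewrite divr_gt0// ltr0n.
have Nh : N%:R * h = t by rewrite /h mulrC divfK.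
have -> : z t - z 0 = \sum_(i < N) (z (i.+1%:R * h) - z (i%:R * h)).
  rewrite -(big_mkord xpredT (fun i => z (i.+1%:R * h) - z (i%:R * h))).
  by rewrite (telescope_sumr (fun i => z (i%:R * h)))// Nh mul0r.
rewrite -sumrB (le_trans (ler_norm_sum _ _ _))//.
have -> : t * (K * (eta + C * h)) = \sum_(i < N) K * (eta + C * h) * h.
  by rewrite sumr_const card_ord -mulr_natl -Nh; ring.
apply: ler_sum => i _.
have E : i.+1%:R * h - i%:R * h = h by rewrite -natr1; ring.
have iN : i.+1%:R * h <= t.
  rewrite -Nh; apply: ler_wpM2r; first exact: ltW.
  by rewrite ler_nat.
have i0 : 0 <= i%:R * h by rewrite mulr_ge0// ltW.
have ii : i%:R * h <= i.+1%:R * h by rewrite -subr_ge0 E ltW.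
have /andP[t1 t2] := tagP i.
have sub s : i%:R * h <= s <= i.+1%:R * h -> 0 <= s <= t.
  by move=> /andP[h1 h2]; rewrite (le_trans i0)//= (le_trans h2).
have := @rV_mvi _ _ z (H \o z) (i%:R * h) (i.+1%:R * h) (K * (eta + C * h))
  (H (p + tag i *: w)) ii.
rewrite E; apply.
  by move=> s; rewrite in_itv/= => /sub st; have [] := zH s st.
move=> s; rewrite in_itv/= => si; have st := sub s si.
have tt : 0 <= tag i <= t by apply: sub; rewrite t1.
have [zO _] := zH s st; have [_ zps] := zp s st; have [pO _] := zp (tag i) tt.
rewrite (le_trans (HK _ _ zO pO))// ler_wpM2l//.
have -> : z s - (p + tag i *: w) = z s - (p + s *: w) + (s - tag i) *: w.
  by rewrite scalerBl; apply/rowP => j; rewrite !mxE; ring.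
rewrite (le_trans (ler_normD _ _))// lerD// normrZ mulrC.
move/andP : si => [s1 s2].
apply: ler_pM => //.
move: s1 s2 t1 t2 E; move: (i%:R * h) (i.+1%:R * h) => x x' s1 s2 t1 t2 E.
by rewrite ler_norml; apply/andP; split; lra.
Qed.

(** Of the form [circulation] with [a = f q] and [b = g q], for vector-valued fields. *)
Definition bracket_sum (R : realType) (n : nat) (f g : 'rV[R]_n -> 'rV[R]_n)
    (t : R) (N : nat) (q : 'rV[R]_n) : 'rV[R]_n :=
  let h := t / N%:R in
  \sum_(j < N) h *: ((g (q + t *: f q + (j%:R * h) *: g q) - g (q + (j%:R * h) *: g q)) -
    (f (q + (j%:R * h) *: f q + t *: g q) - f (q + (j%:R * h) *: f q))).

Lemma curve_linear (R : realType) (n : nat) (Omega : set 'rV[R]_n)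
    (H : 'rV[R]_n -> 'rV[R]_n) (K rho t : R) (z : R -> 'rV[R]_n) (q : 'rV[R]_n) :
  lip_on Omega K H -> 0 <= K -> Omega q ->
  (forall s, 0 <= s <= t -> Omega (z s) /\ is_derive s 1 z (H (z s))) ->
  (forall s, 0 <= s <= t -> `|z s - q| <= rho) ->
  forall s, 0 <= s <= t -> `|z s - z 0 - s *: H q| <= K * rho * t.
Proof.
move=> HK K0 qO zH zq s /andP[s0 st].
have sub r : r \in `[0, s] -> 0 <= r <= t.
  by rewrite in_itv/= => /andP[-> rs]; rewrite (le_trans rs).
have rho0 : 0 <= rho by rewrite (le_trans _ (zq s _))// s0.
have := @rV_mvi _ _ z (H \o z) 0 s (K * rho) (H q) s0.
rewrite subr0 => h; apply: le_trans (h _ _) _.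
- by move=> r /sub rt; have [] := zH r rt.
- move=> r /sub rt; have [zO _] := zH r rt.
  by rewrite (le_trans (HK _ _ zO qO))// ler_wpM2l// zq.
by rewrite ler_wpM2l// mulr_ge0.
Qed.

Lemma local_flow_lip (R : realType) (n : nat) (Omega : set 'rV[R]_n)
    (f : 'rV[R]_n -> 'rV[R]_n) (K C r T : R) (q : 'rV[R]_n) :
  lip_on Omega K f -> 0 <= K -> 0 < r ->
  (forall x, `|x - q| <= r -> Omega x /\ `|f x| <= C) ->
  0 < T -> T < 1 -> K * T <= 1 / 2 -> C * T <= r / 2 ->
  exists phi : 'rV[R]_n -> R -> 'rV[R]_n, forall x, `|x - q| <= r / 2 ->
    [/\ phi x 0 = x,
        forall s, 0 <= s -> s < T -> Omega (phi x s) /\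
          is_derive s 1 (phi x) (f (phi x s)),
        forall s, 0 <= s -> s < T -> flow Omega f s x = phi x s &
        forall y s s', `|y - q| <= r / 2 -> 0 <= s < T -> 0 <= s' < T ->
          `|phi x s - phi y s'| <= 2 * `|x - y| + C * `|s - s'|].
Proof.
move=> fK K0 r0 fC T0 T1 KT CT.
have [phi phiP] := local_flow fK K0 r0 fC T0 T1 KT CT.
exists phi => x xq; have [phi0 dphi phiE] := phiP x xq.
split => // [s s0 sT|y s s' yq /andP[s0 sT] /andP[s'0 s'T]].
  by have [|h1 h2] := dphi s; rewrite ?ger0_norm//; split => //; have [] := fC _ h1.
have [psi0 dpsi _] := phiP y yq.
rewrite -(subrKA (phi y s)) (le_trans (ler_normD _ _))// lerD//.
  have I1 u (v : 'rV[R]_n) : `|v - q| <= r / 2 -> u \in `[0, s] ->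
      Omega (phi v u) /\ is_derive u 1 (phi v) (f (phi v u)).
    move=> vq; rewrite in_itv/= => /andP[u0 us]; have [_ dv _] := phiP v vq.
    have [|h1 h2] := dv u; first by rewrite ger0_norm// (le_lt_trans us).
    by split => //; have [] := fC _ h1.
  have Ks : K * s <= 1 / 2 by rewrite (le_trans _ KT)// ler_wpM2l// ltW.
  have := flow_stability fK K0 s0 Ks (fun u => I1 u x xq) (fun u => I1 u y yq) (s := s).
  by rewrite in_itv/= s0 lexx phi0 psi0 => /(_ isT).
pose S := Num.max s s'.
have ST (u : R) : `|u| <= S -> `|u| < T.
  by move=> uS; apply: (le_lt_trans uS); rewrite gt_max sT.
have d (u : R) : `|u| <= S -> is_derive u 1 (phi y) (f (phi y u)).
  by move=> /ST uT; have [] := dpsi u uT.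
have := @rV_mvi_sym _ _ _ _ S C 0 s' s d.
rewrite scaler0 subr0 (ger0_norm s0) (ger0_norm s'0); apply.
- by rewrite /S le_max lexx orbT.
- by rewrite /S le_max lexx.
by move=> u /ST uT _; rewrite subr0; have [h1 _] := dpsi u uT; have [] := fC _ h1.
Qed.

Lemma lip_onN (R : realType) (V W : normedModType R) (A : set V) (K : R)
  (u : V -> W) : lip_on A K u -> lip_on A K (fun x => - u x).
Proof. by move=> uK x y Ax Ay; rewrite -opprD normrN; exact: uK. Qed.

(** Each of the four arcs deviates from the straight segment of its field frozen at
    [q] by at most [eta = 4 K C t^2] more than the preceding one.  The Riemann sums of
    the fields along these segments ([curve_riemann]), with the two backward arcs read
    in reverse, add up to [bracket_sum]; the constant 40 is [4 (1 + 2 + 3 + 4)]. *)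
Lemma Psi_expansion (R : realType) (n : nat) (Omega : set 'rV[R]_n)
    (f g : 'rV[R]_n -> 'rV[R]_n) (K C r T : R) (q : 'rV[R]_n) :
  lip_on Omega K f -> lip_on Omega K g -> 0 <= K -> 0 < r ->
  (forall x, `|x - q| <= r -> [/\ Omega x, `|f x| <= C & `|g x| <= C]) ->
  0 < T -> T < 1 -> K * T <= 1 / 2 -> 8 * C * T <= r ->
  (forall s t, 0 <= s < T -> 0 <= t < T ->
     `|Psi Omega f g s q - Psi Omega f g t q| <= 15 * C * `|s - t|) /\
  (forall t N, 0 < t -> t < T -> (0 < N)%N ->
     `|Psi Omega f g t q - q - bracket_sum f g t N q| <=
     t * (K * (40 * K * C * t ^+ 2 + 4 * C * (t / N%:R)))).
Proof.
move=> fK gK K0 r0 fgC T0 T1 KT CT.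
have qq : `|q - q| <= r by rewrite subrr normr0 ltW.
have [Oq fqC gqC] := fgC q qq.
have C0 : 0 <= C := le_trans (normr_ge0 _) fqC.
have CT' : C * T <= r / 2 by nra.
have f1 x : `|x - q| <= r -> Omega x /\ `|f x| <= C by move=> /fgC[].
have f2 x : `|x - q| <= r -> Omega x /\ `|g x| <= C by move=> /fgC[].
have f3 x : `|x - q| <= r -> Omega x /\ `|- f x| <= C by rewrite normrN => /fgC[].
have f4 x : `|x - q| <= r -> Omega x /\ `|- g x| <= C by rewrite normrN => /fgC[].
have [p1 P1] := local_flow_lip fK K0 r0 f1 T0 T1 KT CT'.
have [p2 P2] := local_flow_lip gK K0 r0 f2 T0 T1 KT CT'.
have [p3 P3] := local_flow_lip (lip_onN fK) K0 r0 f3 T0 T1 KT CT'.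
have [p4 P4] := local_flow_lip (lip_onN gK) K0 r0 f4 T0 T1 KT CT'.
pose a t := p1 q t.
pose b t s := p2 (a t) s.
pose c t s := p3 (b t t) s.
pose d t s := p4 (c t t) s.
have q0 : `|q - q| <= r / 2 by rewrite subrr normr0 divr_ge0// ltW.
have [a0 da aE aL] := P1 q q0.
have T00 : (0 : R) <= 0 < T by rewrite lexx.
have aq s : 0 <= s < T -> `|a s - q| <= C * s.
  move=> sT; have := aL q s 0 q0 sT T00; rewrite a0 subrr normr0 mulr0 add0r subr0.
  by rewrite (ger0_norm (_ : 0 <= s))//; case/andP : sT.
have CsT s : 0 <= s < T -> C * s <= r / 8.
  by move=> /andP[s0 sT]; have : C * s <= C * T by [rewrite ler_wpM2l// ltW]; lra.
have aq2 s : 0 <= s < T -> `|a s - q| <= r / 2.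
  by move=> sT; have := aq s sT; have := CsT s sT; lra.
have dist_step (p : 'rV[R]_n -> R -> 'rV[R]_n) x s (m : R) :
    (forall y s s', `|y - q| <= r / 2 -> 0 <= s < T -> 0 <= s' < T ->
          `|p x s - p y s'| <= 2 * `|x - y| + C * `|s - s'|) ->
    p x 0 = x -> `|x - q| <= r / 2 -> 0 <= s < T -> `|x - q| <= m ->
    `|p x s - q| <= m + C * s.
  move=> pL px0 xq sT xm; have := pL x s 0 xq sT T00.
  rewrite px0 subrr normr0 mulr0 add0r subr0 (ger0_norm (_ : 0 <= s)); last by case/andP : sT.
  move=> h; rewrite -(subrKA x) (le_trans (ler_normD _ _))// addrC lerD//.
have bP t s : 0 <= t < T -> 0 <= s < T -> `|b t s - q| <= C * t + C * s.
  move=> tT sT; have [b0 _ _ bL] := P2 _ (aq2 t tT).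
  exact: dist_step bL b0 (aq2 t tT) sT (aq t tT).
have bq2 t : 0 <= t < T -> `|b t t - q| <= r / 2.
  by move=> tT; have := bP t t tT tT; have := CsT t tT; lra.
have cP t s : 0 <= t < T -> 0 <= s < T -> `|c t s - q| <= C * t + C * t + C * s.
  move=> tT sT; have [c0 _ _ cL] := P3 _ (bq2 t tT).
  exact: dist_step cL c0 (bq2 t tT) sT (bP t t tT tT).
have cq2 t : 0 <= t < T -> `|c t t - q| <= r / 2.
  by move=> tT; have := cP t t tT tT; have := CsT t tT; lra.
have dP t s : 0 <= t < T -> 0 <= s < T -> `|d t s - q| <= C * t + C * t + C * t + C * s.
  move=> tT sT; have [d0 _ _ dL] := P4 _ (cq2 t tT).
  exact: dist_step dL d0 (cq2 t tT) sT (cP t t tT tT).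
have PsiE t : 0 <= t < T -> Psi Omega f g t q = d t t.
  move=> tT; have [t0 tT'] := andP tT.
  have [_ _ bE _] := P2 _ (aq2 t tT).
  have [_ _ cE _] := P3 _ (bq2 t tT).
  have [_ _ dE _] := P4 _ (cq2 t tT).
  by rewrite /Psi /= aE// -/(a t) bE// -/(b t t) cE// -/(c t t) dE.
split.
  move=> s t sT tT; rewrite !PsiE//.
  have [_ _ _ bL] := P2 _ (aq2 s sT).
  have [_ _ _ cL] := P3 _ (bq2 s sT).
  have [_ _ _ dL] := P4 _ (cq2 s sT).
  have h1 := aL q s t q0 sT tT.
  have h2 := bL _ s t (aq2 t tT) sT tT.
  have h3 := cL _ s t (bq2 t tT) sT tT.
  have h4 := dL _ s t (cq2 t tT) sT tT.
  move: h1 h2 h3 h4; rewrite subrr normr0 -/(a s) -/(a t) -/(b s s) -/(b t t).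
  rewrite -/(c s s) -/(c t t) -/(d s s) -/(d t t); lra.
move=> t N t0 tT N0.
have tT2 : 0 <= t < T by rewrite ltW.
rewrite PsiE//.
have sT s : 0 <= s <= t -> 0 <= s < T by move=> /andP[-> st]; exact: le_lt_trans st tT.
have st s : 0 <= s <= t -> C * s <= C * t by move=> /andP[_ st]; rewrite ler_wpM2l.
have [b0 db _ _] := P2 _ (aq2 t tT2).
have [c0 dc _ _] := P3 _ (bq2 t tT2).
have [d0 dd _ _] := P4 _ (cq2 t tT2).
have cvA s : 0 <= s <= t -> Omega (a s) /\ is_derive s 1 a (f (a s)).
  by move=> /sT/andP[s0 s1]; exact: da.
have cvB s : 0 <= s <= t -> Omega (b t s) /\ is_derive s 1 (b t) (g (b t s)).
  by move=> /sT/andP[s0 s1]; exact: db.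
have cvC s : 0 <= s <= t -> Omega (c t s) /\ is_derive s 1 (c t) (- f (c t s)).
  by move=> /sT/andP[s0 s1]; exact: dc.
have cvD s : 0 <= s <= t -> Omega (d t s) /\ is_derive s 1 (d t) (- g (d t s)).
  by move=> /sT/andP[s0 s1]; exact: dd.
have Ct0 : 0 <= C * t by rewrite mulr_ge0// ltW.
(* All points of the arcs are at distance at most [4 * C * t] from [q]. *)
pose eta := K * (4 * C * t) * t.
have lA s : 0 <= s <= t -> `|a s - a 0 - s *: f q| <= eta.
  apply: (curve_linear fK K0 Oq cvA) => u ut.
  by have := aq u (sT u ut); have := st u ut; lra.
have lB s : 0 <= s <= t -> `|b t s - b t 0 - s *: g q| <= eta.
  apply: (curve_linear gK K0 Oq cvB) => u ut.
  by have := bP t u tT2 (sT u ut); have := st u ut; lra.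
have lC s : 0 <= s <= t -> `|c t s - c t 0 - s *: - f q| <= eta.
  apply: (curve_linear (lip_onN fK) K0 Oq cvC) => u ut.
  by have := cP t u tT2 (sT u ut); have := st u ut; lra.
have lD s : 0 <= s <= t -> `|d t s - d t 0 - s *: - g q| <= eta.
  apply: (curve_linear (lip_onN gK) K0 Oq cvD) => u ut.
  by have := dP t u tT2 (sT u ut); have := st u ut; lra.
have a00 : a 0 = q := a0.
have b00 : b t 0 = a t := b0.
have c00 : c t 0 = b t t := c0.
have d00 : d t 0 = c t t := d0.
have nf : `|- f q| <= C by rewrite normrN.
have ng : `|- g q| <= C by rewrite normrN.
have Ctr : C * t + C * t <= r by have := CsT t tT2; lra.
have inO (u v : R) : `|u| <= t -> `|v| <= t -> Omega (q + u *: f q + v *: g q).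
  move=> ut vt; suff /fgC[] : `|q + u *: f q + v *: g q - q| <= r by [].
  have -> : q + u *: f q + v *: g q - q = u *: f q + v *: g q.
    by apply/rowP => i; rewrite !mxE; ring.
  rewrite (le_trans (ler_normD _ _))// (le_trans _ Ctr)// !normrZ [C * t]mulrC.
  by rewrite lerD// ler_pM.
have nt : `|t| <= t by rewrite ger0_norm// ltW.
have ns s : 0 <= s <= t -> `|s| <= t by move=> /andP[s0 ?]; rewrite ger0_norm.
have nts s : 0 <= s <= t -> `|t - s| <= t.
  by move=> /andP[s0 s1]; rewrite ler_norml; apply/andP; split; lra.
have n0 : `|0 : R| <= t by rewrite normr0 ltW.
have zA s : 0 <= s <= t -> Omega (q + s *: f q) /\ `|a s - (q + s *: f q)| <= eta.
  move=> ss; split; first by have := inO s 0 (ns s ss) n0; rewrite scale0r addr0.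
  by have := lA s ss; rewrite a00 -addrA -opprD.
have t_t : 0 <= t <= t by rewrite lexx ltW.
have zB s : 0 <= s <= t -> Omega (q + t *: f q + s *: g q) /\
    `|b t s - (q + t *: f q + s *: g q)| <= 2 * eta.
  move=> ss; split; first exact: inO nt (ns s ss).
  have -> : b t s - (q + t *: f q + s *: g q) = (b t s - b t 0 - s *: g q) +
      (a t - (q + t *: f q)).
    by rewrite b00; apply/rowP => i; rewrite !mxE; ring.
  rewrite mulr2n mulrDl mul1r (le_trans (ler_normD _ _))// lerD//.
    exact: lB.
  by have [] := zA t t_t.
have zC s : 0 <= s <= t -> Omega (q + t *: f q + t *: g q + s *: - f q) /\
    `|c t s - (q + t *: f q + t *: g q + s *: - f q)| <= 3 * eta.
  move=> ss; split.
    have -> : q + t *: f q + t *: g q + s *: - f q = q + (t - s) *: f q + t *: g q.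
      by apply/rowP => i; rewrite !mxE; ring.
    exact: inO (nts s ss) nt.
  have -> : c t s - (q + t *: f q + t *: g q + s *: - f q) =
      (c t s - c t 0 - s *: - f q) + (b t t - (q + t *: f q + t *: g q)).
    by rewrite c00; apply/rowP => i; rewrite !mxE; ring.
  rewrite (_ : 3 * eta = eta + 2 * eta); last by ring.
  rewrite (le_trans (ler_normD _ _))// lerD//; first exact: lC.
  by have [] := zB t t_t.
have zD s : 0 <= s <= t -> Omega (q + t *: g q + s *: - g q) /\
    `|d t s - (q + t *: g q + s *: - g q)| <= 4 * eta.
  move=> ss; split.
    have -> : q + t *: g q + s *: - g q = q + 0 *: f q + (t - s) *: g q.
      by apply/rowP => i; rewrite !mxE; ring.
    exact: inO n0 (nts s ss).
  have -> : d t s - (q + t *: g q + s *: - g q) =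
      (d t s - d t 0 - s *: - g q) + (c t t - (q + t *: f q + t *: g q + t *: - f q)).
    by rewrite d00; apply/rowP => i; rewrite !mxE; ring.
  rewrite (_ : 4 * eta = eta + 3 * eta); last by ring.
  rewrite (le_trans (ler_normD _ _))// lerD//; first exact: lD.
  by have [] := zC t t_t.
set h := t / N%:R.
have h0 : 0 < h by rewrite divr_gt0// ltr0n.
have Nh : N%:R * h = t by rewrite /h mulrC divfK// pnatr_eq0 -lt0n.
have tagl i : i%:R * h <= i%:R * h <= i.+1%:R * h.
  by rewrite lexx/= ler_wpM2r ?ler_nat// ltW.
have tagr i : i%:R * h <= i.+1%:R * h <= i.+1%:R * h.
  by rewrite lexx andbT ler_wpM2r ?ler_nat// ltW.
have RA := curve_riemann fK K0 t0 N0 cvA zA fqC tagl.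
have RB := curve_riemann gK K0 t0 N0 cvB zB gqC tagl.
have RC := curve_riemann (lip_onN fK) K0 t0 N0 cvC zC nf tagr.
have RD := curve_riemann (lip_onN gK) K0 t0 N0 cvD zD ng tagr.
have revh (j : 'I_N) : (rev_ord j).+1%:R * h = t - j%:R * h.
  by rewrite /= subnSK// natrB ?(ltnW (ltn_ord j))// mulrBl Nh.
rewrite -/h in RA RB RC RD.
rewrite (reindex_inj rev_ord_inj) /= in RC.
rewrite (reindex_inj rev_ord_inj) /= in RD.
have -> : d t t - q - bracket_sum f g t N q =
    (a t - a 0 - \sum_(i < N) h *: f (q + (i%:R * h) *: f q)) +
    (b t t - b t 0 - \sum_(i < N) h *: g (q + t *: f q + (i%:R * h) *: g q)) +
    (c t t - c t 0 - \sum_(j < N) h *: - f (q + t *: f q + t *: g q +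
       ((N - j.+1).+1%:R * h) *: - f q)) +
    (d t t - d t 0 - \sum_(j < N) h *: - g (q + t *: g q +
       ((N - j.+1).+1%:R * h) *: - g q)).
  rewrite a00 b00 c00 d00.
  have -> : bracket_sum f g t N q =
    \sum_(i < N) h *: f (q + (i%:R * h) *: f q) +
    \sum_(i < N) h *: g (q + t *: f q + (i%:R * h) *: g q) +
    \sum_(j < N) h *: - f (q + t *: f q + t *: g q + ((N - j.+1).+1%:R * h) *: - f q) +
    \sum_(j < N) h *: - g (q + t *: g q + ((N - j.+1).+1%:R * h) *: - g q).
    rewrite -!big_split/=; apply: eq_bigr => j _.
    have -> : (N - j.+1).+1%:R * h = t - j%:R * h := revh j.
    have -> : q + t *: f q + t *: g q + (t - j%:R * h) *: - f q =
        q + (j%:R * h) *: f q + t *: g q.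
      by apply/rowP => i; rewrite !mxE; ring.
    have -> : q + t *: g q + (t - j%:R * h) *: - g q = q + (j%:R * h) *: g q.
      by apply/rowP => i; rewrite !mxE; ring.
    by rewrite -/h -!scalerDr; congr (_ *: _); apply/rowP => i; rewrite !mxE; ring.
  move: (\sum_(i < N) _) (\sum_(i < N) _) (\sum_(i < N) _) (\sum_(i < N) _) => *.
  by apply/rowP => i; rewrite !mxE; ring.
move: RA RB RC RD.
set A := a t - _ - _; set B := b t t - _ - _; set Cc := c t t - _ - _.
set D := d t t - _ - _ => RA RB RC RD.
have -> : t * (K * (40 * K * C * t ^+ 2 + 4 * C * h)) =
    t * (K * (eta + C * h)) + t * (K * (2 * eta + C * h)) +
    t * (K * (3 * eta + C * h)) + t * (K * (4 * eta + C * h)).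
  by rewrite /eta; ring.
rewrite (le_trans (ler_normD _ _))// lerD//.
rewrite (le_trans (ler_normD _ _))// lerD//.
by rewrite (le_trans (ler_normD _ _))// lerD.
Qed.

(** * Differentials of Lipschitz maps and convex sets *)

Lemma differentiable_near (R : realType) (V W : normedModType R)
    (f g : V -> W) x :
  (\forall y \near x, f y = g y) -> differentiable f x -> differentiable g x.
Proof.
move=> fg df; have := diff_locally df => /eqaddoP E.
apply: (@differentiable_expansion _ _ _ _ ('d f x)).
  exact: diff_continuous.
move=> e e0; have := E e e0.
have fg0 : \forall y \near 0, f (y + x) = g (y + x).
  move/nbhs_ballP : fg => [d /= d0 H]; apply/nbhs_ballP; exists d => //= y.
  rewrite -ball_normE/= sub0r normrN => yd; apply: H.
  by rewrite -ball_normE/= opprD addrCA subrr addr0 normrN.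
apply: filterS2 fg0 => y fgy; rewrite /= !fctE /= opprD addrA fgy.
by rewrite (nbhs_singleton fg).
Qed.

Lemma diff_bound (R : realType) (V W : normedModType R) (A : set V)
    (f : V -> W) (K : R) x v : 0 <= K ->
  lip_on A K f -> interior A x -> differentiable f x ->
  `|'d f x v| <= K * `|v|.
Proof.
move=> K0 fK Ax df; rewrite -deriveE//.
have dv : derivable f x v by exact: diff_derivable.
apply/ler_addgt0Pr => e e0.
have /cvgrPdist_lt/(_ _ e0) close : h^-1 *: (f (h *: v + x) - f x) @[h --> 0^'] --> 'D_v f x.
  exact: dv.
have quot : \forall h \near (0 : R)^', `|h^-1 *: (f (h *: v + x) - f x)| <= K * `|v|.
  move/nbhs_ballP : (Ax) => [d /= d0 H].
  have dv0 : 0 < d / (`|v| + 1) by rewrite divr_gt0// ltr_wpDl.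
  exists (d / (`|v| + 1)) => //= h /=; rewrite sub0r normrN => hd h0.
  have hvd : `|h| * `|v| < d.
    move: hd; rewrite ltr_pdivlMr ?ltr_wpDl// mulrDr mulr1 => /le_lt_trans; apply.
    by rewrite lerDl.
  have h0' : 0 < `|h| by rewrite normr_gt0.
  rewrite normrZ normfV mulrC ler_pdivrMr//.
  rewrite (le_trans (fK _ _ _ _))//.
  - by apply: H; rewrite -ball_normE/= opprD addrCA subrr addr0 normrN normrZ.
  - by apply: H; exact: ballxx.
  - by rewrite addrK normrZ mulrAC mulrA.
have [h [/= H1 H2]] := @filter_ex _ _ _ _ (filterI close quot).
rewrite -[X in `|X|](subrK (h^-1 *: (f (h *: v + x) - f x))).
by rewrite addrC (le_trans (ler_normD _ _))// lerD// ltW.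
Qed.

Lemma convex_setE (R : realType) (V : normedModType R) (A : set V) :
  convex_set A <-> forall x y (s : R), 0 <= s <= 1 -> A x -> A y ->
    A (s *: x + (1 - s) *: y).
Proof.
split=> [cA x y s s01 Ax Ay|H x y s].
  exact: set_mem (cA x y (Itv01 (andP s01).1 (andP s01).2) (mem_set Ax) (mem_set Ay)).
move=> /set_mem Ax /set_mem Ay; apply: mem_set; apply: (H x y s%:num) => //.
by rewrite ge0/= le1.
Qed.

Lemma closure_normP (R : realType) (V : normedModType R) (A : set V) x :
  closure A x <-> forall e : R, 0 < e -> exists2 y, A y & `|x - y| < e.
Proof.
split=> [clA e e0|H B /nbhs_ballP[e /= e0 eB]].
  have [y [Ay]] := clA _ (nbhsx_ballx x e e0).
  by rewrite -ball_normE => xy; exists y.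
have [y Ay xy] := H e e0; exists y; split => //; apply: eB.
by rewrite -ball_normE.
Qed.

Lemma convex_closure (R : realType) (V : normedModType R) (A : set V) :
  convex_set A -> convex_set (closure A : set V).
Proof.
move=> /convex_setE cA; apply/convex_setE => x y s /andP[s0 s1].
move=> /closure_normP clx /closure_normP cly; apply/closure_normP => e e0.
have [x' Ax xx] := clx e e0; have [y' Ay yy] := cly e e0.
exists (s *: x' + (1 - s) *: y'); first by apply: cA => //; rewrite s0.
rewrite opprD addrACA -!scalerBr (le_lt_trans (ler_normD _ _))//.
rewrite !normrZ !ger0_norm ?subr_ge0//.
have := normr_ge0 (x - x'); have := normr_ge0 (y - y').
have [->|s0'] := eqVneq s 0; first by rewrite mul0r add0r subr0 mul1r.
have : 0 < s by rewrite lt0r s0' s0.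
nra.
Qed.

Lemma convex_hull_convex (R : realType) n (A : set 'rV[R]_n) :
  convex_set (convex_hull A).
Proof.
apply/convex_setE => x y s s01 Ax Ay B BP; have [cB AB] := BP.
by move/convex_setE : cB; apply => //; [exact: (Ax _ BP)|exact: (Ay _ BP)].
Qed.

Lemma convex_closed_ball (R : realType) (V : normedModType R) (c : R) :
  convex_set [set z : V | `|z| <= c].
Proof.
apply/convex_setE => x y s /andP[s0 s1] /= xc yc.
rewrite (le_trans (ler_normD _ _))// !normrZ !ger0_norm ?subr_ge0//.
have : s * `|x| <= s * c by rewrite ler_wpM2l.
have : (1 - s) * `|y| <= (1 - s) * c by rewrite ler_wpM2l// subr_ge0.
lra.
Qed.

Lemma closed_ball_closed (R : realType) n (c : R) :
  closed [set z : 'rV[R]_n | `|z| <= c].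
Proof.
have /continuous_closedP := @norm_continuous R 'rV[R]_n.
by move=> /(_ [set x | x <= c]); apply; exact: closed_le.
Qed.

Lemma bounded_norm_le (R : realType) n (A : set 'rV[R]_n) (c : R) :
  A `<=` [set z | `|z| <= c] -> bounded_set A.
Proof.
move=> Ac; exists c; split => [|M cM z /Ac/= zc]; first exact: num_real.
by rewrite (le_trans zc)// ltW.
Qed.

(** The variational inequality of the Euclidean projection of [a] on [A]: the
    sup norm would provide a nearest point, but no functional. *)
Lemma convex_projection (R : realType) n (A : set 'rV[R]_n) (a : 'rV[R]_n) :
  A !=set0 -> compact A -> convex_set A ->
  exists2 y, A y & forall z, A z -> \sum_i (z - y) 0 i * (a - y) 0 i <= 0.
Proof.
move=> A0 cA /convex_setE vA.
pose phi (z : 'rV[R]_n) := \sum_i (a 0 i - z 0 i) ^+ 2.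
have cphi : continuous phi.
  apply: continuous_big; first exact: add_continuous.
  move=> i _ z.
  have c1 : continuous (fun z : 'rV[R]_n => a 0 i - z 0 i).
    apply: (@lip_with_continuous _ _ _ 1) => x y.
    rewrite mul1r (_ : _ - _ = - (x 0 i - y 0 i)) ?normrN; last by ring.
    by have := rV_coord_le (x - y) i; rewrite !mxE.
  exact: cvgM (c1 z) (c1 z).
have [y /set_mem Ay ymin] := EVT_min_rV A0 cA (continuous_subspaceT cphi).
exists y => // z Az; set D := \sum_i _.
pose E := \sum_i ((z - y) 0 i) ^+ 2.
have E0 : 0 <= E by apply: sumr_ge0 => i _; exact: sqr_ge0.
rewrite leNgt; apply/negP => D0.
have DE : 0 < D + E by rewrite ltr_pwDl.
(* A step from [y] towards [z] of length [s] changes [phi] by [s * (s * E - 2 * D)],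
   which is negative for this [s]. *)
pose s := D / (D + E).
have s0 : 0 < s by rewrite divr_gt0.
have s1 : s <= 1 by rewrite ler_pdivrMr// mul1r lerDl.
have := ymin (s *: z + (1 - s) *: y)
  (mem_set (vA z y s (introT andP (conj (ltW s0) s1)) Az Ay)).
have -> : phi (s *: z + (1 - s) *: y) = phi y - 2 * s * D + s ^+ 2 * E.
  rewrite /phi /D /E !mulr_sumr -sumrB -big_split/=; apply: eq_bigr => i _.
  rewrite !mxE; ring.
move=> le_phi; have : 0 <= s * (s * E - 2 * D).
  by rewrite -(lerD2l (phi y)) addr0 (le_trans le_phi)// le_eqVlt; apply/orP; left; apply/eqP; ring.
rewrite pmulr_rge0// subr_ge0.
have : s * (D + E) = D by rewrite /s divfK// gt_eqF.
nra.
Qed.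

(** * Limit values and their closed convex hull *)

(** For [B] the Lie bracket and [D] the common differentiability points, the set of
    which [lie_bracket_set] is the closed convex hull. *)
Definition limit_set (R : realType) (n m : nat) (D : set 'rV[R]_n)
    (B : 'rV[R]_n -> 'rV[R]_m) (q : 'rV[R]_n) : set 'rV[R]_m :=
  [set v | exists q_ : nat -> 'rV[R]_n,
     [/\ forall k, D (q_ k), q_ k @[k --> \oo] --> q &
         B (q_ k) @[k --> \oo] --> v]].

Lemma seq_cvg (R : realType) (V : normedModType R) (x_ : nat -> V) x :
  (forall k, `|x_ k - x| < k.+1%:R^-1) -> x_ k @[k --> \oo] --> x.
Proof.
move=> H; apply/cvgrPdist_lt => e e0.
have := @near_infty_natSinv_lt R (PosNum e0); apply: filterS => k /= ke.
by rewrite distrC (lt_trans (H k)).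
Qed.

(** The values are in a compact ball, hence have a cluster point, and a subsequence
    converges to it. *)
Lemma limit_set_cluster (R : realType) (n m : nat) (D : set 'rV[R]_n)
    (B : 'rV[R]_n -> 'rV[R]_m) (q : 'rV[R]_n) (c : R) (x_ : nat -> 'rV[R]_n) :
  (forall k, `|x_ k - q| < k.+1%:R^-1) -> (forall k, D (x_ k)) ->
  (forall k, `|B (x_ k)| <= c) ->
  exists2 v, limit_set D B q v & forall e : R, 0 < e ->
    exists k, `|B (x_ k) - v| < e.
Proof.
move=> xq xD xc.
have cc : compact [set z : 'rV[R]_m | `|z| <= c].
  by apply: bounded_closed_compact; [exact: (@bounded_norm_le _ _ _ c)|exact: closed_ball_closed].
have FF : ProperFilter (B (x_ k) @[k --> \oo]) by exact: fmap_proper_filter.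
have xin : (B (x_ k) @[k --> \oo]) [set z | `|z| <= c] by exists 0%N => //= k _; exact: xc.
have [v [_ vcl]] := cc _ FF xin.
have pick (k : nat) : exists j, (k <= j)%N /\ `|B (x_ j) - v| < k.+1%:R^-1.
  have k0 : 0 < k.+1%:R^-1 :> R by rewrite invr_gt0.
  have := vcl (B @` (x_ @` [set j | (k <= j)%N])) _ _ (nbhsx_ballx v _ k0).
  case=> [|_ [[_ [j /= kj <-] <-]]].
    by exists k => // j /= kj; exists (x_ j) => //; exists j.
  by rewrite -ball_normE/= distrC; exists j.
have [s sP] := choice pick.
exists v; last first.
  move=> e e0; have [k _ H] := @near_infty_natSinv_lt R (PosNum e0).
  have /= ke := H k (leqnn k).
  by exists (s k); rewrite (lt_trans (sP k).2).
exists (x_ \o s); split => [k||]; first exact: xD.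
  apply: seq_cvg => k; rewrite (lt_le_trans (xq _))// lef_pV2 ?posrE//.
  by rewrite ler_nat ltnS (sP k).1.
by apply: seq_cvg => k; exact: (sP k).2.
Qed.

(** Otherwise there are points tending to [q] at which the values of [B] keep the
    distance [e] from all limit values, against [limit_set_cluster]. *)
Lemma limit_set_near (R : realType) (n m : nat) (D : set 'rV[R]_n)
    (B : 'rV[R]_n -> 'rV[R]_m) (q : 'rV[R]_n) (c r e : R) :
  0 < r -> (forall x, D x -> `|x - q| < r -> `|B x| <= c) -> 0 < e ->
  exists2 rho, 0 < rho & forall x, D x -> `|x - q| < rho ->
    exists2 z, limit_set D B q z & `|B x - z| < e.
Proof.
move=> r0 Bc e0; apply: contrapT => /forall2NP H.
have far (k : nat) : exists x, [/\ D x, `|x - q| < Num.min r k.+1%:R^-1 &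
    forall z, limit_set D B q z -> e <= `|B x - z|].
  have mk : 0 < Num.min r k.+1%:R^-1 by rewrite lt_min r0 invr_gt0 ltr0n.
  apply: contrapT => /forallNP far.
  case: (H (Num.min r k.+1%:R^-1)); apply => // x Dx xq; apply: contrapT => /forall2NP zfar.
  apply: (far x); split => // z Sz; rewrite leNgt; apply/negP => ze.
  by case: (zfar z).
have [x_ xP] := choice far.
have [|k|k|v Sv /(_ _ e0)[k]] := @limit_set_cluster _ _ _ D B q c x_.
- by move=> k; have [_ + _] := xP k; rewrite lt_min => /andP[].
- by have [] := xP k.
- by have [Dk + _] := xP k; rewrite lt_min => /andP[xr _]; exact: Bc.
- by have [_ _ /(_ _ Sv)] := xP k; rewrite leNgt => /negP.
Qed.

Lemma limit_set_bounded (R : realType) (n m : nat) (D : set 'rV[R]_n)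
    (B : 'rV[R]_n -> 'rV[R]_m) (q : 'rV[R]_n) (c r : R) :
  0 < r -> (forall x, D x -> `|x - q| < r -> `|B x| <= c) ->
  limit_set D B q `<=` [set z | `|z| <= c].
Proof.
move=> r0 Bc v [x_ [xD /cvgrPdist_lt/(_ _ r0) xq xv]] /=.
apply/ler_addgt0Pr => e e0; move/cvgrPdist_lt : xv => /(_ _ e0) xv.
have [k [/= H1 H2]] := @filter_ex _ _ _ _ (filterI xq xv).
rewrite -[v](subrK (B (x_ k))) addrC (le_trans (ler_normD _ _))// lerD ?(ltW H2)//.
by apply: Bc => //; rewrite distrC.
Qed.

Section closed_hull.
Context (R : realType) (n m : nat) (D : set 'rV[R]_n)
  (B : 'rV[R]_n -> 'rV[R]_m) (q : 'rV[R]_n) (c r : R).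
Hypotheses (r0 : 0 < r) (Bc : forall x, D x -> `|x - q| < r -> `|B x| <= c).

Lemma closed_hull_bounded :
  closure (convex_hull (limit_set D B q)) `<=` [set z | `|z| <= c].
Proof.
apply: (subset_trans (closure_subset _)); last first.
  by move=> z; rewrite -(closure_id _).1; [exact|exact: closed_ball_closed].
apply: smallest_sub; first exact: convex_closed_ball.
exact: limit_set_bounded r0 Bc.
Qed.

Lemma closed_hull_compact : compact (closure (convex_hull (limit_set D B q))).
Proof.
apply: bounded_closed_compact; last exact: closed_closure.
exact: bounded_norm_le closed_hull_bounded.
Qed.

Lemma sub_closed_hull :
  limit_set D B q `<=` closure (convex_hull (limit_set D B q)).
Proof. by move=> z Sz; apply: subset_closure; exact: sub_gen_smallest. Qed.

End closed_hull.

(** * The quotient approaches the set-valued bracket *)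

Lemma lip_on_clamp (R : realType) n (W : normedModType R) (A : set 'rV[R]_n)
    (f : 'rV[R]_n -> W) (K r : R) (q : 'rV[R]_n) : 0 <= K -> 0 <= r ->
  (forall x, `|x - q| <= r -> A x) -> lip_on A K f ->
  lip_with K (f \o clamp_rV q r).
Proof.
move=> K0 r0 qA fK x y /=.
rewrite (le_trans (fK _ _ _ _)) ?ler_wpM2l//; try exact/qA/clamp_rV_in.
by have := clamp_rV_lip q r0 x y; rewrite mul1r.
Qed.

Lemma clamp_near (R : realType) n (W : Type) (f : 'rV[R]_n -> W) (r : R)
    (q x : 'rV[R]_n) : `|x - q| < r ->
  \forall y \near x, (f \o clamp_rV q r) y = f y.
Proof.
move=> xr; apply/nbhs_ballP; exists (r - `|x - q|) => /=; first by rewrite subr_gt0.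
move=> y; rewrite -ball_normE/= ltrBrDr => xy.
have yq : `|y - q| < r.
  rewrite -(subrK x y) -addrA (le_lt_trans (ler_normD _ _))//.
  by rewrite (distrC y x).
by rewrite /= clamp_rV_id ?ltW// (le_lt_trans _ xr).
Qed.

Lemma linear_split (R : realType) (V W : normedModType R)
    (P Q : {linear V -> W}) a b c d :
  P a - Q b = P c - Q d + (P (a - c) - Q (b - d)).
Proof.
by rewrite (linearB P) (linearB Q) opprB addrACA [P c + _]addrC subrK addKr.
Qed.

Lemma lin_coords_rectangle (R : realType) n (c : 'I_n -> R) (h : R) a b a' b' :
  lin_coords c (h *: (a - b - (a' - b'))) =
  h * (lin_coords c a - lin_coords c b - (lin_coords c a' - lin_coords c b')).
Proof. by rewrite linearZ/= !(raddfB (lin_coords c)). Qed.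

Section estimate.
Context (R : realType) (n : nat) (Omega : set 'rV[R]_n).
Variables (f g : 'rV[R]_n -> 'rV[R]_n) (K C r : R) (q : 'rV[R]_n).
Hypotheses (fK : lip_on Omega K f) (gK : lip_on Omega K g).
Hypotheses (K0 : 0 <= K) (r0 : 0 < r).
Hypothesis fgC :
  forall x, `|x - q| <= r -> [/\ Omega x, `|f x| <= C & `|g x| <= C].

Let D := Diff Omega f `&` Diff Omega g.

Let C0 : 0 <= C.
Proof.
have [|_ + _] := fgC (x := q); first by rewrite subrr normr0 ltW.
by apply: le_trans.
Qed.

Lemma lie_bracket_bound x : D x -> `|x - q| < r ->
  `|lie_bracket f g x| <= 2 * K * C.
Proof.
move=> [[xO df] [_ dg]] /ltW /fgC[_ fC gC].
rewrite /lie_bracket (le_trans (ler_normB _ _))//.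
rewrite (_ : 2 * K * C = K * C + K * C); last by ring.
apply: lerD; [rewrite (le_trans (diff_bound _ K0 gK xO dg))|
  rewrite (le_trans (diff_bound _ K0 fK xO df))]; by rewrite ?ler_wpM2l.
Qed.

Variable mu : {sigma_finite_measure set (borel_rV R n) -> \bar R}.
Hypothesis mu_fin : forall r, (mu (ball (0%R : 'rV[R]_n) r) < +oo)%E.
Hypothesis mu_pos : forall r, 0 < r -> (0 < mu (ball (0%R : 'rV[R]_n) r))%E.
Hypothesis mu_tr : forall (v : 'rV[R]_n) (A : set 'rV[R]_n),
  measurable (A : set (borel_rV R n)) ->
  mu ((fun x : 'rV[R]_n => x + v) @^-1` A) = mu A.

(** Rademacher's theorem for the truncated fields, which coincide with [f] and [g]
    near every point of the open ball. *)
Lemma ae_Diff : {ae mu, forall x : 'rV[R]_n, `|x - q| < r -> D x}.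
Proof.
have FF := ae_filter_ringOfSetsType mu.
have qO x : `|x - q| <= r -> Omega x by move=> /fgC[].
have df := rademacher mu_fin mu_tr (lip_on_clamp K0 (ltW r0) qO fK).
have dg := rademacher mu_fin mu_tr (lip_on_clamp K0 (ltW r0) qO gK).
move: df dg; apply: filterS2 => x df dg xr.
have xO : interior Omega x.
  apply/nbhs_ballP; exists (r - `|x - q|) => /=; first by rewrite subr_gt0.
  move=> y; rewrite -ball_normE/= ltrBrDr => xy; apply: qO.
  rewrite -(subrK x y) -addrA (le_trans (ler_normD _ _))//.
  by rewrite (distrC y x) ltW.
by split; split => //; [apply: differentiable_near df|apply: differentiable_near dg];
  exact: clamp_near.
Qed.

Lemma Diff_near_nonempty rho : 0 < rho -> exists2 x, D x & `|x - q| < rho.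
Proof.
move=> rho0; apply: contrapT => /forall2NP noD.
pose s := Num.min r rho.
have s0 : 0 < s by rewrite lt_min r0.
have mB0 : measurable (ball (0 : 'rV[R]_n) s : set (borel_rV R n)).
  by apply: open_borel_rV; exact: ball_open.
have [N [mN N0 sN]] := ae_Diff.
have := mu_pos s0; rewrite -(mu_tr (- q) mB0) => /lt_geF/negP; apply => //.
rewrite -N0; apply: le_measure; [|exact: mem_set|].
  by apply: mem_set; have := measurable_translate (- q) measurableT mB0; rewrite setTI.
move=> x; rewrite /preimage/= -ball_normE/= sub0r normrN => xs.
apply: sN => /= xD; move: xs; rewrite lt_min => /andP[/xD Dx xr].
by case: (noD x).
Qed.

(** At almost every [x] the functional takes at ['d g x (f q) - 'd f x (g q)] a value
    that is at most [M] plus the error of replacing [f x] and [g x] by [f q] and [g q],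
    a vector of norm at most [2 K^2 rho].  By [averaging] this bounds [circulation],
    that is the image of [bracket_sum] under the functional, and [Psi_expansion]
    compares the latter with [Psi]; its mesh error disappears as [N] tends to
    infinity. *)
Lemma lin_coords_Psi (c : 'I_n -> R) (M rho T t : R) : 0 < rho -> rho <= r ->
  (forall x, D x -> `|x - q| < rho -> lin_coords c (lie_bracket f g x) <= M) ->
  0 < T -> T < 1 -> K * T <= 1 / 2 -> 8 * C * T <= r ->
  0 < t -> t < T -> t * (2 * C) < rho ->
  lin_coords c (Psi Omega f g t q - q) <=
  t ^+ 2 * (M + (\sum_i `|c i|) * (2 * K ^+ 2 * rho + 40 * K ^+ 2 * C * t)).
Proof.
move=> rho0 rhor DM T0 T1 KT CT t0 tT trho.
set Nc := \sum_i `|c i|.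
have Nc0 : 0 <= Nc by apply: sumr_ge0.
have FF := ae_filter_ringOfSetsType mu.
have qO x : `|x - q| <= r -> Omega x by move=> /fgC[].
have qq : `|q - q| <= r by rewrite subrr normr0 ltW.
have [_ fqC gqC] := fgC qq.
have lc (h : 'rV[R]_n -> 'rV[R]_n) : lip_on Omega K h ->
    lip_with (Nc * K) (lin_coords c \o (h \o clamp_rV q r)).
  move=> hK x y /=; rewrite (le_trans (lip_with_lin_coords _ _ _))// -mulrA.
  by rewrite ler_wpM2l//; exact: (lip_on_clamp K0 (ltW r0) qO hK).
have Dl (h : 'rV[R]_n -> 'rV[R]_n) x v : `|x - q| < r -> differentiable h x ->
    'D_v (lin_coords c \o (h \o clamp_rV q r)) x = lin_coords c ('d h x v).
  move=> xr dh.
  have E : \forall y \near x,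
      (lin_coords c \o (h \o clamp_rV q r)) y = (lin_coords c \o h) y.
    by have := clamp_near h xr; apply: filterS => y /= ->.
  rewrite (near_eq_derive _ E).
  have cl : continuous (lin_coords c).
    by apply: lip_with_continuous; exact: lip_with_lin_coords.
  have dl : differentiable (lin_coords c) (h x) by exact: linear_differentiable.
  rewrite deriveE; last exact: differentiable_comp.
  by rewrite diff_comp//= diff_lin.
pose M' := M + Nc * (2 * K ^+ 2 * rho).
have ae_le : {ae mu, forall x : 'rV[R]_n, `|x - q| < rho ->
    'D_(f q) (lin_coords c \o (g \o clamp_rV q r)) x -
    'D_(g q) (lin_coords c \o (f \o clamp_rV q r)) x <= M'}.
  move: ae_Diff; apply: filterS => x xD xrho.
  have xr : `|x - q| < r by exact: lt_le_trans rhor.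
  have Dx := xD xr; have [[xO df] [_ dg]] := Dx.
  have [Ox _ _] := fgC (ltW xr); have [Oq _ _] := fgC qq.
  rewrite !Dl// -linearB.
  rewrite (linear_split ('d g x) ('d f x) _ _ (f x) (g x)) -/(lie_bracket f g x).
  rewrite (linearD (lin_coords c)); apply: lerD; first exact: DM.
  rewrite (le_trans (ler_norm _))// (le_trans (lin_coords_bound _ _))// ler_wpM2l//.
  rewrite (le_trans (ler_normB _ _))//.
  have e1 : `|'d g x (f q - f x)| <= K * (K * rho).
    rewrite (le_trans (diff_bound _ K0 gK xO dg))// ler_wpM2l//.
    by rewrite (le_trans (fK _ _))// ler_wpM2l// distrC ltW.
  have e2 : `|'d f x (g q - g x)| <= K * (K * rho).
    rewrite (le_trans (diff_bound _ K0 fK xO df))// ler_wpM2l//.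
    by rewrite (le_trans (gK _ _))// ler_wpM2l// distrC ltW.
  by rewrite (_ : 2 * _ * _ = K * (K * rho) + K * (K * rho)) ?lerD//; ring.
have tab : t * (`|f q| + `|g q|) < rho.
  apply: le_lt_trans trho; rewrite ler_wpM2l ?(ltW t0)//.
  by rewrite (_ : 2 * C = C + C) ?lerD//; ring.
have circ_bracket N : (0 < N)%N ->
    circulation (lin_coords c \o (g \o clamp_rV q r)) (lin_coords c \o (f \o clamp_rV q r))
      (f q) (g q) t N q = lin_coords c (bracket_sum f g t N q).
  move=> N0; rewrite /circulation /bracket_sum linear_sum/= mulr_sumr.
  have N0' : 0 < N%:R :> R by rewrite ltr0n.
  have cid (s1 s2 : R) : 0 <= s1 <= t -> 0 <= s2 <= t ->
      clamp_rV q r (q + s1 *: f q + s2 *: g q) = q + s1 *: f q + s2 *: g q.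
    move=> /andP[s10 s1t] /andP[s20 s2t]; rewrite clamp_rV_id ?ltW//.
    have -> : q + s1 *: f q + s2 *: g q - q = s1 *: f q + s2 *: g q.
      by apply/rowP => i; rewrite !mxE; ring.
    rewrite (le_lt_trans (ler_normD _ _))//.
    apply: lt_le_trans rhor; apply: le_lt_trans tab.
    rewrite !normrZ !ger0_norm// mulrDr.
    by rewrite lerD// ler_wpM2r.
  have cid1 (s1 : R) : 0 <= s1 <= t -> clamp_rV q r (q + s1 *: f q) = q + s1 *: f q.
    move=> s1t; have := cid s1 0 s1t; rewrite scale0r addr0 lexx (ltW t0).
    by apply.
  have cid2 (s2 : R) : 0 <= s2 <= t -> clamp_rV q r (q + s2 *: g q) = q + s2 *: g q.
    move=> s2t; have := cid 0 s2; rewrite scale0r addr0 lexx (ltW t0).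
    by apply.
  apply: eq_bigr => j _ /=.
  have jt : 0 <= j%:R * (t / N%:R) <= t.
    rewrite mulr_ge0 ?ler0n ?divr_ge0 ?(ltW t0) ?(ltW N0')//=.
    rewrite mulrCA -[leRHS]mulr1 ler_wpM2l ?(ltW t0)//.
    by rewrite ler_pdivrMr// mul1r ler_nat ltnW.
  have tt : 0 <= t <= t by rewrite lexx (ltW t0).
  by rewrite !cid// cid1// cid2// lin_coords_rectangle.
have [_ exp_t] := Psi_expansion fK gK K0 r0 fgC T0 T1 KT CT.
apply/ler_addgt0Pr => e e0.
have e20 : 0 < e / 2 by rewrite divr_gt0.
have av := averaging mu_fin mu_pos mu_tr (lc _ gK) (lc _ fK) t0 tab e20 ae_le.
pose A := Nc * (t * (K * (4 * C * t))).
have A0 : 0 <= A by rewrite !mulr_ge0// ltW.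
have eA : 0 < e / 2 / (A + 1) by rewrite divr_gt0// ltr_wpDl.
have [N [/= H1 H2]] := @filter_ex _ _ _ _
  (filterI av (@near_infty_natSinv_lt R (PosNum eA))).
rewrite circ_bracket// in H1.
have {}H2 : A * N.+1%:R^-1 <= e / 2.
  have : N.+1%:R^-1 * (A + 1) < e / 2 by rewrite -ltr_pdivlMr ?ltr_wpDl.
  have : 0 < N.+1%:R^-1 :> R by rewrite invr_gt0.
  by rewrite mulrDr mulr1 [_ * A]mulrC => v0 H; apply/ltW/(le_lt_trans _ H); rewrite lerDl ltW.
have H3 := exp_t t N.+1 t0 tT isT.
have -> : Psi Omega f g t q - q = bracket_sum f g t N.+1 q +
    (Psi Omega f g t q - q - bracket_sum f g t N.+1 q).
  by rewrite [RHS]addrC subrK.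
have H4 := le_trans (ler_norm _) (lin_coords_bound c
  (Psi Omega f g t q - q - bracket_sum f g t N.+1 q)).
have H5 := ler_wpM2l Nc0 H3.
rewrite (linearD (lin_coords c)) (le_trans (lerD H1 (le_trans H4 H5)))//.
have -> : Nc * (t * (K * (40 * K * C * t ^+ 2 + 4 * C * (t / N.+1%:R)))) =
   t ^+ 2 * (Nc * (40 * K ^+ 2 * C * t)) + A * N.+1%:R^-1.
  by rewrite /A; ring.
rewrite (_ : t ^+ 2 * (M + _) = t ^+ 2 * M' + t ^+ 2 * (Nc * (40 * K ^+ 2 * C * t))).
  rewrite addrA [X in X + _ <= _]addrAC -!addrA lerD2l lerD2l [leRHS]splitr lerD2l//.
by rewrite /M'; ring.
Qed.

End estimate.

Lemma norm_le_sqrt_sum (R : realType) n (p : 'rV[R]_n) :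
  `|p| <= Num.sqrt (\sum_i p 0 i ^+ 2).
Proof.
apply/rV_norm_leP => [|i]; first exact: sqrtr_ge0.
rewrite -sqrtr_sqr ler_wsqrtr// (bigD1 i)//= lerDl.
by apply: sumr_ge0 => j _; exact: sqr_ge0.
Qed.

Lemma l1_norm_le_sqrt_sum (R : realType) n (p : 'rV[R]_n) :
  \sum_i `|p 0 i| <= n%:R * Num.sqrt (\sum_i p 0 i ^+ 2).
Proof.
rewrite -[n in n%:R]card_ord mulr_natl -sumr_const; apply: ler_sum => i _.
exact: le_trans (rV_coord_le p i) (norm_le_sqrt_sum p).
Qed.

(** The functional with coefficients [p] takes at [p] the value of the squared
    Euclidean norm, and the sum of the [`|p i|] is at most [n] times the Euclidean
    norm. *)
Lemma lin_coords_le_norm (R : realType) n (p : 'rV[R]_n) (s : R) : 0 <= s ->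
  lin_coords (fun i => p 0 i) p <= (\sum_i `|p 0 i|) * s -> `|p| <= n%:R * s.
Proof.
move=> s0; have -> : lin_coords (fun i => p 0 i) p = \sum_i p 0 i ^+ 2.
  by apply: eq_bigr => i _; rewrite expr2.
set S := \sum_i p 0 i ^+ 2 => H.
have S0 : 0 <= S by apply: sumr_ge0 => i _; exact: sqr_ge0.
apply: le_trans (norm_le_sqrt_sum p) _; rewrite -/S.
have := l1_norm_le_sqrt_sum p; rewrite -/S => H1.
have sq := sqr_sqrtr S0; rewrite -sq in H.
have := sqrtr_ge0 S; rewrite le_eqVlt => /predU1P[<-|q0].
  by rewrite mulr_ge0.
rewrite -(ler_pM2l q0) -expr2 (le_trans H)// mulrA [_ * n%:R]mulrC.
exact: ler_wpM2r.
Qed.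

(** With [y] the projection of the quotient [a] on the set-valued bracket and [l]
    the functional with coefficients [p = a - y], all limit values [z] of the bracket
    satisfy [l z <= l y].  Hence [lin_coords_Psi] gives [l p <= small * \sum_i `|p i|],
    and [p] is small by [lin_coords_le_norm]. *)
Lemma bracket_estimate (R : realType) (n : nat) (Omega : set 'rV[R]_n)
    (f g : 'rV[R]_n -> 'rV[R]_n) (K C r T : R) (q : 'rV[R]_n) :
  lip_on Omega K f -> lip_on Omega K g -> 0 <= K -> 0 < r ->
  (forall x, `|x - q| <= r -> [/\ Omega x, `|f x| <= C & `|g x| <= C]) ->
  0 < T -> T < 1 -> K * T <= 1 / 2 -> 8 * C * T <= r ->
  compact (lie_bracket_set Omega f g q) /\
  forall e, 0 < e -> exists2 d, 0 < d & forall t, 0 < t -> t < d ->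
    exists2 z, lie_bracket_set Omega f g q z &
      `|(t ^+ 2)^-1 *: (Psi Omega f g t q - q) - z| <= e.
Proof.
move=> fK gK K0 r0 fgC T0 T1 KT CT.
have [mu [mu_fin mu_pos mu_tr]] := @exists_translation_invariant R n.
have bound := lie_bracket_bound fK gK K0 fgC.
have C0 : 0 <= C.
  have [|_ + _] := fgC q; first by rewrite subrr normr0 ltW.
  by apply: le_trans.
pose D := Diff Omega f `&` Diff Omega g.
pose S := limit_set D (lie_bracket f g) q.
have LE : lie_bracket_set Omega f g q = closure (convex_hull S) by [].
have cL : compact (closure (convex_hull S)) by exact: closed_hull_compact r0 bound.
have vL : convex_set (closure (convex_hull S) : set 'rV[R]_n).
  by apply: convex_closure; exact: convex_hull_convex.
have SL : S `<=` closure (convex_hull S) by exact: sub_closed_hull.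
have L0 : closure (convex_hull S) !=set0.
  have [rho rho0 H] := limit_set_near r0 bound (@ltr01 R).
  have [x Dx xq] := Diff_near_nonempty fK gK K0 r0 fgC mu_fin mu_pos mu_tr rho0.
  by have [z Sz _] := H x Dx xq; exists z; exact: SL.
rewrite LE; split => // e e0.
pose s := e / (n%:R + 1).
have s0 : 0 < s by rewrite divr_gt0// ltr_wpDl.
have ns : n%:R * s <= e.
  rewrite /s mulrCA -[leRHS]mulr1 ler_wpM2l ?(ltW e0)//.
  by rewrite ler_pdivrMr ?ltr_wpDl// mul1r lerDl.
have s3 : 0 < s / 3 by rewrite divr_gt0.
have [rho0 rho00 Hrho] := limit_set_near r0 bound s3.
have D1 : 0 < 2 * K ^+ 2 + 1 by rewrite ltr_wpDl// mulr_ge0// sqr_ge0.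
have D2 : 0 < 40 * K ^+ 2 * C + 1.
  by rewrite ltr_wpDl// !mulr_ge0// sqr_ge0.
pose rho := Num.min (Num.min r rho0) (s / 3 / (2 * K ^+ 2 + 1)).
have rho_gt0 : 0 < rho by rewrite !lt_min r0 rho00 divr_gt0.
have rhor : rho <= r by rewrite /rho !ge_min lexx.
have rhorho0 : rho <= rho0 by rewrite /rho !ge_min lexx orbT.
have rhos : 2 * K ^+ 2 * rho <= s / 3.
  have : rho <= s / 3 / (2 * K ^+ 2 + 1) by rewrite /rho ge_min lexx orbT.
  rewrite ler_pdivlMr// mulrDr mulr1 mulrC => /(le_trans _); apply.
  by rewrite lerDl ltW.
pose d := Num.min (Num.min T (rho / (2 * C + 1))) (s / 3 / (40 * K ^+ 2 * C + 1)).
have D3 : 0 < 2 * C + 1 by rewrite ltr_wpDl// mulr_ge0.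
have d0 : 0 < d by rewrite !lt_min T0 !divr_gt0.
exists d => // t t0; rewrite !lt_min => /andP[/andP[tT trho] ts].
have {}trho : t * (2 * C) < rho.
  move: trho; rewrite ltr_pdivlMr// mulrDr mulr1 => /(le_lt_trans _); apply.
  by rewrite lerDl ltW.
have {}ts : 40 * K ^+ 2 * C * t <= s / 3.
  move: ts; rewrite ltr_pdivlMr// mulrDr mulr1 mulrC => /ltW/(le_trans _); apply.
  by rewrite lerDl ltW.
set a := _ *: _.
have [y Ly yproj] := convex_projection a L0 cL vL.
exists y => //; apply: le_trans ns; apply: lin_coords_le_norm; first exact: ltW.
set p := a - y; pose c i := p 0 i; rewrite -/c.
set Nc := \sum_i _.
have Nc0 : 0 <= Nc by apply: sumr_ge0.
have DM x : D x -> `|x - q| < rho ->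
    lin_coords c (lie_bracket f g x) <= lin_coords c y + Nc * (s / 3).
  move=> Dx xq; have [z Sz xz] := Hrho x Dx (lt_le_trans xq rhorho0).
  have zy : lin_coords c z - lin_coords c y <= 0.
    by rewrite -(raddfB (lin_coords c)); exact: yproj (SL _ Sz).
  have xz' : lin_coords c (lie_bracket f g x) - lin_coords c z <= Nc * (s / 3).
    rewrite -(raddfB (lin_coords c)) (le_trans (ler_norm _))//.
    by rewrite (le_trans (lin_coords_bound _ _))// ler_wpM2l// ltW.
  by move: (Nc * _) zy xz' => m; lra.
have main := lin_coords_Psi fK gK K0 r0 fgC mu_fin mu_pos mu_tr rho_gt0 rhor DM
  T0 T1 KT CT t0 tT trho.
have t2 : 0 < t ^+ 2 by rewrite exprn_gt0.
have aE : lin_coords c a <= lin_coords c y + Nc * (s / 3) +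
    Nc * (2 * K ^+ 2 * rho + 40 * K ^+ 2 * C * t).
  rewrite /a linearZ/= -[_ *: _]/(_ * _) mulrC ler_pdivrMr// [leRHS]mulrC.
  exact: main.
have -> : lin_coords c p = lin_coords c a - lin_coords c y by exact: (raddfB (lin_coords c)).
rewrite lerBlDr (le_trans aE)// -addrA [leRHS]addrC lerD2l -mulrDr ler_wpM2l//.
lra.
Qed.

(** * From the quotient to the QDQ *)

Lemma edist_inf_le (R : realType) (V : normedModType R) (A : set V) (a z : V)
    (e : R) : A z -> `|a - z| <= e -> (edist_inf A a <= e%:E)%E.
Proof.
move=> Az aze; apply: (le_trans (edist_inf_triangle A a z)).
rewrite edist_inf0// adde0; apply/lee_addgt0Pr => r r0.
rewrite -EFinD; apply: edist_fin.
  by rewrite ltr_wpDl// (le_trans _ aze).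
by rewrite -ball_normE/= (le_lt_trans aze)// ltrDl.
Qed.

Section quotient_modulus.
Context (R : realType) (V : normedModType R) (Lambda : set V) (Q : R -> V).
Variable d1 : R.
Hypothesis close1 : forall t, 0 < t -> t < d1 ->
  exists2 z, Lambda z & `|Q t - z| <= 1.

(** The infimum of this set is nondecreasing in [s], as a modulus must be; it is
    meant for quotients at the times [t] with [t ^+ 2 < s]. *)
Definition uniform_dist_bounds (s : R) : set R :=
  [set e | 0 <= e /\ forall t, 0 < t -> t ^+ 2 < s -> t < d1 ->
    exists2 z, Lambda z & `|Q t - z| <= e].

Let E := uniform_dist_bounds.

Let E1 s : E s 1. Proof. by split => // t t0 _; exact: close1. Qed.

Let lbE s : lbound (E s) 0. Proof. by move=> e []. Qed.

Lemma inf_dist_bounds_ge0 s : 0 <= inf (E s).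
Proof. by apply: lb_le_inf; [exists 1; exact: E1|exact: lbE]. Qed.

Lemma inf_dist_bounds_le s e : E s e -> inf (E s) <= e.
Proof. by apply: ge_inf; exists 0; exact: lbE. Qed.

Lemma inf_dist_bounds_mono s s' : s <= s' -> inf (E s) <= inf (E s').
Proof.
move=> ss'; apply: lb_le_inf; first by exists 1; exact: E1.
move=> e [e0 He]; apply: inf_dist_bounds_le; split => // t t0 ts.
by apply: He => //; exact: lt_le_trans ss'.
Qed.

Lemma edist_inf_dist_bounds s t : 0 < t -> t ^+ 2 < s -> t < d1 ->
  (edist_inf Lambda (Q t) <= (inf (E s))%:E)%E.
Proof.
move=> t0 ts td.
have H e : E s e -> (edist_inf Lambda (Q t) <= e%:E)%E.
  by move=> [_ /(_ t t0 ts td)[z Lz ze]]; exact: edist_inf_le ze.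
have fin : edist_inf Lambda (Q t) \is a fin_num.
  rewrite ge0_fin_numE ?edist_inf_ge0//; apply: le_lt_trans (H _ (E1 s)) _.
  exact: ltry.
rewrite -(fineK fin) lee_fin; apply: lb_le_inf; first by exists 1; exact: E1.
by move=> e Ee; rewrite -lee_fin fineK// H.
Qed.

End quotient_modulus.

Lemma sqr_lt (R : realType) (x y : R) : 0 <= y -> x ^+ 2 < y ^+ 2 -> x < y.
Proof. by move=> y0; rewrite !ltNge; apply: contra => yx; rewrite ler_pXn2r ?nnegrE// (le_trans y0). Qed.

Lemma continuous_scale (R : realType) (T : topologicalType) (V : normedModType R)
    (a : T -> R) (u : T -> V) :
  continuous a -> continuous u -> continuous (fun x => a x *: u x).
Proof. by move=> ca cu x; exact: cvgZ (ca x) (cu x). Qed.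

Lemma continuous_sub (R : realType) (T : topologicalType) (V : normedModType R)
    (u w : T -> V) :
  continuous u -> continuous w -> continuous (fun x => u x - w x).
Proof. by move=> cu cw x; exact: cvgB (cu x) (cw x). Qed.

(** On the ball of radius [delta] the quotient is evaluated at times [t] with
    [delta^2 <= t^2 < delta], which keeps it continuous in [eps] and within the modulus
    [inf (uniform_dist_bounds delta)] of [Lambda].  The remainder vanishes for
    [eps >= delta^2]; for smaller [eps] both [F - q] and [eps] times the quotient are at
    most [c * delta^2]. *)
Lemma QDQ_of_quotient (R : realType) n (F : R -> 'rV[R]_n) (Lambda : set 'rV[R]_n)
    (q : 'rV[R]_n) (C T : R) : compact Lambda -> 0 < T ->
  (forall s t, 0 <= s < T -> 0 <= t < T -> `|F s - F t| <= C * `|s - t|) ->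
  (forall e, 0 < e -> exists2 d, 0 < d & forall t, 0 < t -> t < d ->
    exists2 z, Lambda z & `|(t ^+ 2)^-1 *: (F t - q) - z| <= e) ->
  QDQ (fun eps : 'rV[R]_1 => [set F (Num.sqrt (eps 0 0))])
      0 q Lambda [set eps : 'rV[R]_1 | 0 <= eps 0 0].
Proof.
move=> cL T0 FC FL; split => //.
pose Q t := (t ^+ 2)^-1 *: (F t - q).
have [d1 d10 close1] := FL 1 ltr01.
have [c c0 Qc] : exists2 c, 0 <= c & forall t, 0 < t -> t < d1 -> `|Q t| <= c.
  have [M [_ /(_ (Num.max (M + 1) 0))]] := compact_bounded cL.
  rewrite lt_max ltrDl ltr01 => /(_ isT) LM.
  exists (Num.max (M + 1) 0 + 1); first by rewrite addr_ge0// le_max lexx orbT.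
  move=> t t0 td; have [z Lz Qz] := close1 t t0 td.
  rewrite -(subrK z (Q t)) addrC (le_trans (ler_normD _ _))// lerD//.
  exact: LM.
have FQ t : 0 < t -> F t = q + t ^+ 2 *: Q t.
  by move=> t0; rewrite scalerA mulfV ?sqrf_eq0 ?gt_eqF// scale1r addrC subrK.
have F0 : F 0 = q.
  apply/eqP; rewrite -subr_eq0 -normr_le0; apply/ler_addgt0Pr => e e0; rewrite add0r.
  have B0 : 0 < `|C| + c + 1 by rewrite ltr_wpDl// addr_ge0.
  pose b := Num.min (Num.min 1 T) (Num.min d1 (e / (`|C| + c + 1))).
  have b0 : 0 < b by rewrite !lt_min ltr01 T0 d10 divr_gt0.
  pose t := b / 2.
  have t0 : 0 < t by rewrite divr_gt0.
  have : t < b by rewrite /t ltr_pdivrMr// ltr_pMr// ltr1n.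
  rewrite !lt_min => /andP[/andP[t1 tT] /andP[td]].
  rewrite ltr_pdivlMr// => te.
  have h1 : `|F 0 - F t| <= `|C| * t.
    rewrite (le_trans (FC 0 t _ _)) ?lexx ?T0 ?(ltW t0)//.
    by rewrite sub0r normrN gtr0_norm// ler_wpM2r ?(ltW t0)// ler_norm.
  have h2 : `|F t - q| <= c * t.
    rewrite FQ// addrC addKr normrZ gtr0_norm ?exprn_gt0// mulrC.
    apply: ler_pM; rewrite ?Qc// ?exprn_ge0 ?(ltW t0)//.
    by rewrite expr2 ler_piMl ?(ltW t0)// ltW.
  rewrite -(subrK (F t) (F 0)) -addrA (le_trans (ler_normD _ _))//.
  rewrite (le_trans (lerD h1 h2))// -mulrDl mulrC (le_trans _ (ltW te))//.
  by rewrite ler_wpM2l ?(ltW t0)// lerDl.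
pose E := uniform_dist_bounds Lambda Q d1.
pose rho s := inf (E s) + 2 * c * s.
(* [delta < 1] gives [delta^2 < delta]; the other bounds make the times up to
   [sqrt delta] admissible for [FC] and [close1]. *)
pose dmax := Num.min (Num.min 1 (T ^+ 2)) (d1 ^+ 2).
exists dmax%:E, rho; split.
- by rewrite lte_fin !lt_min ltr01 !exprn_gt0.
- split => [s s0|s s' s0 ss'|].
  + by rewrite addr_ge0 ?inf_dist_bounds_ge0// !mulr_ge0.
  + by rewrite lerD ?inf_dist_bounds_mono// ler_wpM2l// mulr_ge0.
  + apply/cvgrPdist_lt => e e0.
    have e20 : 0 < e / 2 by rewrite divr_gt0.
    have [d d0 Hd] := FL _ e20.
    have D0 : 0 < 2 * c + 1 by rewrite ltr_wpDl// mulr_ge0.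
    have m0 : 0 < Num.min (d ^+ 2) (e / 2 / (2 * c + 1)).
      by rewrite lt_min exprn_gt0//= divr_gt0.
    near=> s.
    have s0 : 0 < s by near: s; exact: nbhs_right_gt.
    have : s < Num.min (d ^+ 2) (e / 2 / (2 * c + 1)).
      by near: s; exact: nbhs_right_lt.
    rewrite lt_min => /andP[sd].
    rewrite ltr_pdivlMr// mulrDr mulr1 => se.
    have Es : inf (E s) <= e / 2.
      apply: inf_dist_bounds_le => //; split; first exact: ltW.
      move=> t t0 ts _; apply: Hd => //.
      by apply: sqr_lt; rewrite ?(ltW d0)// (lt_trans ts).
    have := inf_dist_bounds_ge0 close1 s; rewrite -/(E s) => E0.
    rewrite sub0r normrN ger0_norm; last by rewrite addr_ge0// !mulr_ge0// ltW.
    by rewrite /rho [2 * c * s]mulrC; lra.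
- move=> del del0; rewrite lte_fin !lt_min => /andP[/andP[del1 delT] deld].
  pose tau := Num.sqrt del.
  have tau0 : 0 <= tau by exact: sqrtr_ge0.
  have tau2 : tau ^+ 2 = del by rewrite sqr_sqrtr ?ltW.
  have tauT : tau < T by apply: sqr_lt; rewrite ?tau2// ltW.
  (* [F] is only continuous on [0, T[; this extension makes the maps below
     continuous everywhere. *)
  pose G t := F `|clampR tau t|.
  have GF t : 0 <= t <= tau -> G t = F t.
    by move=> /andP[t0 tt]; rewrite /G clampR_id ger0_norm.
  have cG : continuous G.
    apply: (@lip_with_continuous _ _ _ `|C|) => s t.
    have cl u : 0 <= `|clampR tau u| < T.
      by rewrite normr_ge0 (le_lt_trans (clampR_norm _ _)).
    rewrite (le_trans (FC _ _ (cl s) (cl t)))//.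
    rewrite (@le_trans _ _ (`|C| * `| `|clampR tau s| - `|clampR tau t| |))//.
      by rewrite ler_wpM2r// ler_norm.
    rewrite ler_wpM2l// (le_trans (ler_dist_dist _ _))//.
    exact: clampR_lip.
  pose eps (x : 'rV[R]_1) := x 0 0.
  pose m (x : 'rV[R]_1) := Num.max (eps x) (del ^+ 2).
  have d2 : 0 < del ^+ 2 by rewrite exprn_gt0.
  have m0 x : 0 < m x by rewrite lt_max d2 orbT.
  have ceps : continuous eps by exact: coord_continuous.
  have cm : continuous m.
    apply: (@lip_with_continuous _ _ _ 1) => x y; rewrite mul1r.
    have := rV_coord_le (x - y) 0; rewrite !mxE -/(eps x) -/(eps y).
    move=> /(le_trans _); apply; rewrite /m.
    case: (leP (eps x) _) => h1; case: (leP (eps y) _) => h2;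
      rewrite ?subrr ?normr0//.
    + rewrite distrC [leRHS]distrC !ger0_norm; lra.
    + rewrite !ger0_norm; lra.
  pose L x : 'rV[R]_n := (m x)^-1 *: (G (Num.sqrt (m x)) - q).
  pose h x := G (Num.sqrt (eps x)) - q - eps x *: L x.
  have cGs (a : 'rV[R]_1 -> R) : continuous a -> continuous (fun x => G (Num.sqrt (a x)) - q).
    move=> ca; apply: (continuous_sub (w := cst q)); last exact: cst_continuous.
    move=> x; apply: continuous_comp; last exact: cG.
    by apply: continuous_comp; [exact: ca|exact: sqrt_continuous].
  have cLx : continuous L.
    apply: continuous_scale; last exact: cGs.
    move=> x; have mx0 : m x != 0 by rewrite gt_eqF.
    exact: cvgV mx0 (cm x).
  exists L, h; split.
    apply: continuous_subspaceT => x.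
    have ch : continuous h by apply: continuous_sub; [exact: cGs|exact: continuous_scale].
    exact: cvg_pair (cLx x) (ch x).
  move=> x [xdel /= x0]; rewrite -/(eps x) in x0 *.
  have {xdel} xdel : eps x < del.
    move: xdel; rewrite -ball_normE/= sub0r normrN => /(rV_norm_ltP _ del0)/(_ 0).
    by apply: le_lt_trans; exact: ler_norm.
  have mdel : m x < del.
    by rewrite gt_max xdel expr2 -[ltRHS]mulr1 ltr_pM2l.
  have sq2 : Num.sqrt (m x) ^+ 2 = m x by rewrite sqr_sqrtr ?ltW.
  have sq0 : 0 < Num.sqrt (m x) by rewrite sqrtr_gt0.
  have sqd : Num.sqrt (m x) < d1.
    by apply: sqr_lt; rewrite ?(ltW d10)// sq2 (lt_trans mdel).
  have LQ : L x = Q (Num.sqrt (m x)).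
    rewrite /L /Q sq2 GF// (ltW sq0)/=.
    by apply/ltW/sqr_lt; rewrite ?sq2 ?tau2.
  have GFe : G (Num.sqrt (eps x)) = F (Num.sqrt (eps x)).
    by rewrite GF// sqrtr_ge0/= ler_sqrt ?ltW.
  split.
  + apply: (@le_trans _ _ (inf (E del))%:E).
      by rewrite LQ; apply: edist_inf_dist_bounds => //; rewrite sq2.
    by rewrite lee_fin lerDl !mulr_ge0// ltW.
  + have hle : `|h x| <= 2 * c * del ^+ 2.
      rewrite /h GFe; have [le_d|gt_d] := leP (del ^+ 2) (eps x).
        have me : m x = eps x by rewrite /m max_l.
        have -> : F (Num.sqrt (eps x)) = q + eps x *: L x.
          by rewrite LQ me FQ ?sqrtr_gt0 ?(lt_le_trans d2)// sqr_sqrtr.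
        by rewrite [q + _]addrC addrK subrr normr0 !mulr_ge0// ltW.
      have e1 : `|F (Num.sqrt (eps x)) - q| <= c * del ^+ 2.
        have [e0|e0] := eqVneq (eps x) 0.
          by rewrite e0 sqrtr0 F0 subrr normr0 mulr_ge0// ltW.
        have {}e0 : 0 < eps x by rewrite lt0r e0.
        rewrite FQ ?sqrtr_gt0// addrC addKr sqr_sqrtr// normrZ ger0_norm// mulrC.
        apply: ler_pM => //; last exact: ltW.
        apply: Qc; rewrite ?sqrtr_gt0//.
        by rewrite (le_lt_trans _ sqd)// ler_sqrt ?(ltW (m0 x))// /m le_max lexx.
      have e2 : `|eps x *: L x| <= c * del ^+ 2.
        rewrite normrZ ger0_norm// mulrC; apply: ler_pM => //; last exact: ltW.
        by rewrite LQ Qc.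
      rewrite (le_trans (ler_normB _ _))//.
      by rewrite (_ : 2 * c * _ = c * del ^+ 2 + c * del ^+ 2) ?lerD//; ring.
    rewrite (le_trans hle)// expr2 mulrA mulrC ler_wpM2l ?(ltW del0)//.
    by rewrite lerDr inf_dist_bounds_ge0.
  + rewrite subr0 /= {1}[x]mx11_scalar mul_scalar_mx -/(eps x) /h GFe.
    by rewrite [_ - _ - _]addrC addrA addrK addrC subrK.
Unshelve. all: by end_near.
Qed.

Lemma lipschitz_lip_on (R : realType) (V W : normedModType R) (A : set V)
    (f : V -> W) : [lipschitz f x | x in A] ->
  exists2 K, 0 <= K & forall K', K <= K' -> lip_on A K' f.
Proof.
move=> [M [_ HM]]; exists (`|M| + 1); first by rewrite addr_ge0.
move=> K' MK x y Ax Ay; have MK' : M < K'.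
  by apply: lt_le_trans MK; rewrite ltr_pwDr// ler_norm.
by have := HM _ MK' (x, y); apply; split.
Qed.

Theorem propositionV1 (R : realType) (n : nat) (Omega : set 'rV[R]_n)
    (f g : 'rV[R]_n -> 'rV[R]_n) (q : 'rV[R]_n)
    (Omega_compact : compact Omega)
    (f_lip : [lipschitz f x | x in Omega])
    (g_lip : [lipschitz g x | x in Omega])
    (q_int : interior Omega q) :
  QDQ (fun eps : 'rV[R]_1 => [set Psi Omega f g (Num.sqrt (eps 0 0)) q])
      0 q (lie_bracket_set Omega f g q) [set eps : 'rV[R]_1 | 0 <= eps 0 0].
Proof.
have [Kf Kf0 fL] := lipschitz_lip_on f_lip.
have [Kg Kg0 gL] := lipschitz_lip_on g_lip.
pose K := Num.max Kf Kg.
have K0 : 0 <= K by rewrite le_max Kf0.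
have fK : lip_on Omega K f by apply: fL; rewrite le_max lexx.
have gK : lip_on Omega K g by apply: gL; rewrite le_max lexx orbT.
have [r0 /= r0_gt0 qO] := (nbhs_ballP _ _).1 q_int.
pose r := r0 / 2.
have r_gt0 : 0 < r by rewrite divr_gt0.
have {}qO x : `|x - q| <= r -> Omega x.
  move=> xr; apply: qO; rewrite -ball_normE/= distrC (le_lt_trans xr)//.
  by rewrite /r ltr_pdivrMr// ltr_pMr// ltr1n.
have Oq : Omega q by apply: qO; rewrite subrr normr0 ltW.
pose C := `|f q| + `|g q| + K * r.
have C0 : 0 <= C by rewrite !addr_ge0// mulr_ge0// ltW.
have growth (u : 'rV[R]_n -> 'rV[R]_n) x : lip_on Omega K u -> `|x - q| <= r ->
    `|u x| <= `|u q| + K * r.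
  move=> uK xr; rewrite -(subrK (u q) (u x)) addrC (le_trans (ler_normD _ _))//.
  by rewrite lerD2l (le_trans (uK _ _ (qO _ xr) Oq))// ler_wpM2l.
have fgC x : `|x - q| <= r -> [/\ Omega x, `|f x| <= C & `|g x| <= C].
  move=> xr; split; first exact: qO.
    by rewrite (le_trans (growth _ _ fK xr))// lerD2r lerDl.
  by rewrite (le_trans (growth _ _ gK xr))// lerD2r lerDr.
pose T := Num.min (1 / 2) (Num.min (1 / 2 / (K + 1)) (r / (8 * C + 1))).
have C1 : 0 < 8 * C + 1 by rewrite ltr_wpDl// mulr_ge0.
have K1 : 0 < K + 1 by rewrite ltr_wpDl.
have T0 : 0 < T by rewrite !lt_min !divr_gt0.
have T1 : T < 1 by rewrite gt_min; apply/orP; left; lra.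
have KT : K * T <= 1 / 2.
  have : T <= 1 / 2 / (K + 1) by rewrite !ge_min lexx orbT.
  rewrite ler_pdivlMr// mulrDr mulr1 mulrC => /(le_trans _); apply.
  by rewrite lerDl ltW.
have CT : 8 * C * T <= r.
  have : T <= r / (8 * C + 1) by rewrite !ge_min lexx !orbT.
  rewrite ler_pdivlMr// mulrDr mulr1 mulrC => /(le_trans _); apply.
  by rewrite lerDl ltW.
have [cL estimate] := bracket_estimate fK gK K0 r_gt0 fgC T0 T1 KT CT.
have [Psi_lip _] := Psi_expansion fK gK K0 r_gt0 fgC T0 T1 KT CT.
exact: QDQ_of_quotient cL T0 Psi_lip estimate.
Qed.
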